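(* Let $\eta$ be a Poisson process on a measurable space $(\mathbb{X},\mathcal{X})$ with $\sigma$-finite intensity measure $\mu$. Let $p\ge 2$ and $F\in L^1(\mathbb{P}_\eta)$. Then $$\lVert (F-\mathbb{E}[F])_+\rVert_p\le\sqrt{2\kappa p\,\lVert V^+\rVert_{p/2}}=\sqrt{2\kappa p}\,\lVert\sqrt{V^+}\rVert_p,$$ $$\lVert (F-\mathbb{E}[F])_-\rVert_p\le\sqrt{2\kappa p\,\lVert V^-\rVert_{p/2}}=\sqrt{2\kappa p}\,\lVert\sqrt{V^-}\rVert_p,$$ $$\lVert F-\mathbb{E}[F]\rVert_p\le\sqrt{8\kappa p\,\lVert V\rVert_{p/2}}=\sqrt{8\kappa p}\,\lVert\sqrt{V}\rVert_p,$$ where $\kappa:=\frac{\sqrt{e}}{2(\sqrt{e}-1)}$.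
   Context: Let $\mathsf{N}(\mathbb{X})$ be the space of $\sigma$-finite counting measures on $(\mathbb{X},\mathcal{X})$, equipped with the smallest $\sigma$-field making all maps $\xi\mapsto\xi(B)$, $B\in\mathcal{X}$, measurable. A point process is a measurable map from a fixed probability space $(\Omega,\mathcal{F},\mathbb{P})$ to $\mathsf{N}(\mathbb{X})$. A Poisson process $\eta$ with $\sigma$-finite intensity measure $\mu$ is a point process such that $\eta(B)$ is Poisson distributed with mean $\mu(B)$ for all $B\in\mathcal{X}$, and $\eta(B_1),\dots,\eta(B_n)$ are independent for pairwise disjoint $B_1,\dots,B_n\in\mathcal{X}$. A Poisson functional is a random variable $F$ with $F=f(\eta)$ $\mathbb{P}$-almost surely for some measurable $f:\mathsf{N}(\mathbb{X})\to\mathbb{R}$ (a representative of $F$). $L^p(\mathbb{P}_\eta)$ is the space of Poisson functionals $F$ with $\mathbb{E}|F|^p<\infty$. We write $F(\eta)=f(\eta)$, $F(\eta-\delta_x)=f(\eta-\delta_x)$, and the difference operator is $D_xF:=f(\eta+\delta_x)-f(\eta)$, where $\delta_x$ is the Dirac measure at $x\in\mathbb{X}$. Notation: $x_+:=\max\{0,x\}$ and $x_-:=\min\{0,x\}$ for $x\in\mathbb{R}$, with $(y)_\pm^2:=((y)_\pm)^2$; $\lVert F\rVert_p:=(\mathbb{E}[|F|^p])^{1/p}$ for $p>0$. Moreover, $$V^+:=\int_{\mathbb{X}}(D_xF)_-^2\,\mu(\mathrm{d}x)+\int_{\mathbb{X}}(F(\eta)-F(\eta-\delta_x))_+^2\,\eta(\mathrm{d}x),$$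 $$V^-:=\int_{\mathbb{X}}(D_xF)_+^2\,\mu(\mathrm{d}x)+\int_{\mathbb{X}}(F(\eta)-F(\eta-\delta_x))_-^2\,\eta(\mathrm{d}x),$$ $$V:=\int_{\mathbb{X}}(D_xF)^2\,\mu(\mathrm{d}x)+\int_{\mathbb{X}}(F(\eta)-F(\eta-\delta_x))^2\,\eta(\mathrm{d}x).$$ *)

(* Defs.v *)
From HB Require Import structures.
From mathcomp Require Import all_boot all_order all_algebra.
From mathcomp Require Import all_classical all_reals all_analysis.
From mathcomp Require Import measurable_realfun.

Set Implicit Arguments.
Unset Strict Implicit.
Unset Printing Implicit Defensive.
Import Order.TTheory GRing.Theory Num.Theory.
Import numFieldNormedType.Exports.

Local Open Scope classical_set_scope.
Local Open Scope ring_scope.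
Local Open Scope ereal_scope.

(* Generators of the smallest sigma-field on T making all the maps
   t |-> val t B, with B measurable, measurable. *)
Definition evaluations d (X : measurableType d) (R : realType) (T : Type)
    (val : T -> set X -> \bar R) : set_system T :=
  \bigcup_(B in measurable)
    preimage_set_system [set: T] (fun t => val t B) measurable.

Record counting_space d (X : measurableType d) (R : realType) :=
  CountingSpace {
    counting_val :> {measure set X -> \bar R} ;
    counting_valued : forall B, measurable B ->
      counting_val B = +oo \/ exists n : nat, counting_val B = n%:R%:E ;
    counting_sigma_finite : sigma_finite [set: X] counting_val }.

Section counting_space_theory.
Context d (X : measurableType d) (R : realType).
Local Notation N := (counting_space X R).

Let zero_valued (B : set X) : measurable B ->
  (mzero : {measure set X -> \bar R}) B = +oo \/
  exists n : nat, (mzero : {measure set X -> \bar R}) B = n%:R%:E.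
Proof. by move=> _; right; exists 0%N. Qed.

Let zero_sigma_finite :
  sigma_finite [set: X] (mzero : {measure set X -> \bar R}).
Proof.
exists (fun=> [set: X]); first by rewrite bigcup_const.
by move=> _; split; [exact: measurableT | exact: ltry].
Qed.

HB.instance Definition _ := gen_eqMixin N.
HB.instance Definition _ := gen_choiceMixin N.
HB.instance Definition _ :=
  isPointed.Build N (CountingSpace zero_valued zero_sigma_finite).

Definition counting_display : measure_display.
Proof. by constructor. Qed.

Let counting_measurable : set (set N) :=
  <<s evaluations (fun xi : N => counting_val xi : set X -> \bar R) >>.

Let counting_measurable0 : counting_measurable set0.
Proof. exact: sigma_algebra0. Qed.

Let counting_measurableC (U : set N) :
  counting_measurable U -> counting_measurable (~` U).
Proof. exact: sigma_algebraC. Qed.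

Let counting_measurableU (F : (set N)^nat) :
  (forall i, counting_measurable (F i)) ->
  counting_measurable (\bigcup_i (F i)).
Proof. exact: sigma_algebra_bigcup. Qed.

HB.instance Definition _ :=
  @isMeasurable.Build counting_display N counting_measurable
    counting_measurable0 counting_measurableC counting_measurableU.

Section add_dirac.
Variables (xi : N) (x : X).

Let add_val : {measure set X -> \bar R} :=
  measure_add xi (dirac x : {measure set X -> \bar R}).

Let add_valE B : add_val B = xi B + \d_x B.
Proof. exact: measure_addE. Qed.

Let add_valued (B : set X) : measurable B ->
  add_val B = +oo \/ exists n : nat, add_val B = n%:R%:E.
Proof.
move=> mB; rewrite add_valE diracE.
have [->|[n ->]] := counting_valued xi mB; first by left.
by right; exists (n + (x \in B))%N; rewrite -EFinD natrD.
Qed.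

Let add_sigma_finite : sigma_finite [set: X] add_val.
Proof.
have [F XF mF] := counting_sigma_finite xi.
exists F => // i; have [mFi Fioo] := mF i; split => //.
by rewrite add_valE lte_add_pinfty// diracE ltry.
Qed.

Definition add_dirac : N := CountingSpace add_valued add_sigma_finite.

Lemma add_diracE B : add_dirac B = xi B + \d_x B.
Proof. exact: measure_addE. Qed.

End add_dirac.

(* xi - \d_x is in general only a set function, so f (xi - \d_x) is read as
   the value of a measurable extension of f to all set functions, the latter
   with the sigma-field generated by the evaluations at measurable sets.  Such
   an extension always exists (extend_counting_spec), and
   - it gives f zeta as soon as xi - \d_x agrees on the measurable sets with
     some zeta : N, in particular at every atom x_i of xi = \sum_i \d_(x_i)
     (eval_sub_diracE);
   - it is measurable in (xi, x), which a case distinction on whether xi - \d_x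
     is a measure need not be, since { x | \d_x <= xi } may be nonmeasurable;
   - for every xi, whether a sum of Dirac masses or not, and xi-almost every x,
     its value does not depend on the choice of the extension: an extension
     involves only countably many sets, on which xi - \d_x coincides with some
     element of N. *)
Definition set_function := g_sigma_algebraType
  (evaluations (fun m : set X -> \bar R => m)).

Definition is_extension (f : N -> R) (g : set_function -> R) :=
  measurable_fun [set: set_function] g /\
  forall xi : N, g (xi : set X -> \bar R) = f xi.

Definition extend_counting (f : N -> R) : set_function -> R :=
  xget (cst 0%R) [set g | is_extension f g].

Definition eval_sub_dirac (f : N -> R) (xi : N) (x : X) : R :=
  extend_counting f (fun B => xi B - \d_x B).

Let measurable_N_preimage (U : set N) : measurable U ->
  exists2 W : set set_function, measurable W &
    U = [set xi : N | W (xi : set X -> \bar R)].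
Proof.
pose v (xi : N) : set_function := counting_val xi : set X -> \bar R.
pose G := preimage_set_system [set: N] v measurable.
have GU : <<s evaluations (fun xi : N => counting_val xi : set X -> \bar R) >>
    `<=` G.
  apply: smallest_sub; first exact/sigma_algebra_preimage/sigma_algebra_measurable.
  move=> _ [B mB [Y mY <-]].
  exists [set m : set_function | Y ((m : set X -> \bar R) B)] => //.
  apply: sub_sigma_algebra; exists B => //; exists Y => //.
  by rewrite setTI.
by move=> /GU [W mW <-]; exists W => //; rewrite setTI.
Qed.

Lemma extend_counting_spec (f : N -> R) : measurable_fun [set: N] f ->
  is_extension f (extend_counting f).
Proof.
move=> mf; suff [g fg] : exists g, is_extension f g by exact: (xgetI _ fg).
have /choice[A] : forall q : rat, exists W : set set_function, measurable W /\
    forall xi : N, W (xi : set X -> \bar R) <-> (f xi < ratr q)%R.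
  move=> q; have mU : measurable [set xi : N | (f xi < ratr q)%R].
    have := mf measurableT _ (measurable_itv `]-oo, (ratr q : R)[).
    rewrite setTI (_ : f @^-1` _ = [set xi : N | (f xi < ratr q)%R])//.
  have [W mW UW] := measurable_N_preimage mU.
  exists W; split => // xi.
  by rewrite -[X in X <-> _]/([set xi : N | W (xi : set X -> \bar R)] xi) -UW.
move=> /all_and2[mA Af].
pose h (n : nat) (m : set_function) : \bar R :=
  if unpickle n is Some q then (if m \in A q then (ratr q)%:E else +oo) else +oo.
have mh n : measurable_fun [set: set_function] (h n).
  rewrite /h; case: (unpickle n) => [q|]; last exact: measurable_cst.
  apply: measurable_fun_ifT => //.
  apply: (measurable_fun_bool true); rewrite setTI.
  rewrite (_ : _ @^-1` _ = A q)//; apply/seteqP; split=> m /=; first exact: set_mem.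
  exact: mem_set.
exists (fun m => fine (einfs (h ^~ m) 0%N)); split.
  apply: measurableT_comp; first exact: fine_measurable.
  exact: measurable_fun_einfs.
move=> xi; suff -> : einfs (h ^~ (xi : set X -> \bar R)) 0%N = (f xi)%:E by [].
apply/eqP; rewrite eq_le; apply/andP; split.
  apply/lee_addgt0Pr => e e0.
  have [q /andP[fq qe]] : exists q, ((f xi < ratr q) && (ratr q < f xi + e))%R.
    have /rat_in_itvoo[q] : (f xi < f xi + e)%R by rewrite ltrDl.
    by rewrite in_itv /= => ?; exists q.
  apply: (@le_trans _ _ (ratr q)%:E); last by rewrite -EFinD lee_fin ltW.
  apply: ereal_inf_lbound; exists (pickle q) => //.
  rewrite /h pickleK; case: ifPn => //; rewrite notin_setE => /(_ ((Af q xi).2 fq)).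
  by [].
apply: le_ereal_inf_tmp => _ [n _ <-]; rewrite /h.
case: (unpickle n) => [q|]; last exact: leey.
case: ifPn => [|_]; last exact: leey.
by rewrite inE => /Af fq; rewrite lee_fin ltW.
Qed.

Lemma eval_sub_diracE (f : N -> R) (xi zeta : N) (x : X) :
  measurable_fun [set: N] f ->
  (forall B, measurable B -> xi B = zeta B + \d_x B) ->
  eval_sub_dirac f xi x = f zeta.
Proof.
move=> /extend_counting_spec[mg fg] xiE; rewrite /eval_sub_dirac -fg.
pose m1 : set_function := fun B => xi B - \d_x B.
pose m2 : set_function := zeta : set X -> \bar R.
rewrite -[LHS]/(extend_counting f m1) -[RHS]/(extend_counting f m2).
have m12 B : measurable B -> (m1 : set X -> \bar R) B = (m2 : set X -> _) B.
  by move=> mB; rewrite /m1 xiE// addeK// diracE.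
have sub (U : set set_function) : measurable U -> U m1 <-> U m2.
  have : <<s evaluations (fun m : set X -> \bar R => m) >> `<=`
      [set U | U m1 <-> U m2].
    apply: smallest_sub; last first.
      by move=> _ [B mB [Y mY <-]]; rewrite !setTI /= m12.
    split => //= [V|F] /=.
    - by move=> VE; split=> -[_ nV]; split=> // /VE.
    - move=> FE; split=> -[i _ Fi]; exists i => //; exact/FE.
  by move=> + mU => /(_ _ mU).
apply: esym.
have := sub _ (mg measurableT _ (measurable_set1 (extend_counting f m1))).
by rewrite !setTI /= => -[+ _]; exact.
Qed.

End counting_space_theory.

Section poisson_process.
Context d (X : measurableType d) d' (Omega : measurableType d') (R : realType).
Local Notation N := (counting_space X R).

Implicit Type P : probability Omega R.

(* An infinite mean is allowed: eta B is then infinite almost surely.  The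
   second argument of poisson_prob is a dummy, and poisson_prob 0 is the Dirac
   mass at 0. *)
Definition poisson_distributed P (Y : Omega -> \bar R) (m : \bar R) :=
  if m == +oo then P [set w | Y w = +oo] = 1
  else forall k : nat,
    P [set w | Y w = k%:R%:E] = poisson_prob (fine m) 0%N [set k].

(* The sets A i are arbitrary, in particular they may be [set: \bar R]; hence
   the product rule for subfamilies is included. *)
Definition mutually_independent P (n : nat) (Y : 'I_n -> Omega -> \bar R) :=
  forall A : 'I_n -> set \bar R, (forall i, measurable (A i)) ->
    P (\bigcap_i (Y i @^-1` A i)) = \prod_(i < n) P (Y i @^-1` A i).

Record is_poisson_process P (mu : {measure set X -> \bar R})
    (eta : Omega -> N) : Prop := {
  poisson_process_measurable : measurable_fun [set: Omega] eta ;
  poisson_process_distributed : forall B, measurable B ->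
    poisson_distributed P (fun w => eta w B) (mu B) ;
  poisson_process_independent : forall n (B : 'I_n -> set X),
    (forall i, measurable (B i)) -> trivIset [set: 'I_n] B ->
    mutually_independent P (fun i w => eta w (B i)) }.

Definition is_representative P (eta : Omega -> N) (F : Omega -> R)
    (f : N -> R) :=
  measurable_fun [set: N] f /\ {ae P, forall w, F w = f (eta w)}.

End poisson_process.

Section variation.
Context (R : realType).

Definition pos_part (x : R) : R := Num.max 0%R x.

(* Nonpositive: this is min(0, x), not the library's max(- x, 0). *)
Definition neg_part (x : R) : R := Num.min 0%R x.

Context d (X : measurableType d).
Local Notation N := (counting_space X R).
Variables (mu : {measure set X -> \bar R}) (f : N -> R) (xi : N).

Definition add_cost (x : X) : R := (f (add_dirac xi x) - f xi)%R.

Definition remove_cost (x : X) : R := (f xi - eval_sub_dirac f xi x)%R.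

Definition Vplus : \bar R :=
  \int[mu]_x ((neg_part (add_cost x)) ^+ 2)%:E +
  \int[xi]_x ((pos_part (remove_cost x)) ^+ 2)%:E.

Definition Vminus : \bar R :=
  \int[mu]_x ((pos_part (add_cost x)) ^+ 2)%:E +
  \int[xi]_x ((neg_part (remove_cost x)) ^+ 2)%:E.

Definition Vfull : \bar R :=
  \int[mu]_x ((add_cost x) ^+ 2)%:E + \int[xi]_x ((remove_cost x) ^+ 2)%:E.

End variation.

Definition kappa (R : realType) : R :=
  (Num.sqrt (expR 1) / (2 * (Num.sqrt (expR 1) - 1)))%R.

(* Main.v *)
Require Import Defs.
From HB Require Import structures.
From mathcomp Require Import all_boot all_order all_algebra.
From mathcomp Require Import all_classical all_reals all_analysis.
From mathcomp Require Import measurable_realfun.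
From mathcomp Require Import ring lra.

Set Implicit Arguments.
Unset Strict Implicit.
Unset Printing Implicit Defensive.
Import Order.TTheory GRing.Theory Num.Theory.
Import numFieldNormedType.Exports.

Local Open Scope classical_set_scope.
Local Open Scope ring_scope.
Local Open Scope ereal_scope.

(** The proof compares two copies of the Poisson process that share part of
    their points.  Let first the intensity measure [nu] be finite, and let
    [P a] be the operator that averages a functional over an added Poisson
    process of intensity [a * nu]; these operators form a semigroup
    ([poisson_opD]).  For bounded nonnegative functionals [F] and [G] the
    function
    [C s = P s (P (1 - s) G * P (1 - s) F)]
    is the mean of [G] at one copy times [F] at another, where the two copies
    share points of intensity [s * nu] and are otherwise independent.  It goes
    from the product of the means of [G] and [F] at [s = 0] to the mean of
    [G * F] at [s = 1].  Its derivative is governed by the products of the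
    increments of [P (1 - s) G] and [P (1 - s) F] caused by one added point
    ([poisson_op_small_cov]), and such a product is at most that of the averaged
    increases plus that of the averaged decreases.

    If the increments of [G] are at most [c * phi] times those of [F], then the
    derivative is a mean of [c * phi] times products of two increments of [F].
    The inequality between the arithmetic and the geometric mean turns these
    products into squares, and the Mecke formula ([poisson_op_mecke]) turns the
    squared increase caused by an added point into the squared decrease caused
    by removing a point.  This produces exactly the two integrals in the
    variation [V], evaluated at one copy, times [phi], evaluated at the same or
    at the other copy.  In the Mecke formula a removed shared point costs a
    factor [1 / s]; weighting the two squares by [sqrt s] and its inverse makes
    the rate at most [c / sqrt s], whose integral over the unit interval is
    [2 * c].  Hence the covariance of [F] and [G] is at most [2 * c] times a
    mean of [V * phi] ([poisson_covariance_le]).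

    With [G = (f - m)_+ `^ (p - 1)], [phi = (f - m)_+ `^ (p - 2)], [c = p - 1]
    and [F = f] up to a constant, Young's inequality separates [V] from [phi].
    If [y] is the [p]-norm of [(f - m)_+] and [v] the [(p / 2)]-norm of [V], the
    result is [y `^ p <= 2 * (p - 1) * v * y `^ (p - 2)], that is,
    [y ^+ 2 <= 2 * (p - 1) * v] ([bounded_moment]).  As [kappa >= 1], this is
    stronger than what is claimed.

    For a sigma-finite intensity measure the space is exhausted by sets [An n]
    of finite measure.  The points in [An n] may be replaced by an independent
    Poisson process ([resample]); given the other points, the covariance
    inequality applies.  It leaves the mean of a product of two averages that
    depend only on points outside [An n], and this converges to the product of
    the means ([tail_product_le]), by the argument for zero-one laws.

    Truncating [f] and its values at configurations with one point removed
    decreases all the increments, and Fatou's lemma yields the bound for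
    integrable functionals ([moment_bound]).  The inequality for the negative
    part is the one for the positive part of [- f], and the last one follows by
    the triangle inequality since [V] dominates both one-sided variations. *)

(** * Measurability on the space of counting measures *)

(** The domain of all the operators below: nonnegative measurable functions,
    with infinite values allowed, so that no integrability is ever at stake. *)
Definition nn_measurable d (Z : measurableType d) (R : realType)
    (h : Z -> \bar R) :=
  measurable_fun [set: Z] h /\ forall z, 0 <= h z.

Section counting_measurability.
Context d (X : measurableType d) (R : realType).
Local Notation N := (counting_space X R).

(** The proof fields of a counting measure are propositions. *)
Lemma counting_ext (xi zeta : N) : (forall B, xi B = zeta B) -> xi = zeta.
Proof.
case: xi zeta => [m mv ms] [m' mv' ms'] /= mm'.
have E : m = m' by apply: eq_measure; apply/funext.
by subst m'; congr CountingSpace; exact: Prop_irrelevance.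
Qed.

Lemma measurable_count (B : set X) : measurable B ->
  measurable_fun [set: N] (fun xi : N => xi B).
Proof.
move=> mB _ Y mY; rewrite setTI; apply: sub_sigma_algebra.
by exists B => //; exists Y => //; rewrite setTI.
Qed.

(** The sigma-field on counting measures is generated by the evaluations. *)
Lemma measurable_fun_counting d' (Z : measurableType d') (g : Z -> N) :
  (forall B, measurable B -> measurable_fun [set: Z] (fun z => g z B)) ->
  measurable_fun [set: Z] g.
Proof.
move=> mg; apply: (@measurability _ _ _ _ _ _
  (evaluations (fun xi : N => counting_val xi : set X -> \bar R))) => //.
move=> _ [U [B mB [Y mY <-]] <-].
by rewrite !setTI; have := mg B mB measurableT Y mY; rewrite setTI.
Qed.

Lemma measurable_dirac_fun (B : set X) : measurable B ->
  measurable_fun [set: X] (fun x => \d_x B : \bar R).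
Proof.
move=> mB; rewrite (_ : (fun x => _) = EFin \o \1_B); last first.
  by apply/funext => x; rewrite /= diracE indicE.
exact/measurable_EFinP/measurable_indic.
Qed.

Lemma measurable_add_dirac :
  measurable_fun [set: N * X] (fun q : N * X => add_dirac q.1 q.2).
Proof.
apply: measurable_fun_counting => B mB.
under eq_fun do rewrite add_diracE.
apply: emeasurable_funD.
  exact: (measurableT_comp (measurable_count mB) measurable_fst).
exact: (measurableT_comp (measurable_dirac_fun mB) measurable_snd).
Qed.

Lemma measurable_add_dirac2 d' (Z : measurableType d') (g1 : Z -> N) (g2 : Z -> X) :
  measurable_fun [set: Z] g1 -> measurable_fun [set: Z] g2 ->
  measurable_fun [set: Z] (fun z => add_dirac (g1 z) (g2 z)).
Proof.
by move=> m1 m2; exact: (measurableT_comp measurable_add_dirac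
  (measurable_fun_pair m1 m2)).
Qed.

Lemma measurable_add_diracl (x : X) :
  measurable_fun [set: N] (fun xi : N => add_dirac xi x).
Proof.
exact: (measurableT_comp measurable_add_dirac (pair2_measurable x)).
Qed.

Lemma measurable_add_diracr (xi : N) :
  measurable_fun [set: X] (fun x : X => add_dirac xi x).
Proof.
exact: (measurableT_comp measurable_add_dirac (pair1_measurable xi)).
Qed.

Lemma add_diracC (xi : N) (x y : X) :
  add_dirac (add_dirac xi x) y = add_dirac (add_dirac xi y) x.
Proof. by apply: counting_ext => B; rewrite !add_diracE addeAC. Qed.

(** [eval_sub_dirac f] factors through a measurable function of the set function
    [xi - \d_x], all of whose evaluations are measurable in [(xi, x)]. *)
Lemma measurable_eval_sub_dirac (f : N -> R) : measurable_fun [set: N] f ->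
  measurable_fun [set: N * X] (fun q : N * X => eval_sub_dirac f q.1 q.2).
Proof.
move=> mf; have [mg _] := extend_counting_spec mf.
pose s (q : N * X) : set_function X R := fun B => q.1 B - \d_(q.2) B.
suff ms : measurable_fun [set: N * X] s by exact: (measurableT_comp mg ms).
apply: (@measurability _ _ _ (set_function X R) setT s
  (evaluations (fun m : set X -> \bar R => m))) => //.
move=> _ [U [B mB [Y mY <-]] <-]; rewrite !setTI.
have m : measurable_fun setT (fun q : N * X => q.1 B - \d_(q.2) B).
  apply: emeasurable_funB.
    exact: (measurableT_comp (measurable_count mB) measurable_fst).
  exact: (measurableT_comp (measurable_dirac_fun mB) measurable_snd).
by have := m measurableT Y mY; rewrite setTI.
Qed.

End counting_measurability.

(** * Positive kernel operators *)

Section nn_measurable_theory.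
Context d (Z : measurableType d) (R : realType).
Implicit Types h : Z -> \bar R.

Lemma nn_measurable_cst (k : \bar R) : 0 <= k ->
  nn_measurable (fun _ : Z => k).
Proof. by move=> k0; split. Qed.

Lemma nn_measurableD h h' : nn_measurable h -> nn_measurable h' ->
  nn_measurable (fun z => h z + h' z).
Proof.
by move=> [mh h0] [mh' h'0]; split; [exact: emeasurable_funD|move=> z; exact: adde_ge0].
Qed.

Lemma nn_measurableM h h' : nn_measurable h -> nn_measurable h' ->
  nn_measurable (fun z => h z * h' z).
Proof.
by move=> [mh h0] [mh' h'0]; split; [exact: emeasurable_funM|move=> z; exact: mule_ge0].
Qed.

Lemma nn_measurable_sum (h : nat -> Z -> \bar R) :
  (forall n, nn_measurable (h n)) ->
  nn_measurable (fun z => \sum_(n <oo) h n z).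
Proof.
move=> nh; split; last by move=> z; apply: nneseries_ge0 => n _ _; exact: (nh n).2.
by apply: ge0_emeasurable_sum => [n x _ _|n _]; [exact: (nh n).2|exact: (nh n).1].
Qed.

Lemma nn_measurable_fsum (I : Type) (r : seq I) (h : I -> Z -> \bar R) :
  (forall i, nn_measurable (h i)) ->
  nn_measurable (fun z => \sum_(i <- r) h i z).
Proof.
move=> nh; split; last by move=> z; apply: sume_ge0 => i _; exact: (nh i).2.
by apply: emeasurable_sum => i; exact: (nh i).1.
Qed.

Lemma nn_measurableT_comp d' (Y : measurableType d') h (g : Y -> Z) :
  nn_measurable h -> measurable_fun [set: Y] g ->
  nn_measurable (fun y => h (g y)).
Proof. by move=> [mh h0] mg; split => //; exact: (measurableT_comp mh mg). Qed.

Lemma nn_measurable_comp2 d1 (Y1 : measurableType d1) d2 (Y2 : measurableType d2)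
    (u : Y1 -> Y2 -> \bar R) (g1 : Z -> Y1) (g2 : Z -> Y2) :
  nn_measurable (fun q : Y1 * Y2 => u q.1 q.2) ->
  measurable_fun [set: Z] g1 -> measurable_fun [set: Z] g2 ->
  nn_measurable (fun z => u (g1 z) (g2 z)).
Proof.
move=> [mu u0] m1 m2; split; last by move=> z; exact: (u0 (_, _)).
exact: (measurableT_comp mu (measurable_fun_pair m1 m2)).
Qed.

Lemma nn_measurable_indic (U : set Z) : measurable U ->
  nn_measurable (fun z => (\1_U z)%:E : \bar R).
Proof.
by move=> mU; split; [exact/measurable_EFinP/measurable_indic|
  by move=> z; rewrite lee_fin].
Qed.

End nn_measurable_theory.

Section kernel_operator.
Context d (S : measurableType d) (R : realType).

(** The operator that integrates against a kernel, described by how it acts on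
    functions instead of by the kernel.  Stability under composition and series
    then needs no kernel to be constructed; [ko_param] expresses the
    measurability of the kernel, and [ko_int] is Tonelli's theorem. *)
Record kernel_operator (Phi : (S -> \bar R) -> S -> \bar R) : Prop := {
  ko_param : forall d' (Z : measurableType d') (u : S -> Z -> \bar R),
    nn_measurable (fun q : S * Z => u q.1 q.2) ->
    nn_measurable (fun q : S * Z => Phi (u ^~ q.2) q.1) ;
  ko_sum : forall (h : nat -> S -> \bar R), (forall n, nn_measurable (h n)) ->
    forall s, Phi (fun t => \sum_(n <oo) h n t) s = \sum_(n <oo) Phi (h n) s ;
  ko_add : forall h h', nn_measurable h -> nn_measurable h' ->
    forall s, Phi (fun t => h t + h' t) s = Phi h s + Phi h' s ;
  ko_scale : forall k h, 0 <= k -> nn_measurable h ->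
    forall s, Phi (fun t => k * h t) s = k * Phi h s ;
  ko_le : forall h h', nn_measurable h -> nn_measurable h' ->
    (forall t, h t <= h' t) -> forall s, Phi h s <= Phi h' s ;
  ko_int : forall d' (Z : measurableType d')
      (m : {finite_measure set Z -> \bar R}) (u : S -> Z -> \bar R),
    nn_measurable (fun q : S * Z => u q.1 q.2) ->
    forall s, Phi (fun t => \int[m]_z u t z) s = \int[m]_z Phi (u ^~ z) s }.

Lemma ko_nn Phi h : kernel_operator Phi -> nn_measurable h ->
  nn_measurable (Phi h).
Proof.
move=> kP nh; have nu : nn_measurable (fun q : S * S => h q.1).
  exact: (nn_measurableT_comp nh measurable_fst).
have := @ko_param _ kP _ _ (fun s _ => h s) nu.
move=> /nn_measurableT_comp => /(_ _ _ (fun s => (s, s))) /=; apply.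
by apply/measurable_fun_pairP; split => //=; exact: measurable_id.
Qed.

Lemma ko_ge0 Phi h : kernel_operator Phi -> nn_measurable h ->
  forall s, 0 <= Phi h s.
Proof. by move=> kP nh s; have [] := ko_nn kP nh. Qed.

Lemma kernel_operator_id : kernel_operator (fun h => h).
Proof. by split => //. Qed.

Lemma kernel_operator_comp Phi Psi : kernel_operator Phi ->
  kernel_operator Psi -> kernel_operator (fun h => Phi (Psi h)).
Proof.
move=> kP kQ; split.
- move=> d' Z u nu.
  exact: (@ko_param _ kP _ _ (fun s z => Psi (u ^~ z) s) (ko_param kQ nu)).
- move=> h nh s.
  rewrite (_ : Psi _ = fun t => \sum_(n <oo) Psi (h n) t); last first.
    by apply/funext => t; rewrite (ko_sum kQ).
  by rewrite (ko_sum kP)// => n; exact: ko_nn.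
- move=> h h' nh nh' s.
  rewrite (_ : Psi _ = fun t => Psi h t + Psi h' t); last first.
    by apply/funext => t; rewrite (ko_add kQ).
  by rewrite (ko_add kP)//; exact: ko_nn.
- move=> k h k0 nh s.
  rewrite (_ : Psi _ = fun t => k * Psi h t); last first.
    by apply/funext => t; rewrite (ko_scale kQ).
  by rewrite (ko_scale kP)//; exact: ko_nn.
- by move=> h h' nh nh' hh' s; apply: (ko_le kP); [exact: ko_nn..|exact: ko_le].
- move=> d' Z m u nu s.
  rewrite (_ : Psi _ = fun t => \int[m]_z Psi (u ^~ z) t); last first.
    by apply/funext => t; rewrite (ko_int kQ).
  by rewrite (@ko_int _ kP _ _ m (fun t z => Psi (u ^~ z) t) (ko_param kQ nu)).
Qed.

Lemma kernel_operator_iter Phi n : kernel_operator Phi ->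
  kernel_operator (iter n Phi).
Proof.
move=> kP; elim: n => [|n ih]; first exact: kernel_operator_id.
exact: (kernel_operator_comp kP ih).
Qed.

Lemma kernel_operator_wsum (Phi : nat -> (S -> \bar R) -> S -> \bar R)
    (w : nat -> R) : (forall n, (0 <= w n)%R) ->
  (forall n, kernel_operator (Phi n)) ->
  kernel_operator (fun h s => \sum_(n <oo) (w n)%:E * Phi n h s).
Proof.
move=> w0 kP; have w0' n : 0 <= (w n)%:E by rewrite lee_fin.
split.
- move=> d' Z u nu; apply: nn_measurable_sum => n.
  by apply: nn_measurableM; [exact: nn_measurable_cst|exact: (ko_param (kP n) nu)].
- move=> h nh s.
  rewrite nneseries_interchange; last first.
    by move=> i j; rewrite mule_ge0//; exact: ko_ge0.
  apply: eq_eseriesr => n _; rewrite (ko_sum (kP n))// nneseriesZl//.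
  by move=> i _; exact: ko_ge0.
- move=> h h' nh nh' s; rewrite -nneseriesD; last 2 first.
  + by move=> i _ _; rewrite mule_ge0//; exact: ko_ge0.
  + by move=> i _ _; rewrite mule_ge0//; exact: ko_ge0.
  apply: eq_eseriesr => n _; rewrite (ko_add (kP n))// ge0_muleDr//; exact: ko_ge0.
- move=> k h k0 nh s.
  under eq_eseriesr do rewrite (ko_scale (kP _))// muleCA.
  (* an infinite factor is taken out of the series by hand *)
  have tk (g : nat -> \bar R) : (forall n, 0 <= g n) ->
      \sum_(n <oo) k * g n = k * \sum_(n <oo) g n.
    move=> g0; case: k k0 => [k _|_|//]; first by rewrite nneseriesZl.
    have [[n gn]|/forallNP ng] := pselect (exists n, 0 < g n).
      rewrite (@nneseries_pinfty _ (fun n => +oo * g n) xpredT n)//; last 2 first.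
      - by move=> i _; rewrite mule_ge0.
      - by rewrite gt0_mulye.
      rewrite gt0_mulye//; apply: (lt_le_trans gn).
      by rewrite (@nneseriesD1 _ _ n)// leeDl// nneseries_ge0.
    have g0E i : g i = 0.
      by apply/eqP; rewrite eq_le g0 andbT leNgt; apply/negP/ng.
    by rewrite !eseries0 ?mule0// => i _ _; rewrite g0E// mule0.
  by apply: tk => n; rewrite mule_ge0//; exact: ko_ge0.
- move=> h h' nh nh' hh' s; apply: lee_nneseries => n _.
    by rewrite mule_ge0//; exact: ko_ge0.
  by rewrite lee_wpmul2l//; exact: ko_le.
- move=> d' Z m u nu s.
  have nPu n : nn_measurable (fun z => Phi n (u ^~ z) s).
    exact: (nn_measurableT_comp (ko_param (kP n) nu) (pair1_measurable s)).
  rewrite integral_nneseries//; last 2 first.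
  + by move=> n; apply: emeasurable_funM => //; exact: (nPu n).1.
  + by move=> n z _; rewrite mule_ge0//; exact: (nPu n).2.
  apply: eq_eseriesr => n _; rewrite (ko_int (kP n))// ge0_integralZl//.
  + exact: (nPu n).1.
  + by move=> z _; exact: (nPu n).2.
Qed.

End kernel_operator.

(** * The Poisson semigroup *)

Section ereal_series.
Context (R : realType).

Lemma nneseries_expR (x : R) : (0 <= x)%R ->
  \sum_(n <oo) (x ^+ n / n`!%:R)%:E = (expR x)%:E.
Proof.
move=> x0; rewrite expRE -EFin_lim; last first.
  rewrite /pseries/=; under eq_fun do rewrite mulrC.
  exact: is_cvg_series_exp_coeff.
apply/congr_lim/funext => n/=; rewrite /pseries/= /series/= -sumEFin//.
by under eq_bigr do rewrite mulrC.
Qed.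

Lemma nneseries_cauchy_product (v : nat -> nat -> \bar R) :
  (forall i j, 0 <= v i j) ->
  \sum_(i <oo) \sum_(j <oo) v i j = \sum_(n <oo) \sum_(i < n.+1) v i (n - i)%N.
Proof.
move=> v0.
pose w i n := if (i <= n)%N then v i (n - i)%N else 0.
have w0 i n : 0 <= w i n by rewrite /w; case: ifP.
transitivity (\sum_(i <oo) \sum_(n <oo) w i n).
  apply: eq_eseriesr => i _.
  rewrite [RHS](nneseries_split 0 i)// add0n big_nat_cond big1 ?add0e; last first.
    by move=> j /andP[/andP[_ ji] _]; rewrite /w leqNgt ji.
  rewrite -[RHS]nneseries_addn//; apply: eq_eseriesr => j _.
  by rewrite /w leq_addl addnK.
rewrite nneseries_interchange//; apply: eq_eseriesr => n _.
rewrite (nneseries_split 0 n.+1)// add0n [X in _ + X]eseries0 ?adde0; last first.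
  by move=> i ni _; rewrite /w leqNgt ni.
by rewrite big_mkord; apply: eq_bigr => i _; rewrite /w -ltnS ltn_ord.
Qed.

End ereal_series.

Section kernel_operator_finite_sums.
Context d (S : measurableType d) (R : realType).
Variables (Phi : (S -> \bar R) -> S -> \bar R) (kP : kernel_operator Phi).

Lemma ko0 s : Phi (fun=> 0) s = 0.
Proof.
have n0 : nn_measurable (fun _ : S => 0 : \bar R) by exact: nn_measurable_cst.
have := ko_scale kP (lexx 0) n0 s; rewrite [RHS]mul0e => E; rewrite -[RHS]E.
by congr (Phi _ s); apply/funext => t; rewrite mul0e.
Qed.

Lemma ko_fsum (I : Type) (r : seq I) (h : I -> S -> \bar R) :
  (forall i, nn_measurable (h i)) -> forall s,
  Phi (fun t => \sum_(i <- r) h i t) s = \sum_(i <- r) Phi (h i) s.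
Proof.
move=> nh s; elim: r => [|i r ih].
  rewrite big_nil -[RHS](ko0 s); congr (Phi _ s); apply/funext => t.
  by rewrite big_nil.
rewrite big_cons -ih -(ko_add kP)//; last exact: nn_measurable_fsum.
by congr (Phi _ s); apply/funext => t; rewrite big_cons.
Qed.

(** One argument is averaged at a time.  This transfers inequalities between
    values at two copies of the process to their means when the copies are
    independent. *)
Lemma ko_bilinear_le (a b c1 e1 c2 e2 : S -> \bar R) :
  nn_measurable a -> nn_measurable b ->
  nn_measurable c1 -> nn_measurable e1 ->
  nn_measurable c2 -> nn_measurable e2 ->
  (forall t t', a t * b t' <= c1 t * e1 t' + c2 t * e2 t') ->
  forall s, Phi a s * Phi b s <= Phi c1 s * Phi e1 s + Phi c2 s * Phi e2 s.
Proof.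
move=> na nb nc1 ne1 nc2 ne2 abce s.
have H t' : Phi a s * b t' <= Phi c1 s * e1 t' + Phi c2 s * e2 t'.
  rewrite muleC [X in _ <= X + _]muleC [X in _ <= _ + X]muleC.
  rewrite -!(ko_scale kP)//; [|exact: ne2.2|exact: ne1.2|exact: nb.2].
  have nk (k : \bar R) h : 0 <= k -> nn_measurable h ->
      nn_measurable (fun t : S => k * h t).
    by move=> k0 nh; apply: nn_measurableM => //; exact: nn_measurable_cst.
  rewrite -(ko_add kP); [|exact/nk/nc1/ne1.2|exact/nk/nc2/ne2.2].
  apply: (ko_le kP); [exact/nk/na/nb.2| |].
    by apply: nn_measurableD; [exact/nk/nc1/ne1.2|exact/nk/nc2/ne2.2].
  by move=> t; rewrite muleC [X in _ <= X + _]muleC [X in _ <= _ + X]muleC.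
have P0 h : nn_measurable h -> 0 <= Phi h s by move=> nh; exact: ko_ge0.
rewrite -!(ko_scale kP)//; [|exact: P0..].
have nk h' h : nn_measurable h' -> nn_measurable h ->
    nn_measurable (fun t : S => Phi h' s * h t).
  by move=> nh' nh; apply: nn_measurableM => //; exact/nn_measurable_cst/P0.
rewrite -(ko_add kP); [|exact: nk..].
apply: (ko_le kP); [exact: nk| |exact: H].
by apply: nn_measurableD; exact: nk.
Qed.

End kernel_operator_finite_sums.

Section birth.
Context d (X : measurableType d) (R : realType).
Local Notation N := (counting_space X R).
Implicit Types (nu : {finite_measure set X -> \bar R}) (h : N -> \bar R).

Definition birth nu h : N -> \bar R :=
  fun xi => \int[nu]_x h (add_dirac xi x).

Lemma nn_measurable_addr h xi : nn_measurable h ->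
  nn_measurable (fun x => h (add_dirac xi x)).
Proof.
by move=> nh; apply: (nn_measurableT_comp nh); exact: measurable_add_diracr.
Qed.

Lemma nn_measurable_addl h x : nn_measurable h ->
  nn_measurable (fun xi => h (add_dirac xi x)).
Proof.
by move=> nh; apply: (nn_measurableT_comp nh); exact: measurable_add_diracl.
Qed.

Lemma nn_measurable_section1 d' (Y : measurableType d') d'' (Z : measurableType d'')
    (u : Y -> Z -> \bar R) y :
  nn_measurable (fun q : Y * Z => u q.1 q.2) -> nn_measurable (u y).
Proof. by move=> nu; exact: (nn_measurableT_comp nu (pair1_measurable y)). Qed.

Lemma nn_measurable_section2 d' (Y : measurableType d') d'' (Z : measurableType d'')
    (u : Y -> Z -> \bar R) z :
  nn_measurable (fun q : Y * Z => u q.1 q.2) -> nn_measurable (u ^~ z).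
Proof. by move=> nu; exact: (nn_measurableT_comp nu (pair2_measurable z)). Qed.

Lemma nn_measurable_integral d' (Y : measurableType d') d'' (Z : measurableType d'')
    (m : {finite_measure set Z -> \bar R}) (u : Y -> Z -> \bar R) :
  nn_measurable (fun q : Y * Z => u q.1 q.2) ->
  nn_measurable (fun y => \int[m]_z u y z).
Proof.
move=> [mu u0]; split.
  exact: (measurable_fun_fubini_tonelli_F (m2 := m) _ mu u0).
by move=> y; apply: integral_ge0 => z _; exact: (u0 (y, z)).
Qed.

Lemma kernel_operator_birth nu : kernel_operator (birth nu).
Proof.
split.
- move=> d' Z u nn; rewrite /birth.
  apply: (@nn_measurable_integral _ _ _ _ nu
    (fun (q : N * Z) x => u (add_dirac q.1 x) q.2)).
  apply: (nn_measurable_comp2 nn); last first.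
    exact: (measurableT_comp measurable_snd measurable_fst).
  apply: measurable_add_dirac2 => //.
  exact: (measurableT_comp measurable_fst measurable_fst).
- move=> h nh xi; rewrite /birth integral_nneseries//.
    by move=> n; exact: (nn_measurable_addr xi (nh n)).1.
  by move=> n x _; exact: (nh n).2.
- move=> h h' nh nh' xi; rewrite /birth ge0_integralD//.
  + by move=> x _; exact: nh.2.
  + exact: (nn_measurable_addr xi nh).1.
  + by move=> x _; exact: nh'.2.
  + exact: (nn_measurable_addr xi nh').1.
- move=> k h k0 nh xi; rewrite /birth ge0_integralZl//.
  + exact: (nn_measurable_addr xi nh).1.
  + by move=> x _; exact: nh.2.
- move=> h h' nh nh' hh' xi; apply: ge0_le_integral => //.
  + by move=> x _; exact: nh.2.
  + exact: (nn_measurable_addr xi nh).1.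
  + exact: (nn_measurable_addr xi nh').1.
- move=> d' Z m u nn xi; rewrite /birth.
  apply: (@fubini_tonelli _ _ _ _ _ (nu : {sigma_finite_measure set X -> \bar R})
    (m : {sigma_finite_measure set Z -> \bar R}) (fun q : X * Z => u (add_dirac xi q.1) q.2)).
    apply: (nn_measurable_comp2 nn _ _).1 => //.
    exact: measurable_add_dirac2.
  by move=> q; exact: (nn.2 (_, _)).
Qed.

Lemma birth_cst nu (k : \bar R) xi : 0 <= k -> birth nu (fun=> k) xi = k * nu setT.
Proof.
move=> k0; rewrite /birth -[in LHS](mule1 k) ge0_integralZl//.
by rewrite integral_cst// mul1e.
Qed.

Lemma birth_shift nu h x xi :
  birth nu h (add_dirac xi x) = birth nu (fun zeta => h (add_dirac zeta x)) xi.
Proof. by apply: eq_integral => y _; rewrite add_diracC. Qed.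

Definition poisson_weight (a lam : R) n : R :=
  (expR (- (a * lam)) * (a ^+ n / n`!%:R))%R.

(** The mean of [h] at [xi] plus an independent Poisson process of intensity
    [a * nu], by conditioning on its number of points: this is
    [exp (a * (birth nu - nu setT))]. *)
Definition poisson_op nu (a : R) h : N -> \bar R := fun xi =>
  \sum_(n <oo) (poisson_weight a (fine (nu setT)) n)%:E * iter n (birth nu) h xi.

Lemma poisson_weight_ge0 a lam n : (0 <= a)%R -> (0 <= poisson_weight a lam n)%R.
Proof. by move=> a0; rewrite mulr_ge0 ?expR_ge0// divr_ge0// exprn_ge0. Qed.

Lemma kernel_operator_poisson nu a : (0 <= a)%R ->
  kernel_operator (poisson_op nu a).
Proof.
move=> a0; apply: kernel_operator_wsum.
  by move=> n; exact: poisson_weight_ge0.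
by move=> n; apply: kernel_operator_iter; exact: kernel_operator_birth.
Qed.

Lemma iter_birth_nn nu n h : nn_measurable h -> nn_measurable (iter n (birth nu) h).
Proof.
by move=> nh; apply: ko_nn => //; apply: kernel_operator_iter;
  exact: kernel_operator_birth.
Qed.

Lemma fin_mass nu : nu setT = (fine (nu setT))%:E.
Proof. by rewrite fineK//; exact: fin_num_measure. Qed.

Lemma iter_birth_cst nu n (k : \bar R) xi : 0 <= k ->
  iter n (birth nu) (fun=> k) xi = k * (fine (nu setT) ^+ n)%:E.
Proof.
move=> k0; elim: n xi => [|n ih] xi /=; first by rewrite expr0 mule1.
rewrite (_ : iter n _ _ = fun=> k * (fine (nu setT) ^+ n)%:E); last first.
  by apply/funext => zeta; exact: ih.
rewrite birth_cst ?mule_ge0 ?lee_fin ?exprn_ge0 ?fine_ge0//.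
by rewrite -muleA [X in k * (_ * X)]fin_mass -EFinM exprSr.
Qed.

Lemma poisson_op_cst nu a (k : \bar R) xi : (0 <= a)%R -> 0 <= k ->
  poisson_op nu a (fun=> k) xi = k.
Proof.
move=> a0 k0; rewrite /poisson_op; set lam := fine _.
have lam0 : (0 <= lam)%R by exact: fine_ge0.
suff H : poisson_op nu a (fun=> 1) xi = 1.
  rewrite -[RHS]mule1 -[in RHS]H -(ko_scale (kernel_operator_poisson nu a0))//.
    by under [in RHS]eq_fun do rewrite mule1.
rewrite /poisson_op.
under eq_eseriesr => n _ do rewrite iter_birth_cst// mul1e -EFinM /poisson_weight
   -mulrA -mulrAC -exprMn EFinM.
rewrite nneseriesZl; last first.
  by move=> n _; rewrite lee_fin divr_ge0// exprn_ge0// mulr_ge0.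
rewrite nneseries_expR; last by rewrite mulr_ge0.
by rewrite -EFinM expRN mulVf// gt_eqF// expR_gt0.
Qed.

Lemma iter_birth_shift nu n h x xi : iter n (birth nu) h (add_dirac xi x) =
  iter n (birth nu) (fun zeta => h (add_dirac zeta x)) xi.
Proof.
elim: n xi => //= n ih xi; rewrite birth_shift; congr (birth nu _ xi).
by apply/funext => zeta; exact: ih.
Qed.

Lemma poisson_op_shift nu a h x xi : poisson_op nu a h (add_dirac xi x) =
  poisson_op nu a (fun zeta => h (add_dirac zeta x)) xi.
Proof. by apply: eq_eseriesr => n _; rewrite iter_birth_shift. Qed.

Lemma birthC nu1 nu2 h xi : nn_measurable h ->
  birth nu1 (birth nu2 h) xi = birth nu2 (birth nu1 h) xi.
Proof.
move=> nh; have nn : nn_measurable (fun q : N * X => h (add_dirac q.1 q.2)).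
  exact: (nn_measurableT_comp nh (@measurable_add_dirac _ X R)).
rewrite {1}/birth -/(birth nu1 _ _).
transitivity (birth nu1 (fun zeta => \int[nu2]_x h (add_dirac zeta x)) xi).
  by [].
rewrite (ko_int (kernel_operator_birth nu1) nu2 nn).
by rewrite [RHS]/birth; apply: eq_integral => x _; rewrite birth_shift.
Qed.

(** Superposition of independent Poisson processes.  The births commute, so that
    [exp (a * T1 + b * T2) = exp (a * T1) * exp (b * T2)]; the series are
    multiplied by the Cauchy product. *)
Lemma poisson_op_superposition rho nu1 nu2 (c a b : R) :
  (0 <= c)%R -> (0 <= a)%R -> (0 <= b)%R ->
  (forall h xi, nn_measurable h ->
    c%:E * birth rho h xi = a%:E * birth nu1 h xi + b%:E * birth nu2 h xi) ->
  forall h xi, nn_measurable h ->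
    poisson_op rho c h xi = poisson_op nu1 a (poisson_op nu2 b h) xi.
Proof.
move=> c0 a0 b0 E h xi nh.
have k1 := kernel_operator_birth nu1.
have k2 := kernel_operator_birth nu2.
have kr := kernel_operator_birth rho.
have iC n zeta f : nn_measurable f ->
    birth nu2 (iter n (birth nu1) f) zeta = iter n (birth nu1) (birth nu2 f) zeta.
  move=> nf; elim: n zeta => //= n ih zeta; rewrite -birthC; last exact: iter_birth_nn.
  by congr (birth nu1 _ zeta); apply/funext => z; exact: ih.
pose v i j zeta := (a ^+ i / i`!%:R)%:E * ((b ^+ j / j`!%:R)%:E *
   iter i (birth nu1) (iter j (birth nu2) h) zeta).
have a0' i : 0 <= (a ^+ i / i`!%:R)%:E by rewrite lee_fin divr_ge0// exprn_ge0.
have b0' i : 0 <= (b ^+ i / i`!%:R)%:E by rewrite lee_fin divr_ge0// exprn_ge0.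
have nt i j : nn_measurable (iter i (birth nu1) (iter j (birth nu2) h)).
  by apply: iter_birth_nn; exact: iter_birth_nn.
have ntb i j : nn_measurable (fun zeta => (b ^+ j / j`!%:R)%:E *
   iter i (birth nu1) (iter j (birth nu2) h) zeta).
  by apply: nn_measurableM => //; exact: nn_measurable_cst.
have nv i j : nn_measurable (v i j).
  by apply: nn_measurableM => //; exact: nn_measurable_cst.
have T1v i j zeta : a%:E * birth nu1 (v i j) zeta = i.+1%:R%:E * v i.+1 j zeta.
  rewrite /v (ko_scale k1)// (ko_scale k1)// !muleA; congr (_ * _ * _).
  rewrite -!EFinM; congr EFin; rewrite factS natrM exprS; field.
  by rewrite ?nat1r !pnatr_eq0 -?lt0n !fact_gt0.
have T2v i j zeta : b%:E * birth nu2 (v i j) zeta = j.+1%:R%:E * v i j.+1 zeta.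
  rewrite /v (ko_scale k2)// (ko_scale k2)// iC; last exact: iter_birth_nn.
  rewrite -/(iter j.+1 (birth nu2) h) !muleA; congr (_ * _).
  rewrite -!EFinM; congr EFin; rewrite factS natrM exprS; field.
  by rewrite ?nat1r !pnatr_eq0 -?lt0n !fact_gt0.
(* the binomial formula for [c * birth rho], divided by [n`!] *)
have U n zeta : (c ^+ n / n`!%:R)%:E * iter n (birth rho) h zeta =
    \sum_(i < n.+1) v i (n - i)%N zeta.
  elim: n zeta => [|n ih] zeta.
    by rewrite big_ord1 /v /= !expr0 fact0 divr1 !mul1e.
  have n0 : (n.+1%:R : R) != 0%R by rewrite pnatr_eq0.
  have -> : (c ^+ n.+1 / n.+1`!%:R = n.+1%:R^-1 * (c * (c ^+ n / n`!%:R)))%R.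
    rewrite factS natrM exprS; field.
    by rewrite ?nat1r !pnatr_eq0 -?lt0n !fact_gt0.
  have -> : iter n.+1 (birth rho) h zeta = birth rho (iter n (birth rho) h) zeta by [].
  have nr : nn_measurable (iter n (birth rho) h) by exact: iter_birth_nn.
  rewrite EFinM -muleA EFinM -[in X in _ * X]muleA -(ko_scale kr)//; last first.
    by rewrite lee_fin divr_ge0// exprn_ge0.
  rewrite (_ : (fun t => _) = fun t => \sum_(i < n.+1) v i (n - i)%N t); last first.
    by apply/funext.
  have nvs : forall i : 'I_n.+1, nn_measurable (v i (n - i)%N) by move=> i.
  rewrite E; last exact: nn_measurable_fsum.
  rewrite (ko_fsum k1)// (ko_fsum k2)//.
  rewrite !ge0_sume_distrr; last 2 first.
    by move=> i _; exact: ko_ge0.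
    by move=> i _; exact: ko_ge0.
  under eq_bigr do rewrite T1v.
  under [X in _ + X]eq_bigr do rewrite T2v.
  have -> : \sum_(i < n.+1) i.+1%:R%:E * v i.+1 (n - i)%N zeta =
      \sum_(i < n.+2) i%:R%:E * v i (n.+1 - i)%N zeta.
    by rewrite [RHS]big_ord_recl mul0e add0e.
  have -> : \sum_(i < n.+1) (n - i).+1%:R%:E * v i (n - i).+1 zeta =
      \sum_(i < n.+2) (n.+1 - i)%N%:R%:E * v i (n.+1 - i)%N zeta.
    rewrite [RHS]big_ord_recr/= subnn mul0e adde0; apply: eq_bigr => i _.
    by rewrite subSn// -ltnS ltn_ord.
  rewrite -big_split/= ge0_sume_distrr; last first.
    by move=> i _; rewrite adde_ge0// mule_ge0//; exact: (nv _ _).2.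
  apply: eq_bigr => i _; rewrite -ge0_muleDl//.
  rewrite -EFinD -natrD subnKC; last by rewrite -ltnS ltn_ord.
  by rewrite muleA -EFinM mulVf// mul1e.
(* the same relation between the masses, read off at a constant function *)
have lamE : (c * fine (rho setT) = a * fine (nu1 setT) + b * fine (nu2 setT))%R.
  have := E (fun=> 1) xi (nn_measurable_cst _ lee01).
  by rewrite !birth_cst// !mul1e fin_mass (fin_mass nu1) (fin_mass nu2)
    -!EFinM -EFinD => -[].
rewrite /poisson_op.
pose w := (expR (- (a * fine (nu1 setT))) * expR (- (b * fine (nu2 setT))))%R.
have w0 : (0 <= w)%R by rewrite mulr_ge0 ?expR_ge0.
have ew : (expR (- (c * fine (rho setT))) = w)%R.
  by rewrite lamE opprD expRD.
transitivity (w%:E * \sum_(i <oo) \sum_(j <oo) v i j xi).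
  rewrite nneseries_cauchy_product; last by move=> i j; exact: (nv _ _).2.
  rewrite -nneseriesZl; last first.
    by move=> i _; apply: sume_ge0 => j _; exact: (nv _ _).2.
  by apply: eq_eseriesr => n _; rewrite -U muleA -EFinM /poisson_weight ew.
rewrite -nneseriesZl; last first.
  by move=> i _; apply: nneseries_ge0 => j _ _; exact: (nv _ _).2.
apply: eq_eseriesr => i _.
rewrite (ko_sum (kernel_operator_iter i k1)); last first.
  move=> n; apply: nn_measurableM; last exact: iter_birth_nn.
  by apply: nn_measurable_cst; rewrite lee_fin poisson_weight_ge0.
rewrite -!nneseriesZl; last 2 first.
- by move=> n _; apply: ko_ge0; [exact: kernel_operator_iter|
    apply: nn_measurableM; [apply: nn_measurable_cst; rewrite lee_fin poisson_weight_ge0|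
    exact: iter_birth_nn]].
- by move=> n _; exact: (nv _ _).2.
apply: eq_eseriesr => j _.
rewrite (ko_scale (kernel_operator_iter i k1)); last 2 first.
- by rewrite lee_fin poisson_weight_ge0.
- exact: iter_birth_nn.
rewrite /v !muleA -!EFinM; congr (_%:E * _); rewrite /poisson_weight /w; ring.
Qed.

Lemma poisson_opD nu a b h xi : (0 <= a)%R -> (0 <= b)%R -> nn_measurable h ->
  poisson_op nu a (poisson_op nu b h) xi = poisson_op nu (a + b) h xi.
Proof.
move=> a0 b0 nh; apply/esym/poisson_op_superposition => //; first exact: addr_ge0.
by move=> f zeta nf; rewrite EFinD ge0_muleDl ?lee_fin.
Qed.

Lemma poisson_op0 nu h xi : poisson_op nu 0 h xi = h xi.
Proof.
rewrite /poisson_op (_ : (fun n => _) = fun n => \sum_(0 <= k < n) if k == 0%N then h xi else 0).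
  apply/lim_near_cst => //; exists 1%N => // -[//|n] _.
  by rewrite big_nat_recl// big1_seq ?adde0//= => i /andP[]; rewrite mem_iota.
apply/funext => n; apply: eq_bigr => -[|k] _ /=; rewrite /poisson_weight.
  by rewrite mul0r oppr0 expR0 expr0 fact0 divr1 mulr1 mul1e.
by rewrite exprS !mul0r mulr0 mul0e.
Qed.

End birth.

(** * Small times, carriers, and the Mecke formula *)

Section carriers.
Context d (T : measurableType d) (R : realType).

Lemma ge0_integral_carrier (m : {measure set T -> \bar R}) (A : set T)
    (f : T -> \bar R) : measurable A -> m (~` A) = 0 -> nn_measurable f ->
  \int[m]_x f x = \int[m]_(x in A) f x.
Proof.
move=> mA mA0 [mf f0].
by rewrite (@ge0_negligible_integral _ _ _ m setT (~` A))// ?setTD ?setCK//;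
  exact: measurableC.
Qed.

Lemma ge0_integral_mrestr (m : {measure set T -> \bar R}) (A : set T)
    (mA : measurable A) (f : T -> \bar R) : nn_measurable f ->
  \int[mrestr m mA]_x f x = \int[m]_(x in A) f x.
Proof.
move=> nf; rewrite (@ge0_integral_carrier _ A)//; last first.
  by rewrite /= /mrestr setICl measure0.
by apply: eq_measure_integral => B mB BA; rewrite /= /mrestr setIidl.
Qed.

Lemma ge0_eq_integral_carrier (m : {measure set T -> \bar R}) (A : set T)
    (f g : T -> \bar R) : measurable A -> m (~` A) = 0 ->
  nn_measurable f -> nn_measurable g -> (forall x, A x -> f x = g x) ->
  \int[m]_x f x = \int[m]_x g x.
Proof.
move=> mA mA0 nf ng fg; rewrite !(ge0_integral_carrier mA)//.
by apply: eq_integral => x /set_mem /fg.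
Qed.

End carriers.

Section poisson_op_theory.
Context d (X : measurableType d) (R : realType).
Local Notation N := (counting_space X R).
Variable nu : {finite_measure set X -> \bar R}.
Implicit Types (h k f g : N -> \bar R) (a : R).

Local Notation lam := (fine (nu [set: X])).
Local Notation T := (birth nu).
Local Notation P := (poisson_op nu).

Let lam0 : (0 <= lam)%R. Proof. exact: fine_ge0. Qed.

Let w0E a : poisson_weight a lam 0 = expR (- (a * lam)).
Proof. by rewrite /poisson_weight expr0 fact0 divr1 mulr1. Qed.

Let w1E a : poisson_weight a lam 1 = (expR (- (a * lam)) * a)%R.
Proof. by rewrite /poisson_weight expr1 divr1. Qed.

Let poisson_op_split a h xi : (0 <= a)%R -> nn_measurable h ->
  P a h xi = (expR (- (a * lam)))%:E * (h xi + a%:E * T h xi) +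
    \sum_(2 <= n <oo) (poisson_weight a lam n)%:E * iter n T h xi.
Proof.
move=> a0 nh; rewrite /poisson_op (nneseries_split 0 2); last first.
  by move=> n _; rewrite mule_ge0 ?lee_fin ?poisson_weight_ge0// (iter_birth_nn nu n nh).2.
rewrite add0n big_nat_recl// big_nat1 /= w0E w1E.
have k := kernel_operator_birth nu.
rewrite EFinM -muleA -ge0_muleDr//; first exact: nh.2.
by rewrite mule_ge0 ?lee_fin//; exact: ko_ge0.
Qed.

Lemma poisson_op_lower a h xi : (0 <= a)%R -> nn_measurable h ->
  (expR (- (a * lam)))%:E * (h xi + a%:E * T h xi) <= P a h xi.
Proof.
move=> a0 nh; rewrite poisson_op_split// leeDl//; apply: nneseries_ge0 => n _ _.
by rewrite mule_ge0 ?lee_fin ?poisson_weight_ge0// (iter_birth_nn nu n nh).2.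
Qed.

(** The terms with at least two added points are compared with those of the
    constant function [U], which are known exactly, since [poisson_op] fixes
    constants; what is left is [1 - (1 + x) * expR (- x) <= x ^+ 2]. *)
Lemma poisson_op_upper a h (U : R) xi : (0 <= a)%R -> nn_measurable h ->
  (forall zeta, h zeta <= U%:E) ->
  P a h xi <= (expR (- (a * lam)))%:E * (h xi + a%:E * T h xi) +
              (U * (a * lam) ^+ 2)%:E.
Proof.
move=> a0 nh hU; rewrite poisson_op_split// leeD2l//.
have U0 : (0 <= U)%R by rewrite -lee_fin; exact: le_trans (nh.2 xi) (hU xi).
have nU : nn_measurable (fun _ : N => U%:E).
  by apply: nn_measurable_cst; rewrite lee_fin.
apply: (@le_trans _ _
    (\sum_(2 <= n <oo) (poisson_weight a lam n)%:E * iter n T (fun=> U%:E) xi)).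
  apply: lee_nneseries => [n _ _|n _].
    by rewrite mule_ge0 ?lee_fin ?poisson_weight_ge0// (iter_birth_nn nu n nh).2.
  rewrite lee_wpmul2l ?lee_fin ?poisson_weight_ge0//.
  exact: (ko_le (kernel_operator_iter n (kernel_operator_birth nu))).
have := poisson_op_split xi a0 nU.
rewrite poisson_op_cst ?lee_fin// birth_cst ?lee_fin// fin_mass.
set s := \sum_(2 <= n <oo) _; set x := (a * lam)%R => E.
have x0 : (0 <= x)%R by rewrite mulr_ge0.
have sE : s = (U - expR (- x) * (U + a * (U * lam)))%:E.
  have := E; case: s {E} => [s| |]// [E].
  by congr EFin; lra.
rewrite sE lee_fin.
have -> : (U + a * (U * lam) = U * (1 + x))%R by rewrite /x; ring.
have -> : (U - expR (- x) * (U * (1 + x)) = U * (1 - (1 + x) * expR (- x)))%R by ring.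
rewrite ler_wpM2l//.
have := expR_ge1Dx (- x); nra.
Qed.

(** The carre du champ: over a short time the covariance of two observables
    grows at most at the rate given by the products of their increments.  [U]
    bounds the integral of these products, since the hypothesis says that
    [T (g * f) - g * T f - f * T g + lam * g * f <= U]. *)
Lemma poisson_op_small_cov (a M U : R) g f xi : (0 <= a)%R -> (0 <= U)%R ->
  nn_measurable g -> nn_measurable f ->
  (forall zeta, g zeta <= M%:E) -> (forall zeta, f zeta <= M%:E) ->
  T (fun zeta => g zeta * f zeta) xi + lam%:E * (g xi * f xi) <=
    f xi * T g xi + g xi * T f xi + U%:E ->
  P a (fun zeta => g zeta * f zeta) xi <=
    P a g xi * P a f xi + (a * U + 3 * M ^+ 2 * (a * lam) ^+ 2)%:E.
Proof.
move=> a0 U0 ng nf gM fM H.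
have M0 : (0 <= M)%R by rewrite -lee_fin; exact: le_trans (ng.2 xi) (gM xi).
have ngf := nn_measurableM ng nf.
have k := kernel_operator_birth nu.
have gfM zeta : g zeta * f zeta <= (M ^+ 2)%:E.
  by rewrite expr2 EFinM lee_pmul//; [exact: ng.2|exact: nf.2].
have TM h (C : R) : nn_measurable h -> (forall zeta, h zeta <= C%:E) ->
    (0 <= C)%R -> exists2 r : R, T h xi = r%:E & (0 <= r <= C * lam)%R.
  move=> nh hC C0.
  have : T h xi <= C%:E * lam%:E.
    rewrite -fin_mass -(birth_cst nu xi) ?lee_fin//; exact: (ko_le k).
  have : 0 <= T h xi by exact: ko_ge0.
  by case: (T h xi) => [r| |]//; rewrite -EFinM !lee_fin => r0 rC;
    exists r => //; rewrite r0.
have PM h (C : R) : nn_measurable h -> (forall zeta, h zeta <= C%:E) ->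
    (0 <= C)%R -> exists2 r : R, P a h xi = r%:E & (0 <= r)%R.
  move=> nh hC C0.
  have kP := kernel_operator_poisson nu a0.
  have : P a h xi <= C%:E.
    rewrite -[leRHS](@poisson_op_cst _ _ _ nu a _ xi) ?lee_fin//.
    exact: (ko_le kP).
  have : 0 <= P a h xi by exact: ko_ge0.
  by case: (P a h xi) => [r| |]//; rewrite !lee_fin => r0 rC; exists r.
have [A TA /andP[A0 AM]] := TM g M ng gM M0.
have [B TB /andP[B0 BM]] := TM f M nf fM M0.
have [C TC /andP[C0 CM]] := TM _ (M ^+ 2)%R ngf gfM (sqr_ge0 _).
have [p Pp p0] := PM g M ng gM M0.
have [q Pq q0] := PM f M nf fM M0.
have := poisson_op_upper xi a0 ngf gfM.
have := poisson_op_lower xi a0 ng; have := poisson_op_lower xi a0 nf.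
have [r Pr r0] := PM _ (M ^+ 2)%R ngf gfM (sqr_ge0 _).
have : exists2 G : R, g xi = G%:E & (0 <= G <= M)%R.
  have := gM xi; have := ng.2 xi; case: (g xi) => [G| |]//; rewrite !lee_fin => G0 G1.
  by exists G => //; rewrite G0.
have : exists2 F : R, f xi = F%:E & (0 <= F <= M)%R.
  have := fM xi; have := nf.2 xi; case: (f xi) => [G| |]//; rewrite !lee_fin => G0 G1.
  by exists G => //; rewrite G0.
move=> [F FE /andP[F0 FM]] [G GE /andP[G0 GM]].
move: H; rewrite Pp Pq Pr TA TB TC FE GE -!EFinM -!EFinD !lee_fin.
set x := (a * lam)%R; set e := expR (- x).
have x0 : (0 <= x)%R by rewrite mulr_ge0.
have e0 : (0 <= e)%R by exact: expR_ge0.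
have e1 : (e <= 1)%R by rewrite -expR0 ler_expR oppr_le0.
have ex : (1 - x <= e)%R by exact: expR_ge1Dx.
move=> H qF pG rC.
apply: (le_trans rC).
have pq : (e ^+ 2 * (G * F + a * (F * A + G * B)) <= p * q)%R.
  apply: le_trans (ler_pM _ _ pG qF).
  - rewrite -subr_ge0.
    have -> : (e * (G + a * A) * (e * (F + a * B)) -
      e ^+ 2 * (G * F + a * (F * A + G * B)) = e ^+ 2 * (a ^+ 2 * (A * B)))%R by ring.
    by rewrite mulr_ge0 ?sqr_ge0// mulr_ge0 ?sqr_ge0// mulr_ge0.
  - by rewrite mulr_ge0// addr_ge0// mulr_ge0.
  - by rewrite mulr_ge0// addr_ge0// mulr_ge0.
suff : (e * (G * F + a * C) + M ^+ 2 * x ^+ 2 <=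
    e ^+ 2 * (G * F + a * (F * A + G * B)) + (a * U + 3 * M ^+ 2 * x ^+ 2))%R.
  by move=> /le_trans; apply; rewrite lerD2r.
have aC : (a * C <= a * (F * A + G * B) + a * U - x * (G * F))%R.
  have : (a * C <= a * (F * A + G * B + U - lam * (G * F)))%R.
    by rewrite ler_wpM2l// lerBrDr.
  by rewrite /x => /le_trans; apply; rewrite le_eqVlt; apply/orP; left; apply/eqP; ring.
set D := (F * A + G * B)%R in aC *.
have D0 : (0 <= D)%R by rewrite addr_ge0// mulr_ge0.
have aD : (a * D <= 2 * M ^+ 2 * x)%R.
  have : (D <= 2 * (M * (M * lam)))%R.
    have : (F * A <= M * (M * lam))%R by rewrite ler_pM.
    have : (G * B <= M * (M * lam))%R by rewrite ler_pM.
    by rewrite /D; lra.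
  move=> /(ler_wpM2l a0) /le_trans; apply.
  by rewrite le_eqVlt; apply/orP; left; apply/eqP; rewrite /x; ring.
have GF0 : (0 <= G * F)%R by rewrite mulr_ge0.
have : (e * (a * U) <= 1 * (a * U))%R by rewrite ler_wpM2r// mulr_ge0.
have : (e * (a * C) <= e * (a * D + a * U - x * (G * F)))%R by rewrite ler_wpM2l.
have : (e * (1 - e - x) * (G * F) <= 0)%R.
  by rewrite mulr_le0_ge0// mulr_ge0_le0//; lra.
have : (e * (1 - e) * (a * D) <= x * (2 * M ^+ 2 * x))%R.
  apply: ler_pM => //.
  - by rewrite mulr_ge0// subr_ge0.
  - by rewrite mulr_ge0.
  - have : (e * (1 - e) <= 1 * (1 - e))%R by rewrite ler_wpM2r// subr_ge0.
    by lra.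
lra.
Qed.

End poisson_op_theory.

Section insensitivity.
Context d (X : measurableType d) (R : realType).
Local Notation N := (counting_space X R).
Variable nu : {finite_measure set X -> \bar R}.
Implicit Types (h k : N -> \bar R) (a : R).

Definition insensitive (A : set X) (V : Type) (k : N -> V) :=
  forall xi x, A x -> k (add_dirac xi x) = k xi.

Lemma iter_birth_insensitive (A : set X) n h k xi :
  measurable A -> nu (~` A) = 0 ->
  nn_measurable h -> nn_measurable k -> insensitive A k ->
  iter n (birth nu) (fun zeta => k zeta * h zeta) xi = k xi * iter n (birth nu) h xi.
Proof.
move=> mA A0 nh nk kA; elim: n xi => //= n ih xi.
have nih : nn_measurable (iter n (birth nu) h) by exact: iter_birth_nn.
transitivity (birth nu (fun zeta => k zeta * iter n (birth nu) h zeta) xi).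
  by congr (birth nu _ xi); apply/funext => zeta; exact: ih.
rewrite /birth -ge0_integralZl//; last 3 first.
- exact: (nn_measurable_addr xi nih).1.
- by move=> x _; exact: nih.2.
- exact: nk.2.
apply: (ge0_eq_integral_carrier mA A0).
- exact: nn_measurable_addr (nn_measurableM nk nih).
- by apply: nn_measurableM; [exact/nn_measurable_cst/nk.2|exact: nn_measurable_addr].
- by move=> x Ax; rewrite kA.
Qed.

(** Only points of the carrier [A] of [nu] are ever added. *)
Lemma poisson_op_insensitive (A : set X) a h k xi : (0 <= a)%R ->
  measurable A -> nu (~` A) = 0 ->
  nn_measurable h -> nn_measurable k -> insensitive A k ->
  poisson_op nu a (fun zeta => k zeta * h zeta) xi = k xi * poisson_op nu a h xi.
Proof.
move=> a0 mA A0 nh nk kA.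
rewrite -(ko_scale (kernel_operator_poisson nu a0) (nk.2 xi) nh).
apply: eq_eseriesr => n _; congr (_ * _).
rewrite (iter_birth_insensitive _ _ mA)//.
by rewrite (ko_scale (kernel_operator_iter n (kernel_operator_birth nu)))//; exact: nk.2.
Qed.

Lemma eq_iter_birth (C : set N) n h h' xi :
  (forall zeta x, C zeta -> C (add_dirac zeta x)) ->
  (forall zeta, C zeta -> h zeta = h' zeta) -> C xi ->
  iter n (birth nu) h xi = iter n (birth nu) h' xi.
Proof.
move=> CD hh'; elim: n xi => [|n ih] xi Cxi /=; first exact: hh'.
by apply: eq_integral => x _; apply: ih; exact: CD.
Qed.

End insensitivity.

Section point_sum.
Context d (X : measurableType d) (R : realType).
Local Notation N := (counting_space X R).
Variables (A : set X) (mA : measurable A).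
Implicit Types (u : N -> X -> \bar R) (a : R).

(** The sum of [u xi x] over the points [x] of [xi] in [A].  It is cut off at
    configurations with infinitely many points in [A], so that it is given by a
    kernel whose values are finite measures, and hence is measurable in [xi]. *)
Definition point_sum u : N -> \bar R := fun xi =>
  if xi A < +oo then \int[xi]_(x in A) u xi x else 0.

Let D (xi : N) : set X := if xi A < +oo then A else set0.
Let mD xi : measurable (D xi). Proof. by rewrite /D; case: ifP. Qed.
Let l (xi : N) : {measure set X -> \bar R} := mrestr xi (mD xi).

Let fin_counting : measurable [set xi : N | xi A < +oo].
Proof.
have := emeasurable_fun_infty_o (measurableT : measurable [set: N])
  (measurable_count mA) (+oo : \bar R).
by rewrite setTI.
Qed.

Let mfin_counting : measurable_fun [set: N] (fun xi : N => xi A < +oo).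
Proof.
apply: (measurable_fun_bool true); rewrite setTI.
by rewrite [X in measurable X](_ : _ = [set xi : N | xi A < +oo])//.
Qed.

Let ml (U : set X) : measurable U -> measurable_fun [set: N] (fun xi => l xi U).
Proof.
move=> mU.
rewrite (_ : (fun xi => _) = fun xi : N => if xi A < +oo then xi (U `&` A) else 0).
  by apply: measurable_fun_ifT => //; apply: measurable_count; exact: measurableI.
apply/funext => xi; rewrite /l /= /mrestr /D; case: ifP => // _.
by rewrite setI0 measure0.
Qed.

HB.instance Definition _ := isKernel.Build _ _ N X R l ml.

Import HBNNSimple.

Lemma nn_measurable_point_sum u : nn_measurable (fun q : N * X => u q.1 q.2) ->
  nn_measurable (point_sum u).
Proof.
move=> nu; split; last first.
  move=> xi; rewrite /point_sum; case: ifP => // _.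
  by apply: integral_ge0 => x _; exact: (nu.2 (xi, x)).
rewrite (_ : point_sum u = fun xi => \int[l xi]_x u xi x); last first.
  apply/funext => xi; rewrite ge0_integral_mrestr; last exact: nn_measurable_section1.
  by rewrite /point_sum /D; case: ifP => // _; rewrite integral_set0.
(* the kernel [l] is not uniformly finite; for the sections of a single set,
   that is, for simple functions, it suffices that each [l xi] is finite *)
pose k_ := nnsfun_approx measurableT nu.1.
apply: (@measurable_fun_xsection_integral _ _ _ _ _ (fun q : N * X => u q.1 q.2) l k_).
- by move=> a b ab; exact/nd_nnsfun_approx.
- by move=> z; apply: cvg_nnsfun_approx => // q _; exact: nu.2.
- move=> n r.
  have mB : measurable (k_ n @^-1` [set r]) by [].
  have [|_ +] := @measurable_prod_subset_xsection_kernel _ _ N X R l setT measurableT _ _ mB.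
    move=> xi; exists (fine (l xi setT) + 1)%R => B mB'.
    have lfin : l xi setT \is a fin_num.
      rewrite ge0_fin_numE// /l /= /mrestr setTI /D.
      by case: ifPn => //; rewrite measure0.
    rewrite /mrestr setIT.
    apply: (@le_lt_trans _ _ (l xi setT)); first by apply: le_measure; rewrite ?inE.
    by rewrite -[ltLHS]fineK// lte_fin ltrDl.
  by apply: eq_measurable_fun => xi _; rewrite /mrestr setIT.
Qed.

End point_sum.

Section mecke.
Context d (X : measurableType d) (R : realType).
Local Notation N := (counting_space X R).
Variables (nu : {finite_measure set X -> \bar R}) (A : set X).
Hypotheses (mA : measurable A) (nuA : nu (~` A) = 0).
Implicit Types (u : N -> X -> \bar R) (a : R) (xi : N).

Local Notation S := (point_sum A).
Local Notation P := (poisson_op nu).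

Definition mecke_diag u : N -> \bar R :=
  fun xi => \int[nu]_y u (add_dirac xi y) y.

Let finA_add xi x : xi A < +oo -> add_dirac xi x A < +oo.
Proof. by move=> xiA; rewrite add_diracE lte_add_pinfty// diracE ltry. Qed.

Let nn_diag u : nn_measurable (fun q : N * X => u q.1 q.2) ->
  nn_measurable (fun q : N * X => u (add_dirac q.1 q.2) q.2).
Proof.
by move=> nu'; apply: (nn_measurable_comp2 nu') => //; exact: measurable_add_dirac.
Qed.

Lemma nn_measurable_mecke_diag u : nn_measurable (fun q : N * X => u q.1 q.2) ->
  nn_measurable (mecke_diag u).
Proof.
move=> nu'; exact: (@nn_measurable_integral _ _ _ _ _ nu
  (fun xi y => u (add_dirac xi y) y) (nn_diag nu')).
Qed.

Let point_sum_mfrestr u xi (xiA : xi A < +oo) :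
  nn_measurable (fun q : N * X => u q.1 q.2) -> forall zeta,
  \int[mfrestr mA xiA]_x u zeta x = \int[xi]_(x in A) u zeta x.
Proof.
by move=> nu' zeta; apply: ge0_integral_mrestr; exact: nn_measurable_section1.
Qed.

(** An added point leaves the terms of the old points in place and contributes
    one term of its own. *)
Lemma birth_point_sum u xi : nn_measurable (fun q : N * X => u q.1 q.2) ->
  xi A < +oo ->
  birth nu (S u) xi = S (fun zeta x => birth nu (u ^~ x) zeta) xi + mecke_diag u xi.
Proof.
move=> nu' xiA.
have ns zeta : nn_measurable (u zeta) by exact: nn_measurable_section1.
transitivity (\int[nu]_y (\int[xi]_(x in A) u (add_dirac xi y) x +
    \d_y A * u (add_dirac xi y) y)).
  apply: eq_integral => y _; rewrite /point_sum finA_add//.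
  transitivity (\int[measure_add xi (dirac y : {measure set X -> \bar R})]_(x in A)
      u (add_dirac xi y) x) => //.
  rewrite ge0_integral_measure_add//; last 2 first.
  - by move=> x _; exact: (ns _).2.
  - exact: measurable_funTS (ns _).1.
  by rewrite integral_dirac//; exact: measurable_funTS (ns _).1.
have nm : nn_measurable (fun y => \int[xi]_(x in A) u (add_dirac xi y) x).
  rewrite (_ : (fun y => _) = fun y => \int[mfrestr mA xiA]_x u (add_dirac xi y) x);
    last by apply/funext => y; rewrite point_sum_mfrestr.
  apply: (@nn_measurable_integral _ _ _ _ _ (mfrestr mA xiA)
    (fun y x => u (add_dirac xi y) x)).
  by apply: (nn_measurable_comp2 nu') => //; exact: measurable_add_dirac2.
have nd : nn_measurable (fun y => u (add_dirac xi y) y).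
  apply: (nn_measurable_comp2 nu'); last exact: measurable_id.
  exact: measurable_add_diracr.
have nda : nn_measurable (fun y => \d_y A : \bar R).
  by split; [exact: measurable_dirac_fun|move=> y; rewrite diracE lee_fin].
rewrite ge0_integralD//; last 4 first.
- by move=> x _; exact: nm.2.
- exact: nm.1.
- by move=> x _; rewrite mule_ge0//; exact: nd.2.
- exact: (nn_measurableM nda nd).1.
congr (_ + _); last first.
  apply: (ge0_eq_integral_carrier mA nuA) => //; first exact: nn_measurableM.
  by move=> x Ax; rewrite diracE mem_set// mul1e.
rewrite /point_sum xiA.
rewrite -(@point_sum_mfrestr (fun zeta x => birth nu (u ^~ x) zeta) xi xiA); last first.
  exact: (ko_param (kernel_operator_birth nu) nu').
rewrite -(ko_int (kernel_operator_birth nu) (mfrestr mA xiA) nu').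
by apply: eq_integral => y _; rewrite point_sum_mfrestr.
Qed.

Let nn_iter n u : nn_measurable (fun q : N * X => u q.1 q.2) ->
  nn_measurable (fun q : N * X => iter n (birth nu) (u ^~ q.2) q.1).
Proof.
exact: (ko_param (kernel_operator_iter n (kernel_operator_birth nu))).
Qed.

(** Any of the [n] added points may be the one that contributes. *)
Lemma iter_birth_point_sum n u xi : nn_measurable (fun q : N * X => u q.1 q.2) ->
  xi A < +oo ->
  iter n (birth nu) (S u) xi = S (fun zeta x => iter n (birth nu) (u ^~ x) zeta) xi +
    n%:R%:E * iter n.-1 (birth nu) (mecke_diag u) xi.
Proof.
move=> nu'; elim: n xi => [|n ih] xi xiA; first by rewrite mul0e adde0.
have k := kernel_operator_birth nu.
have nmd := nn_measurable_mecke_diag nu'.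
have kn := kernel_operator_iter n k.
pose v zeta x := iter n (birth nu) (u ^~ x) zeta.
have nv : nn_measurable (fun q : N * X => v q.1 q.2) by exact: nn_iter.
transitivity (birth nu (fun zeta => S v zeta +
    n%:R%:E * iter n.-1 (birth nu) (mecke_diag u) zeta) xi).
  apply: (@eq_iter_birth _ _ _ nu [set xi | xi A < +oo] 1) => //.
have nim m : nn_measurable (iter m (birth nu) (mecke_diag u)) by exact: iter_birth_nn.
have nn0 : nn_measurable (fun _ : N => n%:R%:E : \bar R).
  by apply: nn_measurable_cst; rewrite lee_fin.
rewrite (ko_add k); [|exact: nn_measurable_point_sum|exact: nn_measurableM].
rewrite (ko_scale k) ?lee_fin// birth_point_sum// -addeA; congr (_ + _).
have -> : mecke_diag v xi = iter n (birth nu) (mecke_diag u) xi.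
  rewrite (ko_int kn nu (u := fun zeta y => u (add_dirac zeta y) y)); last exact: nn_diag.
  by apply: eq_integral => y _; rewrite /v iter_birth_shift.
rewrite -[X in X + _]mul1e -[in RHS]nat1r EFinD ge0_muleDl ?lee_fin//.
congr (_ + _); clear; case: n => [|n//]; by rewrite !mul0e.
Qed.

(** The factor [n] cancels against [n`!] in the Poisson weights and shifts the
    exponential series by one, which gives the factor [a]. *)
Lemma poisson_op_point_sum a u xi : (0 <= a)%R ->
  nn_measurable (fun q : N * X => u q.1 q.2) -> xi A < +oo ->
  P a (S u) xi = S (fun zeta x => P a (u ^~ x) zeta) xi +
    a%:E * P a (mecke_diag u) xi.
Proof.
move=> a0 nu' xiA; have k := kernel_operator_birth nu.
have kn n := kernel_operator_iter n k.
set lam := fine (nu setT).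
have w0 n : 0 <= (poisson_weight a lam n)%:E by rewrite lee_fin poisson_weight_ge0.
have w1 n : 0 <= (poisson_weight a lam n * n%:R)%:E.
  by rewrite lee_fin mulr_ge0// poisson_weight_ge0.
have nmd := nn_measurable_mecke_diag nu'.
have nT n : nn_measurable (iter n (birth nu) (mecke_diag u)) by exact: iter_birth_nn.
pose v n zeta x := iter n (birth nu) (u ^~ x) zeta.
have nv n : nn_measurable (fun q : N * X => v n q.1 q.2) by exact: nn_iter.
have nS n : nn_measurable (S (v n)) by exact: nn_measurable_point_sum.
transitivity (\sum_(n <oo) (poisson_weight a lam n)%:E * S (v n) xi +
  \sum_(n <oo) (poisson_weight a lam n * n%:R)%:E *
    iter n.-1 (birth nu) (mecke_diag u) xi).
  rewrite -nneseriesD; last 2 first.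
  - by move=> n _ _; rewrite mule_ge0//; exact: (nS n).2.
  - by move=> n _ _; rewrite mule_ge0//; exact: (nT _).2.
  apply: eq_eseriesr => n _.
  rewrite iter_birth_point_sum// ge0_muleDr; last 2 first.
  - exact: (nS n).2.
  - by rewrite mule_ge0 ?lee_fin//; exact: (nT _).2.
  by rewrite muleA -EFinM.
congr (_ + _).
  rewrite /point_sum xiA /poisson_op integral_nneseries//; last 2 first.
  - move=> n; apply: measurable_funTS.
    apply: (nn_measurableM (nn_measurable_cst _ (w0 n)) _).1.
    exact: nn_measurable_section1 (nv n).
  - by move=> n x _; rewrite mule_ge0//; exact: ((nv n).2 (xi, x)).
  apply: eq_eseriesr => n _; rewrite ge0_integralZl//.
  - exact: (measurable_funTS (nn_measurable_section1 xi (nv n)).1).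
  - by move=> x _; exact: ((nv n).2 (xi, x)).
rewrite (nneseries_split 0 1); last first.
  by move=> n _; rewrite mule_ge0//; exact: (nT _).2.
rewrite big_nat1 mulr0 mul0e add0e -nneseries_addn; last first.
  by move=> n; rewrite mule_ge0//; exact: (nT _).2.
rewrite /poisson_op -nneseriesZl; last first.
  by move=> n _; rewrite mule_ge0//; exact: (nT _).2.
apply: eq_eseriesr => n _; rewrite !addn1 /= muleA -EFinM; congr (_%:E * _).
rewrite /poisson_weight factS natrM exprS; field.
by rewrite ?nat1r !pnatr_eq0 -?lt0n !fact_gt0.
Qed.

Lemma point_sum_poisson_op_le a u xi : (0 <= a)%R ->
  nn_measurable (fun q : N * X => u q.1 q.2) ->
  S (fun zeta x => P a (u ^~ x) zeta) xi <= P a (S u) xi.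
Proof.
move=> a0 nu'; have kP := kernel_operator_poisson nu a0.
have nPS := ko_ge0 kP (nn_measurable_point_sum mA nu') xi.
have [xiA|xiA] := boolP (xi A < +oo); last by rewrite {1}/point_sum (negbTE xiA).
rewrite poisson_op_point_sum// leeDl// mule_ge0 ?lee_fin//.
by apply: (ko_ge0 kP); exact: nn_measurable_mecke_diag.
Qed.

(** The Mecke formula, started from a configuration without points in [A]. *)
Lemma poisson_op_mecke a u xi : (0 <= a)%R ->
  nn_measurable (fun q : N * X => u q.1 q.2) -> xi A = 0 ->
  P a (S u) xi = a%:E * P a (mecke_diag u) xi.
Proof.
move=> a0 nu' xiA; rewrite poisson_op_point_sum ?xiA//.
rewrite [X in X + _](_ : _ = 0) ?add0e// /point_sum xiA ltry.
apply: null_set_integral => //.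
pose v zeta x := P a (u ^~ x) zeta.
have nv : nn_measurable (fun q : N * X => v q.1 q.2).
  exact: (ko_param (kernel_operator_poisson nu a0) nu').
exact: measurable_funTS (nn_measurable_section1 xi nv).1.
Qed.

End mecke.

(** * The covariance inequality *)

Section kernel_operator_combinations.
Context d (S : measurableType d) (R : realType).
Variables (Phi Psi : (S -> \bar R) -> S -> \bar R).
Hypotheses (kP : kernel_operator Phi) (kQ : kernel_operator Psi).
Hypothesis Phi1 : forall s, Phi (fun=> 1) s = 1.

Lemma ko_lincomb (k s : R) (a b e f : S -> \bar R) t : (0 <= k)%R -> (0 <= s)%R ->
  nn_measurable a -> nn_measurable b -> nn_measurable e -> nn_measurable f ->
  Phi (fun t => k%:E * ((a t + b t) + (s%:E * e t + f t))) t =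
  k%:E * ((Phi a t + Phi b t) + (s%:E * Phi e t + Phi f t)).
Proof.
move=> k0 s0 na nb ne nf.
have nse : nn_measurable (fun t => s%:E * e t).
  by apply: nn_measurableM => //; apply: nn_measurable_cst; rewrite lee_fin.
have nab := nn_measurableD na nb; have nef := nn_measurableD nse nf.
rewrite (ko_scale kP) ?lee_fin//; last exact: nn_measurableD.
by rewrite (ko_add kP)// (ko_add kP)// (ko_add kP)// (ko_scale kP) ?lee_fin.
Qed.

Lemma ko_affine (k c : R) (a b : S -> \bar R) t : (0 <= k)%R -> (0 <= c)%R ->
  nn_measurable a -> nn_measurable b ->
  Phi (fun t => a t + (k%:E * b t + c%:E)) t = Phi a t + (k%:E * Phi b t + c%:E).
Proof.
move=> k0 c0 na nb.
have nk (e : R) : (0 <= e)%R -> nn_measurable (fun _ : S => e%:E).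
  by move=> e0; apply: nn_measurable_cst; rewrite lee_fin.
have nkb := nn_measurableM (nk _ k0) nb.
rewrite (ko_add kP)//; last by apply: nn_measurableD => //; exact: nk.
rewrite (ko_add kP)//.
rewrite (ko_scale kP) ?lee_fin//.
have n1 : nn_measurable (fun _ : S => 1 : \bar R) by exact: nn_measurable_cst.
have c0' : 0 <= c%:E by rewrite lee_fin.
by have := ko_scale kP c0' n1 t; rewrite Phi1 mule1 => ->.
Qed.

(** How the hypothesis on [V * phi] is used for a product of separate averages:
    [V] and [phi] may be taken at two copies which are independent given the
    argument of [Phi], and [W1 + W2] has the same mean there as at one copy. *)
Lemma ko_product_bound (phi V1 V2 V3 W1 W2 : S -> \bar R) t :
  nn_measurable phi -> nn_measurable V1 -> nn_measurable V2 -> nn_measurable V3 ->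
  nn_measurable W1 -> nn_measurable W2 ->
  (forall s s', (V1 s + V2 s) * phi s' <= W1 s + W2 s') ->
  (forall s, V3 s <= Phi V2 s) ->
  Psi (fun s => Phi phi s * Phi V1 s) t + Psi (fun s => Phi phi s * V3 s) t <=
  Psi (Phi (fun s => W1 s + W2 s)) t.
Proof.
move=> nphi nV1 nV2 nV3 nW1 nW2 VW V32.
have n1 : nn_measurable (fun _ : S => 1 : \bar R) by exact: nn_measurable_cst.
have [nPphi nPV1] := (ko_nn kP nphi, ko_nn kP nV1).
have nV := nn_measurableD nV1 nV2; have nW := nn_measurableD nW1 nW2.
have nP1 := nn_measurableM nPphi nPV1; have nP3 := nn_measurableM nPphi nV3.
rewrite -(ko_add kQ nP1 nP3); apply: (ko_le kQ).
- exact: nn_measurableD.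
- exact: ko_nn.
move=> s; apply: (@le_trans _ _ (Phi (fun s => V1 s + V2 s) s * Phi phi s)).
  rewrite (ko_add kP nV1 nV2) ge0_muleDl; [|exact: ko_ge0..].
  by rewrite [X in X + _]muleC leeD2l// muleC lee_wpmul2r// nPphi.2.
have pw y y' : (V1 y + V2 y) * phi y' <= W1 y * 1 + 1 * W2 y'.
  by rewrite mule1 mul1e.
have := ko_bilinear_le kP nV nphi nW1 n1 n1 nW2 pw s.
by rewrite Phi1 mule1 mul1e (ko_add kP nW1 nW2).
Qed.

End kernel_operator_combinations.

(** A left-endpoint Riemann sum of [s ^ (-1/2)] over [[0, 1]] is at most [2];
    the first step, where the rate blows up, is controlled by a crude bound. *)
Lemma growth_inv_sqrt (R : realType) (C : R -> R) (c lam K w : R) :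
  (0 <= c)%R -> (0 <= w)%R -> (0 <= K)%R ->
  (forall s h, (0 <= s)%R -> (0 <= h)%R -> (s + h <= 1)%R ->
    (C (s + h) <= C s + K * h)%R) ->
  (forall s h, (0 < s)%R -> (0 <= h)%R -> (s + h <= 1)%R ->
    (C (s + h) <= C s + h * (c * (Num.sqrt s)^-1 * expR (h * lam) * w) +
      K * h ^+ 2)%R) ->
  (C 1 <= C 0 + 2 * c * w)%R.
Proof.
move=> c0 w0 K0 crude fine_step.
pose u n := (C 0 + 2 * (K * n.+1%:R^-1) + 2 * c * w * expR (n.+1%:R^-1 * lam))%R.
have Cu n : (C 1 <= u n)%R.
  set h := (n.+1%:R^-1 : R)%R; have h0 : (0 < h)%R by rewrite invr_gt0.
  have hn : (n.+1%:R * h = 1)%R by rewrite mulfV.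
  set e := expR (h * lam); have e0 : (0 <= e)%R by exact: expR_ge0.
  (* the first step is crude; each other one is bounded by a telescoping
     difference of square roots, as [h / a <= 2 * (a - b)] when
     [h = a ^+ 2 - b ^+ 2] and [b <= a] *)
  have H k : (k <= n)%N -> (C (k.+1%:R * h) <= C 0 + K * h + k%:R * (K * h ^+ 2) +
      2 * c * w * e * Num.sqrt (k%:R * h))%R.
    elim: k => [|k ih] kn.
      have := crude 0%R h (lexx _) (ltW h0).
      rewrite add0r !mul0r sqrtr0 mulr0 !addr0 mul1r; apply.
      by rewrite invf_le1// ler1n.
    have kh : (0 < k.+1%:R * h)%R by rewrite mulr_gt0.
    have := fine_step (k.+1%:R * h)%R h kh (ltW h0).
    have -> : (k.+1%:R * h + h = k.+2%:R * h)%R by rewrite -[X in (_ + X)%R]mul1r -mulrDl natr1.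
    have -> : (k.+2%:R * h <= 1)%R by rewrite -[leRHS]hn ler_pM2r// ler_nat.
    move=> /(_ isT) step; have {ih} := ih (ltnW kn).
    set a := Num.sqrt (k.+1%:R * h); set b := Num.sqrt (k%:R * h).
    have a0 : (0 < a)%R by rewrite sqrtr_gt0.
    have b0 : (0 <= b)%R by exact: sqrtr_ge0.
    have ab : (h = a ^+ 2 - b ^+ 2)%R.
      rewrite !sqr_sqrtr ?mulr_ge0// ?(ltW h0)//.
      by rewrite -mulrBl -natrB// subSnn mul1r.
    have ba : (b <= a)%R by apply: ler_wsqrtr; rewrite ler_pM2r// ler_nat.
    have hab : (h * a^-1 <= 2 * (a - b))%R.
      rewrite ler_pdivrMr// ab.
      have -> : (a ^+ 2 - b ^+ 2 = (a - b) * (a + b))%R by ring.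
      by rewrite [leRHS](_ : _ = (a - b) * (2 * a))%R; [rewrite ler_wpM2l//; lra|ring].
    have : (h * (c * a^-1 * e * w) <= 2 * c * w * e * (a - b))%R.
      have -> : (h * (c * a^-1 * e * w) = (c * w * e) * (h * a^-1))%R by ring.
      have -> : (2 * c * w * e * (a - b) = (c * w * e) * (2 * (a - b)))%R by ring.
      by rewrite ler_wpM2l// !mulr_ge0.
    move: step; rewrite -/a -/e -[in (k.+1%:R * (K * _))%R]natr1; lra.
  have := H n (leqnn n); rewrite hn /u -/h -/e => /le_trans; apply.
  have nh : (n%:R * h <= 1)%R by rewrite -[leRHS]hn ler_pM2r// ler_nat.
  have : (n%:R * (K * h ^+ 2) <= K * h)%R.
    have -> : (n%:R * (K * h ^+ 2) = (K * h) * (n%:R * h))%R by ring.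
    by rewrite -[leRHS]mulr1 ler_wpM2l// mulr_ge0// ltW.
  have : (2 * c * w * e * Num.sqrt (n%:R * h) <= 2 * c * w * e)%R.
    rewrite -[leRHS]mulr1 ler_wpM2l ?mulr_ge0//.
    by rewrite -[leRHS]sqrtr1; exact: ler_wsqrtr.
  lra.
have cu : u n @[n --> \oo] --> (C 0 + 2 * c * w)%R.
  rewrite [X in _ --> X](_ : _ = C 0 + 2 * (K * 0) + 2 * c * w * expR (0 * lam))%R;
    last by rewrite mul0r expR0; ring.
  have h0 : (fun n => n.+1%:R^-1 : R)%R @ \oo --> (0 : R)%R by exact: cvg_harmonic.
  apply: cvgD.
    by apply: cvgD; [exact: cvg_cst|apply: cvgMr; apply: cvgMr].
  apply: cvgMr.
  have hl : (fun n => n.+1%:R^-1 * lam : R)%R @ \oo --> (0 * lam : R)%R by exact: cvgMl.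
  exact: (continuous_cvg _ (@continuous_expR R _) hl).
by apply: (cvgr_to_ge cu); apply: nearW => n; exact: Cu.
Qed.

Section covariance.
Context d (X : measurableType d) (R : realType).
Local Notation N := (counting_space X R).
Variables (nu : {finite_measure set X -> \bar R}) (A : set X).
Hypotheses (mA : measurable A) (nuA : nu (~` A) = 0).
Variables (F G phi : N -> R) (M c : R).
Hypotheses (mF : measurable_fun [set: N] F) (mG : measurable_fun [set: N] G)
  (mphi : measurable_fun [set: N] phi).
Hypotheses (F0 : forall xi, (0 <= F xi)%R) (FM : forall xi, (F xi <= M)%R).
Hypotheses (G0 : forall xi, (0 <= G xi)%R) (GM : forall xi, (G xi <= M)%R).
Hypotheses (phi0 : forall xi, (0 <= phi xi)%R) (c0 : (0 <= c)%R).

Local Notation P := (poisson_op nu).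
Local Notation lam := (fine (nu [set: X])).

Definition increase (H : N -> R) xi x : R :=
  Num.max 0%R (H (add_dirac xi x) - H xi)%R.
Definition decrease (H : N -> R) xi x : R :=
  Num.max 0%R (H xi - H (add_dirac xi x))%R.

Hypothesis incG : forall xi x,
  (increase G xi x <= c * (phi (add_dirac xi x) * increase F xi x))%R.
Hypothesis decG : forall xi x,
  (decrease G xi x <= c * (phi xi * decrease F xi x))%R.

Variable w : N -> X -> R.
Hypotheses (mw : measurable_fun [set: N * X] (fun q : N * X => w q.1 q.2))
  (w0 : forall xi x, (0 <= w xi x)%R)
  (wE : forall xi x, w (add_dirac xi x) x = (increase F xi x ^+ 2)%R).

Let we (xi : N) (x : X) : \bar R := (w xi x)%:E.
Let V1 (xi : N) : \bar R := \int[nu]_x ((decrease F xi x) ^+ 2)%:E.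
Let V2 : N -> \bar R := point_sum A we.
Let V (xi : N) : \bar R := V1 xi + V2 xi.

Variables W1 W2 : N -> \bar R.
Hypotheses (nW1 : nn_measurable W1) (nW2 : nn_measurable W2).
Hypothesis VW : forall xi zeta, V xi * (phi zeta)%:E <= W1 xi + W2 zeta.

Let measurable_increase (H : N -> R) : measurable_fun [set: N] H ->
  measurable_fun [set: N * X] (fun q : N * X => increase H q.1 q.2).
Proof.
move=> mH; apply: measurable_maxr; first exact: measurable_cst.
apply: measurable_funB; last exact: (measurableT_comp mH measurable_fst).
exact: (measurableT_comp mH (@measurable_add_dirac _ X R)).
Qed.

Let measurable_decrease (H : N -> R) : measurable_fun [set: N] H ->
  measurable_fun [set: N * X] (fun q : N * X => decrease H q.1 q.2).
Proof.
move=> mH; apply: measurable_maxr; first exact: measurable_cst.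
apply: measurable_funB; first exact: (measurableT_comp mH measurable_fst).
exact: (measurableT_comp mH (@measurable_add_dirac _ X R)).
Qed.

Lemma increase_ge0 H xi x : (0 <= increase H xi x)%R.
Proof. by rewrite /increase le_max lexx. Qed.

Lemma decrease_ge0 H xi x : (0 <= decrease H xi x)%R.
Proof. by rewrite /decrease le_max lexx. Qed.

Lemma add_increase H xi x :
  (H (add_dirac xi x) + decrease H xi x = H xi + increase H xi x)%R.
Proof. by rewrite /increase /decrease; case: leP => ?; case: leP => ?; lra. Qed.

Let nnE d' (Z : measurableType d') (H : Z -> R) : measurable_fun [set: Z] H ->
  (forall z, (0 <= H z)%R) -> nn_measurable (fun z => (H z)%:E).
Proof.
by move=> mH H0; split; [exact/measurable_EFinP|move=> z; rewrite lee_fin].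
Qed.

Let nF : nn_measurable (fun xi => (F xi)%:E). Proof. exact: nnE. Qed.
Let nG : nn_measurable (fun xi => (G xi)%:E). Proof. exact: nnE. Qed.
Let nphi : nn_measurable (fun xi => (phi xi)%:E). Proof. exact: nnE. Qed.
Let nw : nn_measurable (fun q : N * X => we q.1 q.2). Proof. exact: nnE. Qed.

Let ninc (H : N -> R) : measurable_fun [set: N] H ->
  nn_measurable (fun q : N * X => (increase H q.1 q.2)%:E).
Proof.
by move=> mH; apply: nnE; [exact: measurable_increase|move=> q; exact: increase_ge0].
Qed.

Let ndec (H : N -> R) : measurable_fun [set: N] H ->
  nn_measurable (fun q : N * X => (decrease H q.1 q.2)%:E).
Proof.
by move=> mH; apply: nnE; [exact: measurable_decrease|move=> q; exact: decrease_ge0].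
Qed.

Let ndec2 : nn_measurable (fun q : N * X => ((decrease F q.1 q.2) ^+ 2)%:E).
Proof.
apply: (@nnE _ _ (fun q : N * X => (decrease F q.1 q.2 ^+ 2)%R)) => [|q].
  by apply: measurable_funX; exact: measurable_decrease.
exact: sqr_ge0.
Qed.

Let nV1 : nn_measurable V1.
Proof.
exact: (@nn_measurable_integral _ _ _ _ _ nu (fun xi x => ((decrease F xi x) ^+ 2)%:E)).
Qed.

Let nV2 : nn_measurable V2. Proof. exact: nn_measurable_point_sum. Qed.
Let nV : nn_measurable V. Proof. exact: nn_measurableD. Qed.

Let W xi := W1 xi + W2 xi.
Let nW : nn_measurable W. Proof. exact: nn_measurableD. Qed.

(** Dropping the points added during the time [h] costs at most the inverse of
    the probability that there are none. *)
Lemma poisson_op_le_mass (r h : R) (u : N -> \bar R) xi : (0 <= r)%R -> (0 <= h)%R ->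
  nn_measurable u -> P r u xi <= (expR (h * lam))%:E * P (h + r) u xi.
Proof.
move=> r0 h0 nu'; rewrite -poisson_opD//.
have kP := kernel_operator_poisson nu r0.
have nPu := ko_nn kP nu'.
apply: (@le_trans _ _ ((expR (h * lam))%:E * ((expR (- (h * lam)))%:E *
    (P r u xi + h%:E * birth nu (P r u) xi)))); last first.
  by rewrite lee_wpmul2l ?lee_fin ?expR_ge0//; exact: poisson_op_lower.
rewrite muleA -EFinM -expRD addrN expR0 mul1e leeDl// mule_ge0 ?lee_fin//.
exact: (ko_ge0 (kernel_operator_birth nu)).
Qed.

Section rate.
Variables (s r h : R).
Hypotheses (s0 : (0 <= s)%R) (r0 : (0 <= r)%R) (h0 : (0 <= h)%R).
Hypothesis srh : (s + r + h = 1)%R.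

Let kr := kernel_operator_poisson nu r0.
Let ks := kernel_operator_poisson nu s0.
Let f := P r (EFin \o F).
Let g := P r (EFin \o G).

(** The rate of growth of the interpolated covariance. *)
Definition cov_rate xi : \bar R := \int[nu]_x
  (P r (fun t => (increase G t x)%:E) xi * P r (fun t => (increase F t x)%:E) xi +
   P r (fun t => (decrease G t x)%:E) xi * P r (fun t => (decrease F t x)%:E) xi).

Let nPinc (H : N -> R) : measurable_fun [set: N] H ->
  nn_measurable (fun q : N * X => P r (fun t => (increase H t q.2)%:E) q.1).
Proof. by move=> mH; exact: (@ko_param _ _ _ _ kr _ _ (fun t x => (increase H t x)%:E) (ninc mH)). Qed.

Let nPdec (H : N -> R) : measurable_fun [set: N] H ->
  nn_measurable (fun q : N * X => P r (fun t => (decrease H t q.2)%:E) q.1).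
Proof. by move=> mH; exact: (@ko_param _ _ _ _ kr _ _ (fun t x => (decrease H t x)%:E) (ndec mH)). Qed.

Let nrate : nn_measurable (fun q : N * X =>
  P r (fun t => (increase G t q.2)%:E) q.1 * P r (fun t => (increase F t q.2)%:E) q.1 +
  P r (fun t => (decrease G t q.2)%:E) q.1 * P r (fun t => (decrease F t q.2)%:E) q.1).
Proof.
by apply: nn_measurableD; apply: nn_measurableM;
  [exact: nPinc|exact: nPinc|exact: nPdec|exact: nPdec].
Qed.

Lemma nn_measurable_cov_rate : nn_measurable cov_rate.
Proof.
exact: (@nn_measurable_integral _ _ _ _ _ nu (fun xi x =>
  P r (fun t => (increase G t x)%:E) xi * P r (fun t => (increase F t x)%:E) xi +
  P r (fun t => (decrease G t x)%:E) xi * P r (fun t => (decrease F t x)%:E) xi)).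
Qed.

Let P_fin (u : N -> \bar R) (B : R) xi : nn_measurable u ->
  (forall t, u t <= B%:E) -> exists2 z : R, P r u xi = z%:E & (0 <= z <= B)%R.
Proof.
move=> nu' uB.
have B0 : (0 <= B)%R by rewrite -lee_fin; exact: le_trans (nu'.2 xi) (uB xi).
have : P r u xi <= B%:E.
  rewrite -[leRHS](@poisson_op_cst _ _ _ nu r _ xi) ?lee_fin//.
  by apply: (ko_le kr) => //; apply: nn_measurable_cst; rewrite lee_fin.
have := ko_ge0 kr nu' xi.
by case: (P r u xi) => [z| |]//; rewrite !lee_fin => z0 zB; exists z => //; rewrite z0.
Qed.

Let M0 : (0 <= M)%R. Proof. exact: le_trans (F0 point) (FM point). Qed.

Let incM H xi x : (forall t, (0 <= H t)%R) -> (forall t, (H t <= M)%R) ->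
  (increase H xi x <= M)%R.
Proof.
by move=> H0 HM; rewrite /increase ge_max M0/=; have := H0 xi; have := HM (add_dirac xi x); lra.
Qed.

Let decM H xi x : (forall t, (0 <= H t)%R) -> (forall t, (H t <= M)%R) ->
  (decrease H xi x <= M)%R.
Proof.
by move=> H0 HM; rewrite /decrease ge_max M0/=; have := H0 (add_dirac xi x); have := HM xi; lra.
Qed.

Lemma cov_rate_le_mass xi : cov_rate xi <= (2 * M ^+ 2 * lam)%:E.
Proof.
have -> : (2 * M ^+ 2 * lam)%:E = \int[nu]_x (2 * M ^+ 2)%:E.
  by rewrite integral_cst// EFinM -fin_mass.
apply: ge0_le_integral => //.
- by move=> x _; exact: (nrate.2 (xi, x)).
- exact: (nn_measurable_section1 xi (u := fun xi x =>
    P r (fun t => (increase G t x)%:E) xi * P r (fun t => (increase F t x)%:E) xi +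
    P r (fun t => (decrease G t x)%:E) xi * P r (fun t => (decrease F t x)%:E) xi) nrate).1.
move=> x _.
have ni H (mH : measurable_fun [set: N] H) :=
  nn_measurable_section2 x (u := fun xi x => (increase H xi x)%:E) (ninc mH).
have nd H (mH : measurable_fun [set: N] H) :=
  nn_measurable_section2 x (u := fun xi x => (decrease H xi x)%:E) (ndec mH).
have [z1 -> /andP[? ?]] := @P_fin _ M xi (ni _ mG) (fun t => incM t x G0 GM).
have [z2 -> /andP[? ?]] := @P_fin _ M xi (ni _ mF) (fun t => incM t x F0 FM).
have [z3 -> /andP[? ?]] := @P_fin _ M xi (nd _ mG) (fun t => decM t x G0 GM).
have [z4 -> /andP[? ?]] := @P_fin _ M xi (nd _ mF) (fun t => decM t x F0 FM).
rewrite -!EFinM -EFinD lee_fin.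
have : (z1 * z2 <= M * M)%R by exact: ler_pM.
have : (z3 * z4 <= M * M)%R by exact: ler_pM.
by rewrite expr2; lra.
Qed.


Let ni H (mH : measurable_fun [set: N] H) x :
  nn_measurable (fun t => (increase H t x)%:E).
Proof.
exact: (nn_measurable_section2 x (u := fun xi x => (increase H xi x)%:E) (ninc mH)).
Qed.

Let nd H (mH : measurable_fun [set: N] H) x :
  nn_measurable (fun t => (decrease H t x)%:E).
Proof.
exact: (nn_measurable_section2 x (u := fun xi x => (decrease H xi x)%:E) (ndec mH)).
Qed.

Let P_add (H : N -> R) xi x : measurable_fun [set: N] H -> (forall t, (0 <= H t)%R) ->
  P r (EFin \o H) (add_dirac xi x) + P r (fun t => (decrease H t x)%:E) xi =
  P r (EFin \o H) xi + P r (fun t => (increase H t x)%:E) xi.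
Proof.
move=> mH H0; rewrite poisson_op_shift.
have nH : nn_measurable (fun t => (H t)%:E) by exact: nnE.
rewrite -!(ko_add kr)//; [|exact: ni|exact: nn_measurable_addl|exact: nd].
by congr (P r _ xi); apply/funext => t; rewrite -!EFinD add_increase.
Qed.

Let ng : nn_measurable g. Proof. exact: ko_nn. Qed.
Let nf : nn_measurable f. Proof. exact: ko_nn. Qed.

(** With [g' - g = z1 - z3] and [f' - f = z2 - z4], where [z1], [z2] are the
    averaged increases and [z3], [z4] the averaged decreases, the product of the
    two increments is at most [z1 * z2 + z3 * z4]. *)
Lemma cov_growth xi :
  P h (fun t => g t * f t) xi <= P h g xi * P h f xi +
    (h * fine (cov_rate xi) + 3 * M ^+ 2 * (h * lam) ^+ 2)%:E.
Proof.
have gM t : g t <= M%:E.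
  by have [z E /andP[_ ?]] := @P_fin _ M t nG GM; rewrite [g t]E lee_fin.
have fM t : f t <= M%:E.
  by have [z E /andP[_ ?]] := @P_fin _ M t nF FM; rewrite [f t]E lee_fin.
apply: poisson_op_small_cov => //.
  exact/fine_ge0/(nn_measurable_cov_rate.2 xi).
have nrx : nn_measurable (fun x =>
    P r (fun t => (increase G t x)%:E) xi * P r (fun t => (increase F t x)%:E) xi +
    P r (fun t => (decrease G t x)%:E) xi * P r (fun t => (decrease F t x)%:E) xi).
  exact: (nn_measurable_section1 xi (u := fun xi x =>
    P r (fun t => (increase G t x)%:E) xi * P r (fun t => (increase F t x)%:E) xi +
    P r (fun t => (decrease G t x)%:E) xi * P r (fun t => (decrease F t x)%:E) xi) nrate).
have rfin : cov_rate xi \is a fin_num.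
  rewrite ge0_fin_numE; last exact: nn_measurable_cov_rate.2.
  exact: le_lt_trans (cov_rate_le_mass xi) (ltry _).
rewrite (fineK rfin) -fin_mass [X in _ + X]muleC -(birth_cst nu xi); last first.
  by rewrite mule_ge0//; [exact: ng.2|exact: nf.2].
have gx : nn_measurable (fun x => g (add_dirac xi x)) by exact: nn_measurable_addr.
have fx : nn_measurable (fun x => f (add_dirac xi x)) by exact: nn_measurable_addr.
have gc : nn_measurable (fun _ : X => g xi) by apply: nn_measurable_cst; exact: ng.2.
have fc : nn_measurable (fun _ : X => f xi) by apply: nn_measurable_cst; exact: nf.2.
have gf1 := nn_measurableM gx fx; have gf2 := nn_measurableM gc fc.
have gf3 := nn_measurableM fc gx; have gf4 := nn_measurableM gc fx.
rewrite /birth -ge0_integralD//;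
  [|by move=> x _; exact: gf1.2|exact: gf1.1|by move=> x _; exact: gf2.2].
rewrite -ge0_integralZl//; [|exact: gx.1|by move=> x _; exact: gx.2|exact: nf.2].
rewrite -ge0_integralZl//; [|exact: fx.1|by move=> x _; exact: fx.2|exact: ng.2].
rewrite -ge0_integralD//; [|by move=> x _; exact: gf3.2|exact: gf3.1
  |by move=> x _; exact: gf4.2|exact: gf4.1].
have gf5 := nn_measurableD gf3 gf4.
rewrite -ge0_integralD//; [|by move=> x _; exact: gf5.2|exact: gf5.1
  |by move=> x _; exact: nrx.2|exact: nrx.1].
apply: ge0_le_integral => //.
- by move=> x _; exact: (nn_measurableD gf1 gf2).2.
- exact: (nn_measurableD gf1 gf2).1.
- exact: (nn_measurableD gf5 nrx).1.
move=> x _.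
have := P_add xi x mG G0; have := P_add xi x mF F0; rewrite -/f -/g.
have [z1 -> /andP[? ?]] := @P_fin _ M xi (ni mG x) (fun t => incM t x G0 GM).
have [z2 -> /andP[? ?]] := @P_fin _ M xi (ni mF x) (fun t => incM t x F0 FM).
have [z3 -> /andP[? ?]] := @P_fin _ M xi (nd mG x) (fun t => decM t x G0 GM).
have [z4 -> /andP[? ?]] := @P_fin _ M xi (nd mF x) (fun t => decM t x F0 FM).
have [g1 E1 _] := @P_fin _ M xi nG GM.
have [f1 E2 _] := @P_fin _ M xi nF FM.
have [g2 E3 _] := @P_fin _ M (add_dirac xi x) nG GM.
have [f2 E4 _] := @P_fin _ M (add_dirac xi x) nF FM.
rewrite [g xi]E1 [f xi]E2 [g (add_dirac xi x)]E3 [f (add_dirac xi x)]E4.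
rewrite -!EFinM -!EFinD lee_fin => -[hf] [hg].
have -> : (z1 = g2 + z3 - g1)%R by lra.
have -> : (z2 = f2 + z4 - f1)%R by lra.
rewrite -subr_ge0.
have : (0 <= z3 * (f2 + z4 - f1) + (g2 + z3 - g1) * z4)%R.
  by rewrite addr_ge0// mulr_ge0//; lra.
lra.
Qed.

Let amgm (sg x y : R) : (0 < sg)%R ->
  (x * y <= 2^-1 * (sg^-1 * y ^+ 2 + sg * x ^+ 2))%R.
Proof.
move=> sg0; rewrite -subr_ge0.
have -> : (2^-1 * (sg^-1 * y ^+ 2 + sg * x ^+ 2) - x * y =
    2^-1 * sg^-1 * (y - sg * x) ^+ 2)%R by field; rewrite gt_eqF.
by rewrite mulr_ge0 ?sqr_ge0// mulr_ge0// invr_ge0// ltW.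
Qed.

(** Each product in [cov_rate] is an average over two copies [y], [y'] of [phi]
    times an increment of [F] at [y] and an increment of [F] at [y'].  The
    inequality of the arithmetic and the geometric mean leaves [phi] at [y] times
    the square of an increment at [y] or at [y'].  Integrals of squared
    decreases are the first part of [V].  For squared increases the Mecke formula
    at time [s] is used if the square is at [y'], since [phi] and the square then
    share only the points of intensity [s * nu]; it costs a factor [1 / s], which
    the weight [sqrt s] in front of that square compensates.  If the square is at
    [y], the Mecke formula at time 1 costs nothing. *)
Lemma cov_rate_bound (xi : N) : xi A = 0 -> (0 < s)%R ->
  P s cov_rate xi <=
  (c * (Num.sqrt s)^-1 * expR (h * lam))%:E * P 1 W xi.
Proof.
move=> xiA sp.
set sg := Num.sqrt s.
have sg0 : (0 < sg)%R by rewrite sqrtr_gt0.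
have s_le1 : (s <= 1)%R.
  by rewrite -srh -addrA lerDl addr_ge0.
have sg1 : (sg <= 1)%R by rewrite -[leRHS]sqrtr1; exact: ler_wsqrtr.
have sgV : (sg <= sg^-1)%R by rewrite (le_trans sg1)// invf_ge1.
have sg2 : (sg ^+ 2 = s)%R by rewrite sqr_sqrtr.
have sgV0 : (0 <= sg^-1)%R by rewrite invr_ge0 ltW.
have r1 : (0 <= s + r)%R by rewrite addr_ge0.
pose k1 := (c * 2^-1 * sg^-1)%R.
have k10 : (0 <= k1)%R by rewrite !mulr_ge0.
have k10e : 0 <= k1%:E by rewrite lee_fin.
have k1s : (k1 * s = c * 2^-1 * sg)%R.
  by rewrite /k1 -sg2; field; rewrite gt_eqF.
pose phie t := (phi t)%:E : \bar R.
pose phix t x := (phi (add_dirac t x))%:E : \bar R.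
pose d2 t x := (decrease F t x ^+ 2)%:E : \bar R.
pose i2 t x := (increase F t x ^+ 2)%:E : \bar R.
have ki := kernel_operator_birth nu.
have nphix : nn_measurable (fun q : N * X => phix q.1 q.2).
  exact: (nn_measurableT_comp nphi (@measurable_add_dirac _ X R)).
have nd2 : nn_measurable (fun q : N * X => d2 q.1 q.2) by exact: ndec2.
have ni2 : nn_measurable (fun q : N * X => i2 q.1 q.2).
  apply: (@nnE _ _ (fun q : N * X => (increase F q.1 q.2 ^+ 2)%R)) => [|q].
    by apply: measurable_funX; exact: measurable_increase.
  exact: sqr_ge0.
have nphi1 : nn_measurable (fun q : N * X => phie q.1).
  exact: (nn_measurableT_comp nphi measurable_fst).
have npd2 : nn_measurable (fun q : N * X => phie q.1 * d2 q.1 q.2).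
  exact: nn_measurableM.
have npi2 : nn_measurable (fun q : N * X => phix q.1 q.2 * i2 q.1 q.2).
  exact: nn_measurableM.
have sec (u : N -> X -> \bar R) x : nn_measurable (fun q : N * X => u q.1 q.2) ->
  nn_measurable (u ^~ x) by exact: nn_measurable_section2.
have par (u : N -> X -> \bar R) : nn_measurable (fun q : N * X => u q.1 q.2) ->
  nn_measurable (fun q : N * X => P r (u ^~ q.2) q.1) by exact: (ko_param kr).
have nint (u : N -> X -> \bar R) : nn_measurable (fun q : N * X => u q.1 q.2) ->
  nn_measurable (fun t => \int[nu]_x u t x) by exact: nn_measurable_integral.
have nk (u : N -> \bar R) (k : R) : (0 <= k)%R -> nn_measurable u ->
    nn_measurable (fun t => k%:E * u t).
  by move=> k0 nu'; apply: nn_measurableM => //; exact: nn_measurable_cst.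
have n1 : nn_measurable (fun _ : N => 1 : \bar R) by exact: nn_measurable_cst.
pose a1 t x := P r phie t * P r (d2 ^~ x) t.
pose a2 t x := P r (fun t => phie t * d2 t x) t.
pose a3 t x := P r (phix ^~ x) t * P r (i2 ^~ x) t.
pose a4 t x := P r (fun t => phix t x * i2 t x) t.
have nPphi1 : nn_measurable (fun q : N * X => P r phie q.1).
  exact: (nn_measurableT_comp (ko_nn kr nphi) measurable_fst).
have na1 : nn_measurable (fun q : N * X => a1 q.1 q.2).
  by apply: nn_measurableM => //; exact: (par d2).
have na2 : nn_measurable (fun q : N * X => a2 q.1 q.2).
  exact: (par (fun t x => phie t * d2 t x)).
have na3 : nn_measurable (fun q : N * X => a3 q.1 q.2).
  by apply: nn_measurableM; [exact: (par phix)|exact: (par i2)].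
have na4 : nn_measurable (fun q : N * X => a4 q.1 q.2).
  exact: (par (fun t x => phix t x * i2 t x)).
have B1 t x : P r (fun t => (decrease G t x)%:E) t * P r (fun t => (decrease F t x)%:E) t
    <= k1%:E * (a1 t x + a2 t x).
  have pw y y' : (decrease G y x)%:E * (decrease F y' x)%:E <=
      k1%:E * phie y * d2 y' x + k1%:E * (phie y * d2 y x) * 1.
    rewrite mule1 -!EFinM -EFinD lee_fin.
    have D := decrease_ge0 F y x; have D' := decrease_ge0 F y' x.
    apply: (le_trans (ler_wpM2r D' (decG y x))).
    have := @amgm sg (decrease F y x) (decrease F y' x) sg0.
    have : (sg * decrease F y x ^+ 2 <= sg^-1 * decrease F y x ^+ 2)%R.
      by rewrite ler_wpM2r// sqr_ge0.
    move=> h1 h2.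
    have : (c * phi y * (decrease F y x * decrease F y' x) <= c * phi y *
       (2^-1 * (sg^-1 * decrease F y' x ^+ 2 + sg^-1 * decrease F y x ^+ 2)))%R.
      by rewrite ler_wpM2l ?mulr_ge0//; lra.
    by rewrite /k1; lra.
  have := ko_bilinear_le kr (nd mG x) (nd mF x)
    (nk _ _ k10 nphi) (sec d2 x nd2)
    (nk _ _ k10 (sec (fun t x => phie t * d2 t x) x npd2)) n1 pw t.
  rewrite !(ko_scale kr)//; [|exact: (sec (fun t x => phie t * d2 t x))].
  by rewrite poisson_op_cst// mule1 -muleA -ge0_muleDr//;
    [exact: (na1.2 (t, x))|exact: (na2.2 (t, x))].
have B2 t x : P r (fun t => (increase G t x)%:E) t * P r (fun t => (increase F t x)%:E) t
    <= k1%:E * (s%:E * a3 t x + a4 t x).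
  have k1s0 : (0 <= k1 * s)%R by rewrite mulr_ge0.
  have pw y y' : (increase G y x)%:E * (increase F y' x)%:E <=
      (k1 * s)%:E * phix y x * i2 y' x + k1%:E * (phix y x * i2 y x) * 1.
    rewrite mule1 -!EFinM -EFinD lee_fin k1s.
    have D := increase_ge0 F y x; have D' := increase_ge0 F y' x.
    apply: (le_trans (ler_wpM2r D' (incG y x))).
    have h2 := @amgm sg (increase F y' x) (increase F y x) sg0.
    have : (c * phi (add_dirac y x) * (increase F y' x * increase F y x) <=
       c * phi (add_dirac y x) *
       (2^-1 * (sg^-1 * increase F y x ^+ 2 + sg * increase F y' x ^+ 2)))%R.
      by rewrite ler_wpM2l ?mulr_ge0//.
    by rewrite /k1; lra.
  have := ko_bilinear_le kr (ni mG x) (ni mF x)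
    (nk _ _ k1s0 (sec phix x nphix)) (sec i2 x ni2)
    (nk _ _ k10 (sec (fun t x => phix t x * i2 t x) x npi2)) n1 pw t.
  rewrite (ko_scale kr (k := (k1 * s)%:E)) ?lee_fin//; last exact: (sec phix).
  rewrite (ko_scale kr (k := k1%:E)) ?lee_fin//;
    last exact: (sec (fun t x => phix t x * i2 t x)).
  rewrite poisson_op_cst// mule1 -muleA EFinM -muleA -ge0_muleDr//.
  - by rewrite mule_ge0 ?lee_fin//; exact: (na3.2 (t, x)).
  - exact: (na4.2 (t, x)).
(* the terms with the square at [y'] and at [y], as functions of a point that
   has been added *)
pose u t x := P r phie t * P r (we ^~ x) t.
pose v t x := phie t * we t x.
have nPw : nn_measurable (fun q : N * X => P r (we ^~ q.2) q.1) by exact: (par we).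
have nu' : nn_measurable (fun q : N * X => u q.1 q.2) by exact: nn_measurableM.
have nv' : nn_measurable (fun q : N * X => v q.1 q.2) by exact: nn_measurableM.
have secA (y : N -> X -> \bar R) t : nn_measurable (fun q : N * X => y q.1 q.2) ->
  nn_measurable (y t) by exact: nn_measurable_section1.
pose E1 t := P r phie t * P r V1 t.
pose E2 := P r (fun t => phie t * V1 t).
pose E3 := mecke_diag nu u.
pose E4 := P r (mecke_diag nu v).
have E1E t : \int[nu]_x a1 t x = E1 t.
  have nPd : nn_measurable (fun q : N * X => P r (d2 ^~ q.2) q.1) by exact: (par d2).
  rewrite /a1 ge0_integralZl//.
  + by rewrite -(ko_int kr nu nd2).
  + exact: (secA (fun t x => P r (d2 ^~ x) t) t nPd).1.
  + by move=> x _; exact: (secA (fun t x => P r (d2 ^~ x) t) t nPd).2.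
  + exact: ko_ge0.
have E2E t : \int[nu]_x a2 t x = E2 t.
  rewrite /a2 -(ko_int kr nu npd2).
  congr (P r _ t); apply/funext => z; rewrite ge0_integralZl//.
  + exact: (secA _ z nd2).1.
  + by move=> x _; exact: (secA _ z nd2).2.
  + exact: nphi.2.
have E3E t : \int[nu]_x a3 t x = E3 t.
  apply: eq_integral => x _; rewrite /u /a3 !poisson_op_shift; congr (_ * P r _ t).
  by apply/funext => z; rewrite /we wE.
have E4E t : \int[nu]_x a4 t x = E4 t.
  rewrite /a4 -(ko_int kr nu npi2).
  congr (P r _ t); apply/funext => z; apply: eq_integral => x _.
  by rewrite /v /we wE.
have nmu := nn_measurable_mecke_diag nu nu'.
have nmv := nn_measurable_mecke_diag nu nv'.
have npV1 := nn_measurableM nphi nV1.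
have npV2 := nn_measurableM nphi nV2.
have nE1 : nn_measurable E1 by apply: nn_measurableM; exact: ko_nn.
have nE2 : nn_measurable E2 by exact: ko_nn.
have nE3 : nn_measurable E3 by [].
have nE4 : nn_measurable E4 by exact: ko_nn.
have rateE t : cov_rate t <= k1%:E * ((E1 t + E2 t) + (s%:E * E3 t + E4 t)).
  rewrite -E1E -E2E -E3E -E4E.
  have na5 := nn_measurableD (secA _ t na1) (secA _ t na2).
  have ns3 : nn_measurable (fun x => s%:E * a3 t x).
    by apply: nn_measurableM (secA _ t na3); apply: nn_measurable_cst; rewrite lee_fin.
  have na6 := nn_measurableD ns3 (secA _ t na4).
  have na7 := nn_measurableD na5 na6.
  rewrite -ge0_integralZl//; [|exact: (secA _ t na3).1|by move=> x _; exact: (secA _ t na3).2].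
  have [m1 p1] := secA _ t na1; have [m2 p2] := secA _ t na2; have [m4 p4] := secA _ t na4.
  have [m3 p3] := ns3; have [m5 p5] := na5; have [m6 p6] := na6.
  rewrite -ge0_integralD//; rewrite -ge0_integralD//; rewrite -ge0_integralD//.
  rewrite -ge0_integralZl//; [|exact: na7.1|by move=> x _; exact: na7.2].
  apply: ge0_le_integral => //.
  - by move=> x _; exact: (nrate.2 (t, x)).
  - exact: (nn_measurable_section1 t (u := fun xi x =>
    P r (fun t => (increase G t x)%:E) xi * P r (fun t => (increase F t x)%:E) xi +
    P r (fun t => (decrease G t x)%:E) xi * P r (fun t => (decrease F t x)%:E) xi) nrate).1.
  - by apply: emeasurable_funM => //; exact: na7.1.
  move=> x _; rewrite ge0_muleDr; [|exact: na5.2|exact: na6.2].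
  by rewrite addeC leeD.
have h1sr : (h + (s + r) = 1)%R by rewrite addrC.
have mass y : nn_measurable y ->
    P s (P r y) xi <= (expR (h * lam))%:E * P 1 y xi.
  by move=> ny; rewrite poisson_opD// -h1sr; exact: poisson_op_le_mass.
have eW0 : 0 <= (expR (h * lam))%:E :> \bar R by rewrite lee_fin expR_ge0.
have kp1 := kernel_operator_poisson nu (@ler01 R).
have SZ (k : N -> \bar R) (y : N -> X -> \bar R) t : (forall t, 0 <= k t) ->
    nn_measurable (fun q : N * X => y q.1 q.2) ->
    point_sum A (fun t x => k t * y t x) t = k t * point_sum A y t.
  move=> k0 ny; rewrite /point_sum; case: ifP => _; last by rewrite mule0.
  have nyt := secA _ t ny; rewrite ge0_integralZl//.
  - exact: measurable_funTS nyt.1.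
  - by move=> x _; exact: nyt.2.
(* [phi] and the square at different copies *)
have H1 : P s E1 xi + s%:E * P s E3 xi <= (expR (h * lam))%:E * P 1 W xi.
  have MK : P s (point_sum A u) xi = s%:E * P s E3 xi.
    exact: (poisson_op_mecke mA nuA s0 nu' xiA).
  rewrite -MK.
  have -> : point_sum A u =
      fun t => P r phie t * point_sum A (fun zeta x => P r (we ^~ x) zeta) t.
    apply/funext => t.
    exact: (SZ (P r phie) (fun zeta x => P r (we ^~ x) zeta) t (ko_nn kr nphi).2 nPw).
  apply: (le_trans _ (mass W nW)).
  have Pr1 t : P r (fun=> 1) t = 1 by exact: poisson_op_cst.
  have nSP := @nn_measurable_point_sum _ _ _ _ mA (fun t x => P r (we ^~ x) t) nPw.
  have SP t := point_sum_poisson_op_le mA nuA t r0 nw.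
  exact: (ko_product_bound kr ks Pr1 xi nphi nV1 nV2 nSP nW1 nW2 VW SP).
(* [phi] and the square at the same copy *)
have H2 : P s E2 xi + P s E4 xi <= (expR (h * lam))%:E * P 1 W xi.
  have nD := nn_measurableD npV1 nmv.
  rewrite -(ko_add ks nE2 nE4).
  have -> : (fun t => E2 t + E4 t) = P r (fun t => phie t * V1 t + mecke_diag nu v t).
    by apply/funext => t; rewrite (ko_add kr npV1 nmv).
  apply: (le_trans (mass _ nD)); rewrite lee_wpmul2l// (ko_add kp1 npV1 nmv).
  have MK : P 1 (point_sum A v) xi = 1%:E * P 1 (mecke_diag nu v) xi.
    exact: (poisson_op_mecke mA nuA ler01 nv' xiA).
  rewrite mul1e in MK; rewrite -MK.
  have -> : point_sum A v = fun t => phie t * V2 t.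
    by apply/funext => t; exact: (SZ phie we t nphi.2 nw).
  rewrite -(ko_add kp1 npV1 npV2); apply: (ko_le kp1) => //; first exact: nn_measurableD.
  move=> t; rewrite -ge0_muleDr; [|exact: nV1.2|exact: nV2.2].
  by rewrite muleC; exact: VW.
have nE12 := nn_measurableD nE1 nE2.
have nE34 := nn_measurableD (nk _ _ s0 nE3) nE4.
have nE := nn_measurableD nE12 nE34.
apply: (le_trans (ko_le ks nn_measurable_cov_rate (nk _ _ k10 nE) rateE xi)).
have L := ko_lincomb ks xi k10 s0 nE1 nE2 nE3 nE4.
rewrite [leLHS]L {L}.
have -> : (c * sg^-1 * expR (h * lam))%:E * P 1 W xi = k1%:E *
    ((expR (h * lam))%:E * P 1 W xi + (expR (h * lam))%:E * P 1 W xi).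
  have P1W : 0 <= P 1 W xi by exact: ko_ge0.
  rewrite -ge0_muleDl ?lee_fin ?expR_ge0// muleA -EFinD -EFinM; congr (_%:E * _).
  by rewrite /k1; field; rewrite gt_eqF.
by rewrite lee_wpmul2l// addeACA leeD.
Qed.

End rate.

(** The interpolation between the product of the expectations ([s = 0]) and the
    expectation of the product ([s = 1]): a part of intensity [s nu] is shared
    by the two copies of the process. *)
Let interp s : N -> \bar R :=
  P s (fun t => P (1 - s) (EFin \o G) t * P (1 - s) (EFin \o F) t).

Let P_bounded a (u : N -> \bar R) (B : R) xi : (0 <= a)%R -> nn_measurable u ->
  (forall t, u t <= B%:E) -> P a u xi <= B%:E.
Proof.
move=> a0 nu' uB.
have B0 : 0 <= B%:E by exact: le_trans (nu'.2 xi) (uB xi).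
rewrite -[leRHS](@poisson_op_cst _ _ _ nu a _ xi)//.
by apply: (ko_le (kernel_operator_poisson nu a0)) => //; exact: nn_measurable_cst.
Qed.

Let interp_step s h xi : (0 <= s)%R -> (0 <= h)%R -> (s + h <= 1)%R ->
  interp (s + h) xi <= interp s xi +
    (h%:E * P s (cov_rate (1 - (s + h))) xi + (3 * M ^+ 2 * (h * lam) ^+ 2)%:E).
Proof.
move=> s0 h0 sh1; set r := (1 - (s + h))%R; set K := (3 * _ * _)%R.
have r0 : (0 <= r)%R by rewrite subr_ge0.
have s1 : (1 - s = h + r)%R by rewrite /r; ring.
have K0 : (0 <= K)%R by apply: mulr_ge0; rewrite ?sqr_ge0// mulr_ge0 ?sqr_ge0.
have ks := kernel_operator_poisson nu s0; have kh := kernel_operator_poisson nu h0.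
have kr := kernel_operator_poisson nu r0.
have [ng nf] := (ko_nn kr nG, ko_nn kr nF).
have ngf := nn_measurableM ng nf.
have nrate := nn_measurable_cov_rate r0.
have iE2 : interp (s + h) xi =
    P s (P h (fun t => P r (EFin \o G) t * P r (EFin \o F) t)) xi.
  by rewrite /interp -/r -(poisson_opD nu _ s0 h0 ngf).
have [nhg nhf] := (ko_nn kh ng, ko_nn kh nf).
have nhgf := nn_measurableM nhg nhf.
have nhr : nn_measurable (fun t => h%:E * cov_rate r t).
  by apply: nn_measurableM => //; apply: nn_measurable_cst; rewrite lee_fin.
have nK : nn_measurable (fun _ : N => K%:E).
  by apply: nn_measurable_cst; rewrite lee_fin.
have nhrK := nn_measurableD nhr nK.
have gE t : P (1 - s) (EFin \o G) t = P h (P r (EFin \o G)) t.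
  by rewrite s1 poisson_opD.
have fE t : P (1 - s) (EFin \o F) t = P h (P r (EFin \o F)) t.
  by rewrite s1 poisson_opD.
have iE : interp s xi = P s (fun t => P h (P r (EFin \o G)) t * P h (P r (EFin \o F)) t) xi.
  congr (P s _ xi); apply/funext => t.
  exact: (f_equal2 mule (gE t) (fE t)).
have pw t : P h (fun t => P r (EFin \o G) t * P r (EFin \o F) t) t <=
    P h (P r (EFin \o G)) t * P h (P r (EFin \o F)) t + (h%:E * cov_rate r t + K%:E).
  have rfin : cov_rate r t \is a fin_num.
    rewrite ge0_fin_numE; last exact: nrate.2.
    exact: le_lt_trans (cov_rate_le_mass r0 t) (ltry _).
  have E : (h * fine (cov_rate r t) + K)%:E = h%:E * cov_rate r t + K%:E.
    by rewrite -[in RHS](fineK rfin).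
  by rewrite -E; exact: cov_growth.
have le := ko_le ks (ko_nn kh ngf) (nn_measurableD nhgf nhrK) pw xi.
have Ps1 t : P s (fun=> 1) t = 1 by exact: poisson_op_cst.
have L := ko_affine ks Ps1 xi h0 K0 nhgf nrate.
by rewrite iE2 iE -L; exact: le.
Qed.

(** The integration of the rate along the interpolation.  If the mean of [W] is
    infinite there is nothing to prove, otherwise everything is finite and
    [growth_inv_sqrt] applies. *)
Theorem poisson_covariance_le (xi : N) : xi A = 0 -> (0 < c)%R ->
  P 1 (fun t => (G t)%:E * (F t)%:E) xi <=
  P 1 (EFin \o G) xi * P 1 (EFin \o F) xi + (2 * c)%:E * P 1 W xi.
Proof.
move=> xiA cp.
have kP a (a0 : (0 <= a)%R) := kernel_operator_poisson nu a0.
have W0 : 0 <= P 1 W xi by exact: (ko_ge0 (kP _ ler01)).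
have P0 (u : N -> \bar R) a : (0 <= a)%R -> nn_measurable u -> 0 <= P a u xi.
  by move=> a0 nu'; exact: (ko_ge0 (kP _ a0)).
have [Wfin|] := boolP (P 1 W xi \is a fin_num); last first.
  rewrite ge0_fin_numE// -leNgt leye_eq => /eqP ->.
  rewrite gt0_muley ?lte_fin ?mulr_gt0// addey ?leey//.
  by rewrite gt_eqF// (lt_le_trans (ltNyr 0%R))// mule_ge0//; exact: P0.
have M0 : (0 <= M)%R by exact: le_trans (F0 xi) (FM xi).
have interp_fin s : (0 <= s)%R -> (s <= 1)%R -> interp s xi \is a fin_num.
  move=> s0 s1; have r0 : (0 <= 1 - s)%R by rewrite subr_ge0.
  have [ng nf] := (ko_nn (kP _ r0) nG, ko_nn (kP _ r0) nF).
  have ngf := nn_measurableM ng nf.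
  rewrite ge0_fin_numE; last exact: P0.
  apply: le_lt_trans (ltry (M * M)); apply: (P_bounded xi s0 ngf) => t.
  rewrite EFinM lee_pmul//; [exact: ng.2|exact: nf.2|..].
  - by apply: P_bounded => // z; rewrite lee_fin.
  - by apply: P_bounded => // z; rewrite lee_fin.
pose C s := fine (interp s xi).
have CE s : (0 <= s)%R -> (s <= 1)%R -> interp s xi = (C s)%:E.
  by move=> s0 s1; rewrite fineK//; exact: interp_fin.
set w1 := fine (P 1 W xi); have WE : P 1 W xi = w1%:E by rewrite fineK.
have w10 : (0 <= w1)%R by exact: fine_ge0.
have lam0 : (0 <= lam)%R by exact: fine_ge0.
pose K := (2 * M ^+ 2 * lam + 3 * M ^+ 2 * lam ^+ 2)%R.
have M20 : (0 <= M ^+ 2)%R by exact: sqr_ge0.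
have lam20 : (0 <= lam ^+ 2)%R by exact: sqr_ge0.
have K0 : (0 <= K)%R by rewrite addr_ge0// mulr_ge0// mulr_ge0.
have H : (C 1 <= C 0 + 2 * c * w1)%R.
  have step s h : (0 <= s)%R -> (0 <= h)%R -> (s + h <= 1)%R -> forall B : R,
      P s (cov_rate (1 - (s + h))) xi <= B%:E ->
      (C (s + h) <= C s + (h * B + 3 * M ^+ 2 * (h * lam) ^+ 2))%R.
    move=> s0 h0 sh B HB; have I := interp_step xi s0 h0 sh.
    have Es : interp s xi = (C s)%:E by apply: CE => //; rewrite (le_trans _ sh)// lerDl.
    have Esh : interp (s + h) xi = (C (s + h))%:E by apply: CE => //; exact: addr_ge0.
    rewrite Es Esh in I; rewrite -lee_fin; apply: (le_trans I).
    rewrite [leRHS]EFinD; apply: leeD2l; rewrite [leRHS]EFinD; apply: leeD2r.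
    by rewrite EFinM; apply: lee_wpmul2l.
  apply: (@growth_inv_sqrt _ _ _ lam K) => //.
  - move=> s h s0 h0 sh.
    have r0 : (0 <= 1 - (s + h))%R by rewrite subr_ge0.
    have h1 : (h <= 1)%R by rewrite (le_trans _ sh)// lerDr.
    have := @step s h s0 h0 sh (2 * M ^+ 2 * lam)%R.
    move=> /(_ (P_bounded xi s0 (nn_measurable_cov_rate r0) (cov_rate_le_mass r0))).
    move=> /le_trans; apply; rewrite lerD2l.
    have b0 : (0 <= 3 * M ^+ 2 * lam ^+ 2)%R by rewrite mulr_ge0// mulr_ge0.
    have hh : (h ^+ 2 * (3 * M ^+ 2 * lam ^+ 2) <= h * (3 * M ^+ 2 * lam ^+ 2))%R.
      by rewrite ler_wpM2r// expr2 -[leRHS]mulr1 ler_wpM2l.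
    have -> : (3 * M ^+ 2 * (h * lam) ^+ 2 = h ^+ 2 * (3 * M ^+ 2 * lam ^+ 2))%R by ring.
    have -> : (K * h = h * (2 * M ^+ 2 * lam) + h * (3 * M ^+ 2 * lam ^+ 2))%R.
      by rewrite /K; ring.
    by rewrite lerD2l.
  - move=> s h s0 h0 sh.
    have r0 : (0 <= 1 - (s + h))%R by rewrite subr_ge0.
    have e1 : (s + (1 - (s + h)) + h = 1)%R by ring.
    have := cov_rate_bound (ltW s0) r0 h0 e1 xiA s0; rewrite WE -EFinM.
    move=> /(step s h (ltW s0) h0 sh) /le_trans; apply.
    rewrite addrA lerD2l.
    have -> : (3 * M ^+ 2 * (h * lam) ^+ 2 = 3 * M ^+ 2 * lam ^+ 2 * h ^+ 2)%R by ring.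
    by rewrite ler_wpM2r ?sqr_ge0// /K lerDr mulr_ge0// mulr_ge0.
have i0 : interp 0 xi = P 1 (EFin \o G) xi * P 1 (EFin \o F) xi.
  by rewrite /interp poisson_op0 subr0.
have i1 : interp 1 xi = P 1 (fun t => (G t)%:E * (F t)%:E) xi.
  rewrite /interp subrr; congr (P 1 _ xi); apply/funext => t.
  by rewrite !poisson_op0.
have E0 : interp 0 xi = (C 0)%:E by exact: CE.
have E1 : interp 1 xi = (C 1)%:E by exact: CE.
by rewrite -i1 -i0 WE E0 E1 -EFinM -EFinD lee_fin.
Qed.

End covariance.

(** * Restrictions and independence over disjoint cells *)

Section restriction.
Context d (X : measurableType d) (R : realType).
Local Notation N := (counting_space X R).
Variables (A : set X) (mA : measurable A).

Section restrict.
Variable xi : N.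

Let val : {measure set X -> \bar R} := mrestr xi (measurableC mA).

Let valued (B : set X) : measurable B ->
  val B = +oo \/ exists n : nat, val B = n%:R%:E.
Proof.
by move=> mB; apply: counting_valued; apply: measurableI => //; exact: measurableC.
Qed.

Let sfin : sigma_finite [set: X] val.
Proof.
have [F XF mF] := counting_sigma_finite xi.
exists F => // i; have [mFi Fioo] := mF i; split => //.
rewrite /val /= /mrestr (le_lt_trans _ Fioo)// le_measure ?inE//.
by apply: measurableI => //; exact: measurableC.
Qed.

Definition outside : N := CountingSpace valued sfin.

Lemma outsideE B : outside B = xi (B `&` ~` A). Proof. by []. Qed.

End restrict.

Lemma measurable_outside : measurable_fun [set: N] outside.
Proof.
apply: measurable_fun_counting => B mB; under eq_fun do rewrite outsideE.
by apply: measurable_count; apply: measurableI => //; exact: measurableC.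
Qed.

Lemma outside_in xi B : B `<=` A -> outside xi B = 0.
Proof. by move=> BA; rewrite outsideE (disjoints_subset _ _).2 ?setCK// measure0. Qed.

Lemma outside_out xi B : B `<=` ~` A -> outside xi B = xi B.
Proof. by move=> BA; rewrite outsideE setIidl. Qed.

End restriction.

Section cells.
Context d (X : measurableType d) (R : realType).
Local Notation N := (counting_space X R).
Implicit Types (nu : {finite_measure set X -> \bar R}) (xi : N).

(** Functionals that respect a relation stable under adding points still do so
    after averaging over added points. *)
Lemma iter_birth_rel nu (r : N -> N -> Prop) n (h : N -> \bar R) xi zeta :
  (forall xi zeta x, r xi zeta -> r (add_dirac xi x) (add_dirac zeta x)) ->
  (forall xi zeta, r xi zeta -> h xi = h zeta) -> r xi zeta ->
  iter n (birth nu) h xi = iter n (birth nu) h zeta.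
Proof.
move=> rD rh; elim: n xi zeta => [|n ih] xi zeta rxz /=; first exact: rh.
by apply: eq_integral => x _; apply: ih; exact: rD.
Qed.

Lemma poisson_op_rel nu (r : N -> N -> Prop) a (h : N -> \bar R) xi zeta :
  (forall xi zeta x, r xi zeta -> r (add_dirac xi x) (add_dirac zeta x)) ->
  (forall xi zeta, r xi zeta -> h xi = h zeta) -> r xi zeta ->
  poisson_op nu a h xi = poisson_op nu a h zeta.
Proof.
by move=> rD rh rxz; apply: eq_eseriesr => n _; rewrite (iter_birth_rel _ _ rD rh rxz).
Qed.

Lemma add_dirac_out xi x E : ~ E x -> add_dirac xi x E = xi E.
Proof. by move=> Ex; rewrite add_diracE diracE memNset// adde0. Qed.

Lemma add_dirac_in xi x E : E x -> add_dirac xi x E = xi E + 1.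
Proof. by move=> Ex; rewrite add_diracE diracE mem_set. Qed.

(** The law of [y + n] with [n] Poisson distributed of mean [m]. *)
Definition shifted_poisson (m : R) (c : \bar R -> \bar R) (y : \bar R) : \bar R :=
  \sum_(n <oo) (poisson_weight 1 m n * m ^+ n)%:E * c (y + n%:R%:E).

Lemma nn_measurable_count (E : set X) (c : \bar R -> \bar R) :
  measurable E -> nn_measurable c -> nn_measurable (fun xi : N => c (xi E)).
Proof.
by move=> mE nc; apply: (nn_measurableT_comp nc); exact: measurable_count.
Qed.

Lemma nn_measurable_shifted_poisson m c : (0 <= m)%R -> nn_measurable c ->
  nn_measurable (shifted_poisson m c).
Proof.
move=> m0 nc; apply: nn_measurable_sum => n; apply: nn_measurableM.
  by apply: nn_measurable_cst; rewrite lee_fin mulr_ge0 ?poisson_weight_ge0 ?exprn_ge0.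
apply: (nn_measurableT_comp nc); apply: emeasurable_funD => //.
Qed.

Lemma poisson_op_cell nu (E : set X) (c : \bar R -> \bar R) xi :
  measurable E -> nu (~` E) = 0 -> nn_measurable c ->
  poisson_op nu 1 (fun zeta => c (zeta E)) xi =
  shifted_poisson (fine (nu [set: X])) c (xi E).
Proof.
move=> mE nuE nc; set m := fine _.
have m0 : (0 <= m)%R by exact: fine_ge0.
suff H n zeta : iter n (birth nu) (fun zeta => c (zeta E)) zeta =
    (m ^+ n)%:E * c (zeta E + n%:R%:E).
  by apply: eq_eseriesr => n _; rewrite H muleA -EFinM.
elim: n zeta => [|n ih] zeta; first by rewrite expr0 mul1e adde0.
transitivity (birth nu (fun zeta => (m ^+ n)%:E * c (zeta E + n%:R%:E)) zeta).
  by rewrite /=; congr (birth nu _ zeta); apply/funext => z; exact: ih.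
have nk : nn_measurable (fun y => (m ^+ n)%:E * c (y + n%:R%:E)).
  apply: nn_measurableM; first by apply: nn_measurable_cst; rewrite lee_fin exprn_ge0.
  by apply: (nn_measurableT_comp nc); exact: emeasurable_funD.
have k0 : 0 <= (m ^+ n)%:E * c (zeta E + n.+1%:R%:E).
  by rewrite mule_ge0 ?lee_fin ?exprn_ge0//; exact: nc.2.
transitivity (\int[nu]_x ((m ^+ n)%:E * c (zeta E + n.+1%:R%:E))).
  apply: (ge0_eq_integral_carrier mE nuE).
  - exact: (nn_measurable_addr zeta (nn_measurable_count mE nk)).
  - exact: nn_measurable_cst.
  - move=> x Ex; rewrite add_dirac_in// -addeA; congr (_ * c (_ + _)).
    by rewrite -EFinD nat1r.
have := birth_cst nu zeta k0; rewrite /birth => ->.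
by rewrite muleC fin_mass muleA -EFinM -exprS.
Qed.

Lemma ge0_integral_eq_restr nu (mu : {measure set X -> \bar R}) (U : set X)
    (f : X -> \bar R) :
  measurable U -> (forall B, measurable B -> nu B = mu (B `&` U)) ->
  nn_measurable f -> \int[nu]_x f x = \int[mu]_(x in U) f x.
Proof.
move=> mU nuE nf; rewrite -(ge0_integral_mrestr mu mU nf).
by apply: eq_measure_integral => B mB _; exact: nuE.
Qed.

(** Over disjoint cells the numbers of added points are independent.  The points
    in the first cell are added separately, by superposition; the other cells
    and [k] do not see them. *)
Lemma poisson_op_cells (mu : {measure set X -> \bar R}) (I : eqType) (E : I -> set X)
    (c : I -> \bar R -> \bar R) (L : seq I) nu (k : N -> \bar R) xi :
  (forall i, measurable (E i)) -> trivIset [set: I] E -> uniq L ->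
  (forall i, i \in L -> mu (E i) < +oo) ->
  (forall i, nn_measurable (c i)) ->
  (forall B, measurable B -> nu B = mu (B `&` \big[setU/set0]_(i <- L) E i)) ->
  nn_measurable k -> (forall i, i \in L -> insensitive (E i) k) ->
  poisson_op nu 1 (fun zeta => k zeta * \prod_(i <- L) c i (zeta (E i))) xi =
  k xi * \prod_(i <- L) shifted_poisson (fine (mu (E i))) (c i) (xi (E i)).
Proof.
move=> mE tE + + nc; elim: L nu k xi => [|i L ih] nu k xi.
  move=> _ _ nuE nk _; rewrite big_nil mule1.
  have nu0 : nu (~` set0) = 0 by rewrite nuE ?setC0// big_nil setI0 measure0.
  have n1 : nn_measurable (fun _ : N => 1 : \bar R) by exact: nn_measurable_cst.
  have k0 : insensitive set0 k by [].
  transitivity (poisson_op nu 1 (fun zeta => k zeta * 1) xi).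
    by congr (poisson_op nu 1 _ xi); apply/funext => z; rewrite big_nil.
  rewrite (poisson_op_insensitive xi ler01 measurable0 nu0 n1 nk k0).
  by rewrite poisson_op_cst// mule1.
rewrite cons_uniq => /andP[iL uL] fin nuE nk kins.
set U := \big[setU/set0]_(i <- L) E i in nuE *.
have mU : measurable U by apply: bigsetU_measurable => j _.
have Ui : E i `&` U = set0.
  rewrite /U big_distrr/= big1_seq// => j /andP[_ jL].
  have [//|/set0P Eij] := eqVneq (E i `&` E j) set0.
  by have ij := tE i j Logic.I Logic.I Eij; rewrite ij jL in iL.
have finU : mu U < +oo.
  have : forall j, j \in L -> mu (E j) < +oo.
    by move=> j jL; apply: fin; rewrite in_cons jL orbT.
  rewrite /U; elim: (L) => [|j L' ihL] fj; first by rewrite big_nil measure0.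
  rewrite big_cons (le_lt_trans (measureU2 _ _ _))//.
    by apply: bigsetU_measurable => l _.
  rewrite lte_add_pinfty//; first by apply: fj; rewrite mem_head.
  by apply: ihL => l lL; apply: fj; rewrite in_cons lL orbT.
have fini : mu (E i) < +oo by apply: fin; rewrite mem_head.
pose nu1 : {finite_measure set X -> \bar R} := mfrestr (mE i) fini.
pose nu2 : {finite_measure set X -> \bar R} := mfrestr mU finU.
have mUi : measurable (E i `|` U) by exact: measurableU.
have sup h zeta : nn_measurable h -> poisson_op nu 1 h zeta =
    poisson_op nu2 1 (poisson_op nu1 1 h) zeta.
  move=> nh; apply: poisson_op_superposition => // h' z nh'.
  rewrite !mul1e /birth; have nhz := nn_measurable_addr z nh'.
  rewrite (ge0_integral_eq_restr (mu := mu) mUi)//; last first.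
    by move=> B mB; rewrite nuE// big_cons.
  rewrite (ge0_integral_eq_restr (nu := nu2) (mu := mu) mU (fun B _ => erefl) nhz).
  rewrite (ge0_integral_eq_restr (nu := nu1) (mu := mu) (mE i) (fun B _ => erefl) nhz).
  rewrite addeC ge0_integral_setU//.
  - exact: measurable_funTS nhz.1.
  - by move=> x _; exact: nhz.2.
  - exact/disj_set2P.
have nc' j : nn_measurable (fun zeta : N => c j (zeta (E j))).
  exact: nn_measurable_count.
have nprod : nn_measurable (fun zeta : N => \prod_(j <- L) c j (zeta (E j))).
  elim: L {ih iL uL fin nuE kins U mU Ui finU nu2 mUi sup} => [|j L ihL].
    by under eq_fun do rewrite big_nil; exact: nn_measurable_cst.
  by under eq_fun do rewrite big_cons; exact: nn_measurableM.
have nkp := nn_measurableM nk nprod.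
have m0 : (0 <= fine (mu (E i)))%R by exact: fine_ge0.
have ns := nn_measurable_shifted_poisson m0 (nc i).
have Eij j x : j \in L -> E i x -> ~ E j x.
  move=> jL Eix Ejx; have : U x by rewrite /U (big_rem j)//=; left.
  by move=> Ux; have : (E i `&` U) x by []; rewrite Ui.
have step zeta : poisson_op nu1 1
    (fun zeta => k zeta * \prod_(j <- i :: L) c j (zeta (E j))) zeta =
    k zeta * shifted_poisson (fine (mu (E i))) (c i) (zeta (E i)) *
    \prod_(j <- L) c j (zeta (E j)).
  have nu1E : nu1 (~` E i) = 0.
    by rewrite /nu1 /= /mfrestr /mrestr setICl measure0.
  transitivity (poisson_op nu1 1 (fun zeta =>
      (k zeta * \prod_(j <- L) c j (zeta (E j))) * c i (zeta (E i))) zeta).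
    congr (poisson_op nu1 1 _ zeta); apply/funext => z.
    by rewrite big_cons -muleA; congr (_ * _); rewrite muleC.
  have ins : insensitive (E i) (fun zeta => k zeta * \prod_(j <- L) c j (zeta (E j))).
    move=> z x Ex; rewrite (kins i (mem_head _ _))//; congr (_ * _).
    by apply: eq_big_seq => j jL; rewrite add_dirac_out//; exact: Eij.
  rewrite (poisson_op_insensitive zeta ler01 (mE i) nu1E (nc' i) nkp ins).
  rewrite (poisson_op_cell zeta (mE i) nu1E (nc i)).
  have -> : fine (nu1 setT) = fine (mu (E i)).
    by rewrite /nu1 /= /mfrestr /mrestr setTI.
  by rewrite -!muleA; congr (_ * _); rewrite muleC.
have nkall : nn_measurable (fun zeta : N => k zeta * \prod_(j <- i :: L) c j (zeta (E j))).
  apply: nn_measurableM => //.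
  by under eq_fun do rewrite big_cons; exact: nn_measurableM.
rewrite sup//.
transitivity (poisson_op nu2 1 (fun zeta =>
    k zeta * shifted_poisson (fine (mu (E i))) (c i) (zeta (E i)) *
    \prod_(j <- L) c j (zeta (E j))) xi).
  by congr (poisson_op nu2 1 _ xi); apply/funext => z; exact: step.
rewrite ih//.
- by rewrite big_cons muleA.
- by move=> j jL; apply: fin; rewrite in_cons jL orbT.
- by apply: nn_measurableM => //; exact: nn_measurable_count.
- move=> j jL z x Ejx; rewrite (kins j)//; last by rewrite in_cons jL orbT.
  by rewrite add_dirac_out// => Eix; exact: (Eij j x jL Eix).
Qed.

End cells.

(** * Resampling the Poisson process on a set of finite measure *)

Section indicator_products.
Context (R : realType) (T : Type).

Lemma prode_indic (I : finType) (Q : pred I) (y : I -> T) (S : I -> set T) :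
  \prod_(i | Q i) (\1_(S i) (y i))%:E =
  ((`[< forall i, Q i -> S i (y i) >] : bool)%:R : R)%:E.
Proof.
have [H|H] := pselect (forall i, Q i -> S i (y i)).
  rewrite asboolT// big1// => i Qi; rewrite indicE mem_set//; exact: H.
rewrite asboolF//; move/existsNP : H => [i /not_implyP[Qi nS]].
by rewrite (bigD1 i)//= indicE memNset// mul0e.
Qed.

End indicator_products.

Section poisson_law.
Context d (X : measurableType d) d' (Omega : measurableType d') (R : realType).
Local Notation N := (counting_space X R).
Variables (P : probability Omega R) (mu : {measure set X -> \bar R}).
Variables (eta : Omega -> N) (eta_poisson : is_poisson_process P mu eta).

Let meta : measurable_fun [set: Omega] eta := poisson_process_measurable eta_poisson.

(** The values that a counting measure may take, encoded in a countable type. *)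
Definition count_value (o : option nat) : \bar R :=
  if o is Some n then n%:R%:E else +oo.

Lemma shifted_poisson_indic (m : R) (o : option nat) : (0 <= m)%R ->
  shifted_poisson m (fun y => (\1_[set count_value o] y)%:E) 0 =
  if o is Some n then (expR (- m) * (m ^+ n / n`!%:R))%:E else 0.
Proof.
move=> m0; rewrite /shifted_poisson; case: o => [n|] /=; last first.
  rewrite eseries0// => k _ _; rewrite add0e indicE memNset ?mule0//=.
rewrite (@nneseriesD1 _ _ n)//; last first.
  by move=> k _; rewrite mule_ge0 ?lee_fin// mulr_ge0 ?poisson_weight_ge0// exprn_ge0.
rewrite add0e indicE mem_set// mule1 eseries0 ?adde0; last first.
  move=> k _ kn; rewrite add0e indicE memNset ?mule0//= => -[] /eqP.
  by rewrite eqr_nat (negbTE kn).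
congr EFin; rewrite /poisson_weight mul1r expr1n; ring.
Qed.

Lemma poisson_probE (m : R) n : (0 <= m)%R ->
  poisson_prob m 0%N [set n] = (expR (- m) * (m ^+ n / n`!%:R))%:E.
Proof.
move=> m0; rewrite /poisson_prob.
case: ltP => [mp|]; last first.
  move=> mle; have -> : m = 0%R by apply/eqP; rewrite eq_le mle m0.
  rewrite oppr0 expR0 mul1r expr0n diracE; case: n => [|n] /=.
    by rewrite fact0 divr1 mem_set.
  by rewrite mul0r memNset.
by rewrite esum_set1// /poisson_pmf ?mp ?lee_fin//; [congr EFin; ring
  |rewrite !mulr_ge0 ?expR_ge0 ?invr_ge0// exprn_ge0].
Qed.

Lemma measurable_preimage_count (E : set X) (S : set \bar R) :
  measurable E -> measurable S -> measurable [set w | S (eta w E)].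
Proof.
move=> mE mS; have := measurableT_comp (measurable_count mE) meta.
by move=> /(_ measurableT _ mS); rewrite setTI.
Qed.

(** The defining law of the process only gives the probabilities of the finite
    values; these add up to one, so that the infinite value is negligible. *)
Lemma shifted_poisson_prob (E : set X) o : measurable E -> mu E < +oo ->
  shifted_poisson (fine (mu E)) (fun y => (\1_[set count_value o] y)%:E) 0 =
  P [set w | eta w E = count_value o].
Proof.
move=> mE finE; rewrite shifted_poisson_indic ?fine_ge0//.
have := poisson_process_distributed eta_poisson mE.
rewrite /poisson_distributed lt_eqF// => D.
case: o => [n|]; first by rewrite D poisson_probE// fine_ge0.
have mS k : measurable [set w | eta w E = count_value k].
  by apply: (measurable_preimage_count mE (S := [set count_value k])); exact: emeasurable_set1.
have U : [set: Omega] = (\bigcup_n [set w | eta w E = n%:R%:E]) `|`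
    [set w | eta w E = count_value None].
  apply/seteqP; split => // w _; have [H|[n H]] := counting_valued (eta w) mE.
    by right.
  by left; exists n.
have : P [set: Omega] = 1 by exact: probability_setT.
have mB : measurable (\bigcup_n [set w | eta w E = n%:R%:E]).
  by apply: bigcup_measurable => k _; exact: (mS (Some k)).
have dB : (\bigcup_n [set w | eta w E = n%:R%:E]) `&`
    [set w | eta w E = count_value None] = set0.
  by rewrite -subset0 => w [[k _ /= ->]].
have -> : P [set: Omega] = P (\bigcup_n [set w | eta w E = n%:R%:E]) +
    P [set w | eta w E = count_value None].
  by rewrite U; exact: (measureU P mB (mS None) dB).
have tB : trivIset [set: nat] (fun n => [set w | eta w E = n%:R%:E]).
  apply/trivIsetP => i j _ _ ij; rewrite -subset0 => w [/= -> []] /eqP.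
  by rewrite eqr_nat (negbTE ij).
have -> : P (\bigcup_n [set w | eta w E = n%:R%:E]) =
    \sum_(k <oo) P [set w | eta w E = k%:R%:E].
  by apply: measure_semi_bigcup => // k; exact: (mS (Some k)).
have -> : \sum_(k <oo) P [set w | eta w E = k%:R%:E] = 1.
  under eq_eseriesr do rewrite D poisson_probE ?fine_ge0// EFinM.
  rewrite nneseriesZl; last by move=> k _; rewrite lee_fin divr_ge0// exprn_ge0// fine_ge0.
  by rewrite nneseries_expR ?fine_ge0// -EFinM expRN mulVf// gt_eqF// expR_gt0.
have bfin : P [set w | eta w E = count_value None] \is a fin_num.
  by apply: fin_num_measure; exact: mS.
by case: (P _) bfin => [r| |]//= _ [] H; congr EFin; lra.
Qed.

Lemma independent_cells (I : finType) (E : I -> set X) (S : I -> set \bar R) :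
  (forall i, measurable (E i)) -> trivIset [set: I] E ->
  (forall i, measurable (S i)) ->
  P [set w | forall i, S i (eta w (E i))] = \prod_(i : I) P [set w | S i (eta w (E i))].
Proof.
move=> mE tE mS.
have tE' : trivIset [set: 'I_#|I|] (fun j => E (enum_val j)).
  by move=> i j _ _ /(tE _ _ Logic.I Logic.I) /enum_val_inj.
have := poisson_process_independent eta_poisson (fun j => mE (enum_val j)) tE'.
move=> /(_ (fun j => S (enum_val j)) (fun j => mS (enum_val j))).
rewrite (big_enum_val (fun i => P [set w | S i (eta w (E i))])) => <-.
congr (P _); apply/seteqP; split => w /= H.
  by move=> j _; exact: H.
by move=> i; rewrite -(enum_rankK i); exact: H.
Qed.

Variables (A : set X) (mA : measurable A) (finA : mu A < +oo).

Definition restricted_intensity : {finite_measure set X -> \bar R} := mfrestr mA finA.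
Local Notation nu := restricted_intensity.

(** The probability factors over the cells.  The cells in [A] are those that
    [poisson_op] refills, each with its own Poisson law, and the other ones are
    untouched. *)
Lemma resample_cells (I : finType) (E : I -> set X) (inA : pred I)
    (v : I -> option nat) :
  (forall i, measurable (E i)) -> trivIset [set: I] E ->
  (forall i, inA i -> E i `<=` A) -> (forall i, ~~ inA i -> E i `<=` ~` A) ->
  A = \big[setU/set0]_(i <- enum inA) E i ->
  let U := [set xi : N | forall i, xi (E i) = count_value (v i)] in
  P (eta @^-1` U) =
  \int[P]_w poisson_op nu 1 (fun xi => (\1_U xi)%:E) (outside mA (eta w)).
Proof.
move=> mE tE EA EnA AE U.
pose S i := [set count_value (v i)].
pose c i (y : \bar R) := (\1_(S i) y)%:E : \bar R.
have mS i : measurable (S i) by exact: emeasurable_set1.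
have nc i : nn_measurable (c i) by exact: nn_measurable_indic.
pose k (xi : N) := \prod_(i | ~~ inA i) c i (xi (E i)).
have nk : nn_measurable k.
  rewrite /k; elim: (index_enum I) => [|i r ih].
    by under eq_fun do rewrite big_nil; exact: nn_measurable_cst.
  under eq_fun do rewrite big_cons; case: (~~ inA i) => //.
  by apply: nn_measurableM => //; exact: nn_measurable_count.
have UE xi : (\1_U xi)%:E = k xi * \prod_(i <- enum inA) c i (xi (E i)).
  transitivity (\prod_(i : I) c i (xi (E i))); last first.
    by rewrite big_enum/= muleC (bigID inA).
  rewrite /c prode_indic indicE; congr ((nat_of_bool _)%:R%:E).
  by apply/idP/asboolP => [/set_mem|H]; [move=> H i _; exact: H|apply/mem_set => i; exact: H].
have kins i : i \in enum inA -> insensitive (E i) k.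
  rewrite mem_enum => iA xi x Ex; apply: eq_bigr => j jA; rewrite add_dirac_out// => Ejx.
  exact: (EnA _ jA _ Ejx (EA _ iA _ Ex)).
have finE i : i \in enum inA -> mu (E i) < +oo.
  rewrite mem_enum => iA; apply: le_lt_trans finA; apply: le_measure; rewrite ?inE//.
  exact: EA.
have nuE B : measurable B -> nu B = mu (B `&` \big[setU/set0]_(i <- enum inA) E i).
  by move=> mB; rewrite -AE.
pose pr i := P [set w | eta w (E i) = count_value (v i)].
have cellE w : poisson_op nu 1 (fun xi => (\1_U xi)%:E) (outside mA (eta w)) =
    (\prod_(i <- enum inA) pr i) * k (eta w).
  transitivity (poisson_op nu 1
      (fun xi => k xi * \prod_(i <- enum inA) c i (xi (E i))) (outside mA (eta w))).
    by congr (poisson_op nu 1 _ _); apply/funext => xi; exact: UE.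
  rewrite (poisson_op_cells (mu := mu) (outside mA (eta w)) mE tE (enum_uniq _) finE nc
    nuE nk kins) muleC; congr (_ * _).
    apply: eq_big_seq => i iA; rewrite outside_in; last by apply: EA; rewrite mem_enum in iA.
    by rewrite shifted_poisson_prob//; exact: finE.
  by apply: eq_bigr => i iA; rewrite outside_out//; exact: EnA.
under eq_integral do rewrite cellE.
rewrite ge0_integralZl//; last 3 first.
- exact: (nn_measurableT_comp nk meta).1.
- by move=> w _; exact: nk.2.
- by apply: prode_ge0.
have -> : \int[P]_w k (eta w) = \prod_(i | ~~ inA i) pr i.
  pose S' i := if inA i then setT else S i.
  have mS' i : measurable (S' i) by rewrite /S'; case: ifP.
  have kE xi : k xi = (\1_[set xi : N | forall i, S' i (xi (E i))] xi)%:E.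
    rewrite /k prode_indic indicE; congr ((nat_of_bool _)%:R%:E).
    apply/asboolP/idP => [H|/set_mem H i iA].
      by apply/mem_set => i; rewrite /S'; case: ifPn => // iA; exact: H.
    by have := H i; rewrite /S' (negbTE iA).
  have mS'' : measurable [set w | forall i, S' i (eta w (E i))].
    rewrite (_ : mkset _ = \bigcap_(i in [set: I]) [set w | S' i (eta w (E i))]).
      by apply: fin_bigcap_measurable => [|i _]; [exact: finite_finset|exact: measurable_preimage_count].
    by apply/seteqP; split => w /= H i; [move=> _; exact: H|exact: H].
  under eq_integral do rewrite kE.
  transitivity (\int[P]_w (\1_[set w | forall i, S' i (eta w (E i))] w)%:E).
    by apply: eq_integral => w _; rewrite !indicE.
  transitivity (P [set w | forall i, S' i (eta w (E i))]).
    by rewrite integral_indic// setIT.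
  rewrite independent_cells//.
  rewrite (bigID inA)/= [X in X * _]big1 ?mul1e; last first.
    move=> i iA; rewrite /S' iA.
    by rewrite (_ : mkset _ = setT) ?probability_setT//; apply/seteqP; split.
  by apply: eq_bigr => i iA; rewrite /S' (negbTE iA).
transitivity (\prod_(i : I) pr i); last by rewrite big_enum/= (bigID inA).
rewrite -(independent_cells (S := S) mE tE mS).
by congr (P _); apply/seteqP; split => w.
Qed.

End poisson_law.

Section kernel_operator_limits.
Context d (S : measurableType d) (R : realType).
Variables (Phi : (S -> \bar R) -> S -> \bar R) (kP : kernel_operator Phi).

(** Monotone convergence, from countable additivity applied to the differences
    of consecutive terms. *)
Lemma ko_cvg (g : nat -> S -> R) (h : S -> \bar R) s :
  (forall n, measurable_fun [set: S] (g n)) -> (forall n t, (0 <= g n t)%R) ->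
  (forall n t, (g n t <= g n.+1 t)%R) ->
  (forall t, (g n t)%:E @[n --> \oo] --> h t) ->
  Phi (EFin \o g n) s @[n --> \oo] --> Phi h s.
Proof.
move=> mg g0 gS gh.
pose D n t := (if n is m.+1 then g m.+1 t - g m t else g 0%N t)%R.
have D0 n t : (0 <= D n t)%R by case: n => [|n] //=; rewrite subr_ge0.
have mD n : measurable_fun [set: S] (D n).
  by case: n => [|n] /=; [exact: mg|apply: measurable_funB; exact: mg].
have nD n : nn_measurable (fun t => (D n t)%:E).
  by split; [exact/measurable_EFinP|move=> t; rewrite lee_fin].
have sumD n t : \sum_(k < n.+1) (D k t)%:E = (g n t)%:E.
  elim: n => [|n ih]; first by rewrite big_ord1.
  by rewrite big_ord_recr/= ih -EFinD addrC subrK.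
have -> : h = fun t => \sum_(n <oo) (D n t)%:E.
  apply/funext => t; apply/esym/cvg_lim => //.
  rewrite -(cvg_shiftS (fun n => \sum_(0 <= k < n) (D k t)%:E)).
  by under eq_fun do rewrite /= big_mkord sumD; exact: gh.
rewrite (ko_sum kP nD).
have -> : (fun n => Phi (EFin \o g n) s) = fun n => \sum_(0 <= k < n.+1) Phi (fun t => (D k t)%:E) s.
  apply/funext => n; rewrite big_mkord -(ko_fsum kP _ (fun k : 'I_n.+1 => nD k)).
  by congr (Phi _ s); apply/funext => t; rewrite sumD.
rewrite (cvg_shiftS (fun n => \sum_(0 <= k < n) Phi (fun t => (D k t)%:E) s)).
by apply: is_cvg_nneseries => n _ _; exact: ko_ge0.
Qed.

End kernel_operator_limits.

Section cylinders.
Context d (X : measurableType d) (R : realType).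
Local Notation N := (counting_space X R).
Variable An : nat -> set X.
Hypotheses (mAn : forall n, measurable (An n))
  (ndAn : forall m n, (m <= n)%N -> An m `<=` An n)
  (AnT : forall x, exists n, An n x).

(** The sets [B i] are confined to some [An m], so that the event is decided by
    points that are all replaced when the process is resampled on [An m]. *)
Definition cylinder : set_system N := [set U |
  exists (m : nat) (I : finType) (B : I -> set X) (S : I -> set \bar R),
  [/\ forall i, measurable (B i), forall i, B i `<=` An m,
      forall i, measurable (S i) &
      U = [set xi : N | forall i, S i (xi (B i))]]].

Lemma setI_closed_cylinder : setI_closed cylinder.
Proof.
move=> _ _ [m1 [I1 [B1 [S1 [mB1 BA1 mS1 ->]]]]] [m2 [I2 [B2 [S2 [mB2 BA2 mS2 ->]]]]].
exists (maxn m1 m2), (I1 + I2)%type,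
  (fun i => match i with inl j => B1 j | inr j => B2 j end),
  (fun i => match i with inl j => S1 j | inr j => S2 j end).
split.
- by case.
- case=> j; [apply: subset_trans (BA1 j) _|apply: subset_trans (BA2 j) _];
    by apply: ndAn; rewrite ?leq_maxl ?leq_maxr.
- by case.
- apply/seteqP; split => xi /=.
    by move=> [H1 H2] [].
  by move=> H; split => i; [have := H (inl i)|have := H (inr i)].
Qed.

(** The count in any measurable set is the limit of the counts in its
    intersections with [An n]. *)
Lemma cylinder_generates : @measurable _ N = <<s cylinder >>.
Proof.
apply/seteqP; split; last first.
  apply: smallest_sub; first exact: sigma_algebra_measurable.
  move=> _ [m [I [B [S [mB BA mS ->]]]]].
  rewrite (_ : mkset _ = \bigcap_(i in [set: I]) (fun xi : N => xi (B i)) @^-1` (S i)).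
    apply: fin_bigcap_measurable => [|i _]; first exact: finite_finset.
    by have := measurable_count (mB i) measurableT (mS i); rewrite setTI.
  by apply/seteqP; split => xi /= H i; [move=> _; exact: H|exact: H].
apply: smallest_sub; first exact: smallest_sigma_algebra.
move=> _ [B mB [Y mY <-]].
pose N' := g_sigma_algebraType cylinder.
have mBn n : measurable_fun [set: N'] (fun xi : N' => (xi : N) (B `&` An n)).
  move=> _ Z mZ; apply: sub_sigma_algebra.
  exists n, unit, (fun=> B `&` An n), (fun=> Z); split => //.
  - by move=> _; exact: measurableI.
  - by apply/seteqP; split => xi /=; [move=> [_ H] _|move=> H; split => //; exact: (H tt)].
have cB (xi : N) : xi (B `&` An n) @[n --> \oo] --> xi B.
  rewrite [X in _ --> _ X](_ : B = \bigcup_n (B `&` An n)); last first.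
    by rewrite -setI_bigcupr setIidl// => x _; have [n ?] := AnT x; exists n.
  apply: nondecreasing_cvg_mu.
  - by move=> n; exact: measurableI.
  - by apply: bigcup_measurable => n _; exact: measurableI.
  - by move=> m n mn; apply/subsetPset; apply: setIS; exact: ndAn.
have mB' : measurable_fun [set: N'] (fun xi : N' => (xi : N) B).
  by apply: (emeasurable_fun_cvg (fun n (xi : N') => (xi : N) (B `&` An n))).
by have := mB' measurableT Y mY.
Qed.

End cylinders.

Lemma measure_bigsetU_seq d (X : measurableType d) (R : realType)
    (m : {measure set X -> \bar R}) (J : eqType) (E : J -> set X) (r : seq J) :
  (forall f, measurable (E f)) -> trivIset [set: J] E -> uniq r ->
  m (\big[setU/set0]_(f <- r) E f) = \sum_(f <- r) m (E f).
Proof.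
move=> mE tE; elim: r => [|f r ih] /=; first by rewrite !big_nil measure0.
move=> /andP[fr ur]; rewrite !big_cons -ih// measureU//.
  by apply: bigsetU_measurable => g _; exact: mE.
rewrite big_distrr/= big1_seq// => g /andP[_ gr].
have [//|/set0P Efg] := eqVneq (E f `&` E g) set0.
by have fg := tE f g Logic.I Logic.I Efg; rewrite fg gr in fr.
Qed.

Section resampling.
Context d (X : measurableType d) d' (Omega : measurableType d') (R : realType).
Local Notation N := (counting_space X R).
Variables (P : probability Omega R) (mu : {measure set X -> \bar R}).
Variables (eta : Omega -> N) (eta_poisson : is_poisson_process P mu eta).
Variable An : nat -> set X.
Hypotheses (mAn : forall n, measurable (An n))
  (ndAn : forall m n, (m <= n)%N -> An m `<=` An n)
  (AnT : forall x, exists n, An n x).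
Variables (A : set X) (mA : measurable A) (finA : mu A < +oo).
Local Notation nu := (restricted_intensity mA finA).

Let meta : measurable_fun [set: Omega] eta := poisson_process_measurable eta_poisson.
Let kP : kernel_operator (poisson_op nu 1) := kernel_operator_poisson nu ler01.

Definition resampled (h : N -> \bar R) : \bar R :=
  \int[P]_w poisson_op nu 1 h (outside mA (eta w)).

Lemma nn_measurable_resampled h : nn_measurable h ->
  nn_measurable (fun w => poisson_op nu 1 h (outside mA (eta w))).
Proof.
move=> nh; apply: (nn_measurableT_comp (ko_nn kP nh)).
exact: (measurableT_comp (measurable_outside mA) meta).
Qed.

Lemma resampledD h h' : nn_measurable h -> nn_measurable h' ->
  resampled (fun xi => h xi + h' xi) = resampled h + resampled h'.
Proof.
move=> nh nh'; rewrite /resampled; under eq_integral do rewrite (ko_add kP nh nh').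
have [m1 p1] := nn_measurable_resampled nh.
have [m2 p2] := nn_measurable_resampled nh'.
by rewrite ge0_integralD.
Qed.

Lemma resampled_sum (h : nat -> N -> \bar R) : (forall n, nn_measurable (h n)) ->
  resampled (fun xi => \sum_(n <oo) h n xi) = \sum_(n <oo) resampled (h n).
Proof.
move=> nh; rewrite /resampled; under eq_integral do rewrite (ko_sum kP nh).
rewrite integral_nneseries//.
- by move=> n; exact: (nn_measurable_resampled (nh n)).1.
- by move=> n w _; exact: (nn_measurable_resampled (nh n)).2.
Qed.

Lemma resampled1 : resampled (fun=> 1) = 1.
Proof.
rewrite /resampled; under eq_integral do rewrite poisson_op_cst//.
by rewrite integral_cst// mul1e; exact: probability_setT.
Qed.

Let mpre (U : set N) : measurable U -> measurable (eta @^-1` U).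
Proof. by move=> mU; rewrite -[_ @^-1` _]setTI; exact: meta. Qed.

Let good (U : set N) := P (eta @^-1` U) = resampled (fun xi => (\1_U xi)%:E).

Let goodC (U : set N) : measurable U -> good U -> good (~` U).
Proof.
move=> mU gU; rewrite /good preimage_setC probability_setC; last exact: mpre.
have nU := nn_measurable_indic R mU; have nC := nn_measurable_indic R (measurableC mU).
have : resampled (fun xi => (\1_U xi)%:E + (\1_(~` U) xi)%:E) = 1.
  rewrite -resampled1; congr resampled; apply/funext => xi.
  rewrite -EFinD !indicE in_setC; case: (xi \in U) => /=; congr EFin; ring.
move=> H; have aux (p r : \bar R) : p \is a fin_num -> p + r = 1 -> 1 - p = r.
  by case: p r => [p| |] [r| |]//= _ [] E; rewrite -EFinB; congr EFin; lra.
apply: aux; first by apply: fin_num_measure; exact: mpre.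
by rewrite [X in X + _]gU -resampledD.
Qed.

Let goodT : good [set: N].
Proof.
rewrite /good preimage_setT (_ : (fun xi => _) = fun=> 1).
  by rewrite resampled1; exact: probability_setT.
by apply/funext => xi; rewrite indicE in_setT.
Qed.

Let good_bigcup (F : (set N)^nat) : (forall n, measurable (F n)) ->
  trivIset [set: nat] F -> (forall n, good (F n)) -> good (\bigcup_n F n).
Proof.
move=> mF tF gF; rewrite /good preimage_bigcup.
have mpF n : measurable (eta @^-1` F n) by exact: mpre.
have tpF : trivIset [set: nat] (fun n => eta @^-1` F n).
  by move=> i j _ _ [w [Fi Fj]]; apply: (tF i j) => //; exists (eta w).
rewrite measure_semi_bigcup//; last by apply: bigcup_measurable.
rewrite (eq_eseriesr (fun n _ => gF n)) -resampled_sum; last first.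
  by move=> n; exact: nn_measurable_indic.
congr resampled; apply/funext => xi.
by apply/esym; exact: indic_bigcup.
Qed.

(** The sets that define a cylinder, together with [A], cut the space into
    disjoint cells, which the subsets of their index set enumerate.  The event
    is the disjoint union, over the admissible values of the counts in all the
    cells, of events covered by [resample_cells]; there are countably many. *)
Let good_cylinder U : cylinder An U -> good U.
Proof.
move=> [m [I [B [S [mB _ mS ->]]]]].
(* the index [None] stands for [A] *)
pose Be (o : option I) := if o is Some i then B i else A.
have mBe o : measurable (Be o) by case: o.
pose J := {ffun option I -> bool}.
pose E (f : J) := \bigcap_(o in [set: option I]) (if f o then Be o else ~` Be o).
have mE f : measurable (E f).
  apply: fin_bigcap_measurable => [|o _]; first exact: finite_finset.
  by case: ifP => // _; exact: measurableC.
pose code x : J := [ffun o => `[< Be o x >]].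
have Ecode f x : E f x <-> f = code x.
  split => [Ef|->].
    apply/ffunP => o; rewrite ffunE; have := Ef o Logic.I.
    by case: (f o) => H; apply/esym; [exact: asboolT|exact: asboolF].
  by move=> o _; rewrite ffunE; case: ifPn => [/asboolP|/asboolPn].
have tE : trivIset [set: J] E.
  by move=> f f' _ _ [x [/Ecode -> /Ecode ->]].
pose inA (f : J) := f None.
have EA f : inA f -> E f `<=` A.
  by rewrite /inA => fN x /(_ None Logic.I); rewrite fN.
have EnA f : ~~ inA f -> E f `<=` ~` A.
  by rewrite /inA => fN x /(_ None Logic.I); rewrite (negbTE fN).
have bigE (Q : pred J) : \big[setU/set0]_(f <- enum Q) E f = [set x | Q (code x)].
  apply/seteqP; split => x /=.
    rewrite big_enum/= => /=; rewrite -bigcup_pred => -[f /= Qf /Ecode fx].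
    by rewrite -fx.
  move=> Qx; rewrite big_enum/= -bigcup_pred; exists (code x) => //=.
  exact/Ecode.
have AE : A = \big[setU/set0]_(f <- enum inA) E f.
  rewrite bigE; apply/seteqP; split => x; rewrite /inA /= ffunE.
    by move=> Ax; exact: asboolT.
  by move/asboolP.
have BE (xi : N) i : xi (B i) = \sum_(f : J | f (Some i)) xi (E f).
  have -> : B i = \big[setU/set0]_(f <- enum [pred f : J | f (Some i)]) E f.
    rewrite bigE; apply/seteqP; split => x; rewrite /= ffunE.
      by move=> Bx; exact: asboolT.
    by move/asboolP.
  by rewrite measure_bigsetU_seq ?enum_uniq// big_enum.
pose rect (v : {ffun J -> option nat}) :=
  [set xi : N | forall f, xi (E f) = count_value R (v f)].
have grect v : good (rect v).
  exact: (resample_cells eta_poisson mA finA v mE tE EA EnA AE).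
pose compat (v : {ffun J -> option nat}) :=
  forall i, S i (\sum_(f : J | f (Some i)) count_value R (v f)).
pose F n := if pickle_inv n is Some v then (if `[< compat v >] then rect v else set0) else set0.
have vinj o o' : count_value R o = count_value R o' -> o = o'.
  case: o o' => [k|] [k'|]//= [] /eqP; rewrite eqr_nat => /eqP ->//.
have good0 : good set0 by rewrite -setCT; exact: goodC.
have mrect v : measurable (rect v).
  rewrite (_ : rect v = \bigcap_(f in [set: J])
      ((fun xi : N => xi (E f)) @^-1` [set count_value R (v f)])).
    apply: fin_bigcap_measurable => [|f _]; first exact: finite_finset.
    have := measurable_count (mE f) measurableT (emeasurable_set1 (count_value R (v f))).
    by rewrite setTI.
  by apply/seteqP; split => xi /= H f; [move=> _; exact: H|exact: H].
have -> : [set xi : N | forall i, S i (xi (B i))] = \bigcup_n F n.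
  apply/seteqP; split => xi /=.
    move=> H.
    have /choice[v vE] : forall f, exists o, xi (E f) = count_value R o.
      move=> f; have [->|[n ->]] := counting_valued xi (mE f); first by exists None.
      by exists (Some n).
    exists (pickle (finfun v)) => //; rewrite /F pickleK_inv.
    rewrite asboolT; first by move=> f; rewrite ffunE.
    move=> i; have := H i; rewrite BE.
    by under eq_bigr do rewrite vE -[v _](ffunE v).
  move=> [n _]; rewrite /F; case: pickle_inv => [v|//].
  case: asboolP => [cv rv i|//]; rewrite BE; under eq_bigr do rewrite rv; exact: cv.
apply: good_bigcup.
- move=> n; rewrite /F; case: pickle_inv => [v|]; last exact: measurable0.
  by case: ifP => _; [exact: mrect|exact: measurable0].
- move=> n n' _ _ [xi []]; rewrite /F.
  have := @pickle_invK {ffun J -> option nat} n.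
  have := @pickle_invK {ffun J -> option nat} n'.
  case: (pickle_inv n) => [v|]; last by [].
  case: (pickle_inv n') => [v'|]; last by [].
  move=> /= <- <-.
  case: ifP => // _; case: ifP => // _ rv rv'; congr (pickle _).
  by apply/ffunP => f; apply: vinj; rewrite -rv -rv'.
- move=> n; rewrite /F; case: pickle_inv => [v|]; last exact: good0.
  by case: ifP => _; [exact: grect|exact: good0].
Qed.

(** Both sides are probability measures in [U], and they agree on cylinders. *)
Lemma resample_set (U : set N) : measurable U ->
  P (eta @^-1` U) = resampled (fun xi => (\1_U xi)%:E).
Proof.
have cg := cylinder_generates R mAn ndAn AnT.
move=> mU; apply: (dynkin_induction cg (@setI_closed_cylinder _ _ R _ ndAn) goodT
  good_cylinder goodC good_bigcup).
by rewrite -cg.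
Qed.

Import HBNNSimple.

Let resample_nnsfun (g : {nnsfun N >-> R}) :
  \int[P]_w (g (eta w))%:E = resampled (EFin \o g).
Proof.
pose r : seq R := finmap.enum_fset (fset_set (range g)).
pose G (y : R) (xi : N) := (y * \1_(g @^-1` [set y]) xi)%:E.
have mI y : measurable (g @^-1` [set y]) by [].
have nG y : nn_measurable (G y).
  split; first by apply/measurable_EFinP; apply: measurable_funM => //; exact: measurable_indic.
  by move=> xi; rewrite /G EFinM; exact: nnfun_muleindic_ge0.
have gE xi : (g xi)%:E = \sum_(y <- r) G y xi.
  by rewrite fimfunE fsbig_finite// -sumEFin.
under eq_integral do rewrite gE.
rewrite ge0_integral_sum//; last 2 first.
- by move=> y; exact: (nn_measurableT_comp (nG y) meta).1.
- by move=> y w _; exact: (nG y).2.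
have -> : resampled (EFin \o g) = resampled (fun xi => \sum_(y <- r) G y xi).
  by congr resampled; apply/funext => xi; exact: gE.
rewrite /resampled; under [RHS]eq_integral do rewrite (ko_fsum kP r nG).
rewrite ge0_integral_sum//; last 2 first.
- by move=> y; exact: (nn_measurable_resampled (nG y)).1.
- by move=> y w _; exact: (nn_measurable_resampled (nG y)).2.
apply: eq_bigr => y _; rewrite -/(resampled (G y)).
have [y0|y0] := ltP y 0%R.
  have G0 xi : G y xi = 0 by rewrite /G preimage_nnfun0// indic0 mulr0.
  have -> : G y = fun=> 0 by apply/funext => xi; exact: G0.
  rewrite integral0 /resampled; under eq_integral do rewrite (ko0 kP).
  by rewrite integral0.
have nI := nn_measurable_indic R (mI y).
have y0' : 0 <= y%:E by rewrite lee_fin.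
have -> : resampled (G y) = y%:E * resampled (fun xi => (\1_(g @^-1` [set y]) xi)%:E).
  rewrite /resampled -ge0_integralZl//.
  - by apply: eq_integral => w _; rewrite -(ko_scale kP y0' nI).
  - exact: (nn_measurable_resampled nI).1.
  - by move=> w _; exact: (nn_measurable_resampled nI).2.
rewrite -(resample_set (mI y)).
transitivity (\int[P]_w (y%:E * (\1_(eta @^-1` (g @^-1` [set y])) w)%:E)).
  by apply: eq_integral => w _; rewrite /G EFinM !indicE.
rewrite ge0_integralZl//; last exact/measurable_EFinP/measurable_indic/mpre.
by rewrite integral_indic ?setIT//; exact: mpre.
Qed.

(** Passage from events to functions by simple functions.  This reduces the study
    of a Poisson process with a sigma-finite intensity to the operators
    [poisson_op] with a finite one. *)
Theorem resample (h : N -> \bar R) : nn_measurable h ->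
  \int[P]_w h (eta w) = resampled h.
Proof.
move=> nh; pose g := nnsfun_approx measurableT nh.1.
have gh xi : (g n xi)%:E @[n --> \oo] --> h xi.
  by apply: (cvg_nnsfun_approx measurableT nh.1) => // z _; exact: nh.2.
have gS n xi : (g n xi <= g n.+1 xi)%R by exact/lefP/nd_nnsfun_approx.
have gmn m n xi : (m <= n)%N -> (g m xi <= g n xi)%R.
  by move=> mn; exact/lefP/nd_nnsfun_approx.
have ngn n : nn_measurable (EFin \o g n).
  by split; [exact/measurable_EFinP|move=> xi; rewrite lee_fin].
have c1 : \int[P]_w (g n (eta w))%:E @[n --> \oo] --> \int[P]_w h (eta w).
  have -> : \int[P]_w h (eta w) = \int[P]_w limn (fun n => (g n (eta w))%:E).
    by apply: eq_integral => w _; apply/esym/cvg_lim => //; exact: gh.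
  apply: cvg_monotone_convergence => //.
  - by move=> n; exact: (nn_measurableT_comp (ngn n) meta).1.
  - by move=> n w _; rewrite lee_fin.
  - by move=> w _ m n mn; rewrite lee_fin; exact: gmn.
have c2 : resampled (EFin \o g n) @[n --> \oo] --> resampled h.
  rewrite /resampled.
  have -> : \int[P]_w poisson_op nu 1 h (outside mA (eta w)) =
      \int[P]_w limn (fun n => poisson_op nu 1 (EFin \o g n) (outside mA (eta w))).
    apply: eq_integral => w _; apply/esym/cvg_lim => //.
    by apply: (ko_cvg kP) => //; exact: gh.
  apply: cvg_monotone_convergence => //.
  - by move=> n; exact: (nn_measurable_resampled (ngn n)).1.
  - by move=> n w _; exact: (nn_measurable_resampled (ngn n)).2.
  - move=> w _ m n mn; apply: (ko_le kP) => // xi; rewrite lee_fin; exact: gmn.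
move/cvg_lim : c1 => <-//; apply/cvg_lim => //.
by under eq_fun do rewrite resample_nnsfun.
Qed.

End resampling.

(** * Triviality at infinity *)

Section tail.
Context d (X : measurableType d) d' (Omega : measurableType d') (R : realType).
Local Notation N := (counting_space X R).
Variables (P : probability Omega R) (mu : {measure set X -> \bar R}).
Variables (eta : Omega -> N) (eta_poisson : is_poisson_process P mu eta).
Variable An : nat -> set X.
Hypotheses (mAn : forall n, measurable (An n))
  (ndAn : forall m n, (m <= n)%N -> An m `<=` An n)
  (AnT : forall x, exists n, An n x) (finAn : forall n, mu (An n) < +oo).

Let meta : measurable_fun [set: Omega] eta := poisson_process_measurable eta_poisson.
Let nu n := restricted_intensity (mAn n) (finAn n).
Let kP n : kernel_operator (poisson_op (nu n) 1) := kernel_operator_poisson (nu n) ler01.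
Let out n w : N := outside (mAn n) (eta w).

Let resampleE n h : nn_measurable h ->
  \int[P]_w h (eta w) = \int[P]_w poisson_op (nu n) 1 h (out n w).
Proof. exact: (resample eta_poisson mAn ndAn AnT (mAn n) (finAn n)). Qed.

Let nnout n h : nn_measurable h -> nn_measurable (fun w => poisson_op (nu n) 1 h (out n w)).
Proof. exact: (nn_measurable_resampled eta_poisson (mAn n) (finAn n)). Qed.

(** A cylinder over [An n] only sees the points in [An n], which are all fresh,
    so that its probability after resampling does not depend on the start. *)
Let cylinder_cst n (I : finType) (B : I -> set X) (S : I -> set \bar R) (xi zeta : N) :
  (forall i, measurable (B i)) -> (forall i, B i `<=` An n) ->
  xi (An n) = 0 -> zeta (An n) = 0 ->
  let U := [set xi : N | forall i, S i (xi (B i))] in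
  poisson_op (nu n) 1 (fun xi => (\1_U xi)%:E) xi =
  poisson_op (nu n) 1 (fun xi => (\1_U xi)%:E) zeta.
Proof.
move=> mB BA xi0 zeta0 U.
have B0 (x : N) i : x (An n) = 0 -> x (B i) = 0.
  by move=> x0; apply: (subset_measure0 (mB i) (mAn n) (BA i)).
apply: (@poisson_op_rel _ _ _ (nu n) (fun x y => forall i, x (B i) = y (B i))).
- by move=> x y z xy i; rewrite !add_diracE xy.
- move=> x y xy; rewrite !indicE; congr ((nat_of_bool _)%:R%:E).
  apply/idP/idP => /set_mem H; apply/mem_set => i; [rewrite -xy|rewrite xy]; exact: H.
- by move=> i; rewrite !B0.
Qed.

Variables (G : N -> \bar R) (M : R).
Hypotheses (nG : nn_measurable G) (GM : forall xi, G xi <= M%:E).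

Let EG := \int[P]_w G (eta w).

Definition tail_product n (h : N -> \bar R) : \bar R :=
  \int[P]_w (poisson_op (nu n) 1 G (out n w) * poisson_op (nu n) 1 h (out n w)).
Local Notation b := tail_product.

Let M0 : (0 <= M)%R. Proof. by rewrite -lee_fin; exact: le_trans (nG.2 point) (GM point). Qed.

Let nprod n h : nn_measurable h -> nn_measurable
  (fun w => poisson_op (nu n) 1 G (out n w) * poisson_op (nu n) 1 h (out n w)).
Proof. by move=> nh; apply: nn_measurableM; exact: nnout. Qed.

Let b_ge0 n h : nn_measurable h -> 0 <= b n h.
Proof. by move=> nh; apply: integral_ge0 => w _; exact: (nprod n nh).2. Qed.

Let bD n h h' : nn_measurable h -> nn_measurable h' ->
  b n (fun xi => h xi + h' xi) = b n h + b n h'.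
Proof.
move=> nh nh'; have [m1 p1] := nprod n nh; have [m2 p2] := nprod n nh'.
rewrite /b -ge0_integralD//; apply: eq_integral => w _.
rewrite (ko_add (kP n) nh nh') ge0_muleDr//; exact: (ko_ge0 (kP n)).
Qed.

Let bZ n (k : R) h : (0 <= k)%R -> nn_measurable h ->
  b n (fun xi => k%:E * h xi) = k%:E * b n h.
Proof.
move=> k0 nh; have [m1 p1] := nprod n nh.
rewrite /b -ge0_integralZl ?lee_fin//; apply: eq_integral => w _.
by rewrite (ko_scale (kP n)) ?lee_fin// muleCA.
Qed.

Let b_le n h h' : nn_measurable h -> nn_measurable h' -> (forall xi, h xi <= h' xi) ->
  b n h <= b n h'.
Proof.
move=> nh nh' hh'; have [m1 p1] := nprod n nh; have [m2 p2] := nprod n nh'.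
apply: ge0_le_integral => // w _; rewrite lee_wpmul2l//; first exact: (ko_ge0 (kP n)).
exact: (ko_le (kP n)).
Qed.

Let b1 n : b n (fun=> 1) = EG.
Proof.
rewrite /EG (resampleE n nG); apply: eq_integral => w _.
by rewrite poisson_op_cst// mule1.
Qed.

Let b_sum n (h : nat -> N -> \bar R) : (forall k, nn_measurable (h k)) ->
  b n (fun xi => \sum_(k <oo) h k xi) = \sum_(k <oo) b n (h k).
Proof.
move=> nh; rewrite -integral_nneseries//; last 2 first.
- by move=> k; exact: (nprod n (nh k)).1.
- by move=> k w _; exact: (nprod n (nh k)).2.
apply: eq_integral => w _; rewrite (ko_sum (kP n) nh).
have Gfin : poisson_op (nu n) 1 G (out n w) \is a fin_num.
  have nM : nn_measurable (fun _ : N => M%:E) by apply: nn_measurable_cst; rewrite lee_fin.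
  rewrite ge0_fin_numE; last exact: (ko_ge0 (kP n)).
  apply: le_lt_trans (ltry M); apply: (le_trans (ko_le (kP n) nG nM GM (out n w))).
  have -> : poisson_op (nu n) 1 (fun=> M%:E) (out n w) = M%:E.
    by apply: poisson_op_cst => //; rewrite lee_fin.
  by [].
rewrite -(fineK Gfin) nneseriesZl//.
by move=> k _; exact: (ko_ge0 (kP n)).
Qed.

Let b_mass n h : nn_measurable h -> b n h <= M%:E * \int[P]_w h (eta w).
Proof.
move=> nh; have [m1 p1] := nprod n nh; have [m2 p2] := nnout n nh.
rewrite (resampleE n nh) -ge0_integralZl//.
apply: ge0_le_integral => //; first exact: emeasurable_funM.
move=> w _; apply: lee_wpmul2r; first exact: (ko_ge0 (kP n)).
have nM : nn_measurable (fun _ : N => M%:E) by apply: nn_measurable_cst; rewrite lee_fin.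
have := ko_le (kP n) nG nM GM (out n w).
by rewrite (@poisson_op_cst _ _ _ (nu n) 1%R M%:E)// lee_fin.
Qed.


Let pr (U : set N) := P (eta @^-1` U).
Let mpre (U : set N) : measurable U -> measurable (eta @^-1` U).
Proof. by move=> mU; rewrite -[_ @^-1` _]setTI; exact: meta. Qed.

Let ind (U : set N) : N -> \bar R := fun xi => (\1_U xi)%:E.
Let nind (U : set N) : measurable U -> nn_measurable (ind U).
Proof. exact: nn_measurable_indic. Qed.

Let Eind (U : set N) : measurable U -> \int[P]_w ind U (eta w) = pr U.
Proof.
move=> mU; transitivity (\int[P]_w (\1_(eta @^-1` U) w)%:E).
  by apply: eq_integral => w _; rewrite /ind !indicE.
by rewrite integral_indic ?setIT//; exact: mpre.
Qed.

Let intP (k : \bar R) : 0 <= k -> \int[P]_w k = k.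
Proof.
move=> k0; have P1 : \int[P]_w (1 : \bar R) = 1.
  by rewrite integral_cst// mul1e; exact: probability_setT.
transitivity (\int[P]_w (k * 1)); first by under [RHS]eq_integral do rewrite mule1.
by rewrite ge0_integralZl// P1 mule1.
Qed.

Let EG_fin : EG \is a fin_num.
Proof.
rewrite ge0_fin_numE; last by apply: integral_ge0 => w _; exact: nG.2.
apply: (@le_lt_trans _ _ (\int[P]_w M%:E)).
  apply: ge0_le_integral => //.
  - by move=> w _; exact: nG.2.
  - exact: (nn_measurableT_comp nG meta).1.
by rewrite intP ?lee_fin// ltry.
Qed.

Let good (U : set N) := b n (ind U) @[n --> \oo] --> EG * pr U.

Let goodT : good [set: N].
Proof.
rewrite /good.
have -> : ind [set: N] = fun=> 1 by apply/funext => xi; rewrite /ind indicE in_setT.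
have -> : pr [set: N] = 1 by rewrite /pr preimage_setT; exact: probability_setT.
by rewrite mule1; under eq_fun do rewrite b1; exact: cvg_cst.
Qed.

Let fin_b n (U : set N) : measurable U -> b n (ind U) \is a fin_num.
Proof.
move=> mU; rewrite ge0_fin_numE; last exact/b_ge0/nind.
apply: (le_lt_trans (b_mass n (nind mU))); rewrite Eind//.
by rewrite lte_mul_pinfty ?lee_fin// ltey_eq fin_num_measure//; exact: mpre.
Qed.

Let goodC (U : set N) : measurable U -> good U -> good (~` U).
Proof.
move=> mU gU.
have bC n : b n (ind (~` U)) = EG - b n (ind U).
  have : b n (ind U) + b n (ind (~` U)) = EG.
    rewrite -bD; [|exact: nind|exact/nind/measurableC].
    rewrite -(b1 n); congr (b n); apply/funext => xi.
    by rewrite /ind -EFinD !indicE in_setC; case: (xi \in U) => /=; congr EFin; ring.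
  by move=> <-; rewrite [X in _ = X - _]addeC addeK//; exact: fin_b.
rewrite /good.
have -> : EG * pr (~` U) = EG - EG * pr U.
  rewrite /pr preimage_setC.
  have -> : P (~` (eta @^-1` U)) = 1 - P (eta @^-1` U).
    by apply: probability_setC; exact: mpre.
  by rewrite muleBr ?mule1//; apply: fin_num_adde_defr; exact: fin_num_measure (mpre mU).
under eq_fun do rewrite bC.
apply: cvgeB => //; last exact: cvg_cst.
by apply: fin_num_adde_defr.
Qed.

(** The limit in [n] and the series over the [F k] are exchanged by dominated
    convergence for the counting measure: [b_mass] bounds the terms by
    [M * pr (F k)], which is summable. *)
Let good_bigcup (F : (set N)^nat) : (forall n, measurable (F n)) ->
  trivIset [set: nat] F -> (forall n, good (F n)) -> good (\bigcup_n F n).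
Proof.
move=> mF tF gF.
have mpF n : measurable (eta @^-1` F n) by exact: mpre.
have tpF : trivIset [set: nat] (fun n => eta @^-1` F n).
  by move=> i j _ _ [w [Fi Fj]]; apply: (tF i j) => //; exists (eta w).
have prE : pr (\bigcup_n F n) = \sum_(k <oo) pr (F k).
  rewrite /pr preimage_bigcup; apply: measure_semi_bigcup => //.
  exact: bigcup_measurable.
have pr0 k : 0 <= pr (F k) by exact: measure_ge0.
have EG0 : 0 <= EG by apply: integral_ge0 => w _; exact: nG.2.
have bE n : b n (ind (\bigcup_n F n)) = \int[counting]_k b n (ind (F k)).
  rewrite ge0_integral_count; last by move=> k; exact/b_ge0/nind.
  rewrite -b_sum; last by move=> k; exact: nind.
  by congr (b n); apply/funext => xi; exact: indic_bigcup.
have lE : EG * pr (\bigcup_n F n) = \int[counting]_k (EG * pr (F k)).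
  rewrite ge0_integral_count; last by move=> k; exact: mule_ge0.
  by rewrite prE -(fineK EG_fin) nneseriesZl.
rewrite /good lE; under eq_fun do rewrite bE.
apply: (@dominated_cvg _ _ _ counting setT measurableT _ _ (fun k => M%:E * pr (F k))) => //.
- by move=> k _; exact: gF.
- by move=> k _; rewrite fin_numM// fin_num_measure//; exact: mpF.
- apply/integrableP; split => //.
  under eq_integral do rewrite gee0_abs ?mule_ge0 ?lee_fin//.
  rewrite ge0_integral_count; last by move=> k; rewrite mule_ge0 ?lee_fin.
  rewrite nneseriesZl// -prE lte_mul_pinfty ?lee_fin//.
  by rewrite ltey_eq fin_num_measure//; apply: mpre; exact: bigcup_measurable.
- move=> n k _; rewrite gee0_abs; last exact/b_ge0/nind.
  by rewrite -Eind//; exact/b_mass/nind.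
Qed.

Let good_cylinder (U : set N) : cylinder An U -> good U.
Proof.
move=> cU; have mU : measurable U.
  by rewrite (cylinder_generates R mAn ndAn AnT); exact: sub_gen_smallest.
have [m [I [B [S [mB BA mS UE]]]]] := cU.
apply: cvg_near_cst; near=> n.
have BAn i : B i `<=` An n.
  by apply: subset_trans (BA i) _; apply: ndAn; near: n; exact: nbhs_infty_ge.
have z0 : (outside (mAn n) (point : N)) (An n) = 0 by exact: outside_in.
pose k := poisson_op (nu n) 1 (ind U) (outside (mAn n) (point : N)).
have kE w : poisson_op (nu n) 1 (ind U) (out n w) = k.
  rewrite /k /ind UE; apply: (cylinder_cst S mB BAn _ z0); exact: outside_in.
have k0 : 0 <= k by exact: (ko_ge0 (kP n) (nind mU)).
have prU : pr U = k.
  rewrite -(Eind mU) (resampleE n (nind mU)).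
  under eq_integral do rewrite kE.
  by rewrite intP.
rewrite prU /b; under eq_integral do rewrite kE muleC.
rewrite ge0_integralZl//.
- by rewrite -resampleE// muleC.
- exact: (nnout n nG).1.
- by move=> w _; exact: (nnout n nG).2.
Unshelve. all: by end_near. Qed.

(** The class of events that become independent of the outside of [An n] contains
    the cylinders, for which the average is constant once [n] is large, and it is
    a Dynkin class. *)
Let tail_set (U : set N) : measurable U -> good U.
Proof.
move=> mU; have cg := cylinder_generates R mAn ndAn AnT.
apply: (dynkin_induction cg (@setI_closed_cylinder _ _ R _ ndAn) goodT
  good_cylinder goodC good_bigcup).
by rewrite -cg.
Qed.

Let E h := \int[P]_w h (eta w).

Let E_fin h (C : R) : nn_measurable h -> (forall xi, h xi <= C%:E) -> E h \is a fin_num.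
Proof.
move=> nh hC; rewrite ge0_fin_numE; last by apply: integral_ge0 => w _; exact: nh.2.
have C0 : 0 <= C%:E by exact: le_trans (nh.2 point) (hC point).
apply: (@le_lt_trans _ _ (\int[P]_w C%:E)); last by rewrite intP// ltry.
apply: ge0_le_integral => //.
- by move=> w _; exact: nh.2.
- exact: (nn_measurableT_comp nh meta).1.
Qed.

Let limit_ok (h : N -> \bar R) := b n h @[n --> \oo] --> EG * E h.

(** The layer-cake sum approximates bounded nonnegative functions uniformly by
    finitely many indicators of measurable sets. *)
Let layer (F : N -> R) (e : R) J : N -> \bar R := fun xi =>
  \sum_(j < J) (e%:E * ind [set xi | (j%:R * e <= F xi)%R] xi).

Let mlevel (F : N -> R) (c : R) : measurable_fun [set: N] F ->
  measurable [set xi | (c <= F xi)%R].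
Proof.
move=> mF; have := mF measurableT _ (measurable_itv `[c, +oo[).
by rewrite setTI; congr measurable; apply/seteqP; split => xi /=; rewrite in_itv/= andbT.
Qed.

Let nlayer1 (F : N -> R) (e c : R) : (0 <= e)%R -> measurable_fun [set: N] F ->
  nn_measurable (fun xi => e%:E * ind [set xi | (c <= F xi)%R] xi).
Proof.
move=> e0 mF; apply: nn_measurableM; first by apply: nn_measurable_cst; rewrite lee_fin.
by apply: nind; exact: mlevel.
Qed.

Let nlayer (F : N -> R) (e : R) J : (0 <= e)%R -> measurable_fun [set: N] F ->
  nn_measurable (layer F e J).
Proof. by move=> e0 mF; apply: nn_measurable_fsum => j; exact: nlayer1. Qed.

Let layerS F e J xi : layer F e J.+1 xi =
  layer F e J xi + e%:E * ind [set xi | (J%:R * e <= F xi)%R] xi.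
Proof. by rewrite /layer big_ord_recr. Qed.

Let layer_bounds (F : N -> R) (e : R) J xi : (0 < e)%R -> (0 <= F xi)%R ->
  [/\ (Num.min (F xi) (J%:R * e))%:E <= layer F e J xi,
    layer F e J xi <= (J%:R * e)%:E & layer F e J xi <= (F xi + e)%:E].
Proof.
move=> e0 F0; elim: J => [|J [ih1 ih2 ih3]].
  rewrite /layer big_ord0 mul0r !lee_fin; split => //; last by rewrite addr_ge0// ltW.
  by rewrite ge_min lexx orbT.
rewrite layerS.
have -> : e%:E * ind [set xi | (J%:R * e <= F xi)%R] xi =
    (if (J%:R * e <= F xi)%R then e else 0)%:E.
  rewrite /ind indicE -EFinM; congr EFin.
  have -> : (xi \in [set xi | (J%:R * e <= F xi)%R]) = (J%:R * e <= F xi)%R.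
    by apply/idP/idP => [/set_mem|H]//; exact/mem_set.
  by case: ifPn => _; rewrite ?mulr1 ?mulr0.
have Je : (J.+1%:R * e = J%:R * e + e)%R by rewrite -natr1 mulrDl mul1r.
move: (layer F e J xi) ih1 ih2 ih3 => [l| |]//; rewrite !lee_fin => ih1 ih2 ih3.
have [JF|JF] := leP (J%:R * e)%R (F xi).
  rewrite Je; split; [|lra|lra].
  rewrite ge_min; apply/orP; right; rewrite lerD2r.
  by apply: le_trans ih1; rewrite le_min JF lexx.
rewrite addr0 Je; split => //; last by lra.
apply: le_trans ih1; by rewrite le_min !ge_min lexx (ltW JF).
Qed.

Let limit_layer (F : N -> R) (e : R) J : (0 < e)%R -> measurable_fun [set: N] F ->
  (forall xi, (0 <= F xi)%R) -> limit_ok (layer F e J).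
Proof.
move=> e0 mF F0; have e0' := ltW e0.
elim: J => [|J ih].
  have l0 : layer F e 0 = fun=> 0 by apply/funext => xi; rewrite /layer big_ord0.
  rewrite /limit_ok l0 /E integral0 mule0.
  have -> : (fun n => b n (fun=> 0)) = fun=> 0.
    apply/funext => n; rewrite /b; under eq_integral do rewrite (ko0 (kP n)) mule0.
    by rewrite integral0.
  exact: cvg_cst.
pose U := [set xi | (J%:R * e <= F xi)%R].
have mU : measurable U by exact: mlevel.
have nU := nind mU; have nl := nlayer J e0' mF.
have nl1 := nlayer1 (J%:R * e)%R e0' mF.
have lE : layer F e J.+1 = fun xi => layer F e J xi + e%:E * ind U xi.
  by apply/funext => xi; exact: layerS.
have lfin : E (layer F e J) \is a fin_num.
  by apply: (E_fin nl) => xi; have [_ + _] := layer_bounds J e0 (F0 xi); exact.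
have ufin : pr U \is a fin_num by exact/fin_num_measure/mpre.
rewrite /limit_ok lE.
have -> : E (fun xi => layer F e J xi + e%:E * ind U xi) = E (layer F e J) + e%:E * pr U.
  rewrite /E ge0_integralD//.
  - congr (_ + _); rewrite ge0_integralZl ?lee_fin ?Eind//.
      exact: (nn_measurableT_comp nU meta).1.
    by move=> w _; exact: nU.2.
  - by move=> w _; exact: nl.2.
  - exact: (nn_measurableT_comp nl meta).1.
  - by move=> w _; exact: nl1.2.
  - exact: (nn_measurableT_comp nl1 meta).1.
rewrite muleDr//; last exact: fin_num_adde_defl (fin_numM _ _).
have -> : (fun n => b n (fun xi => layer F e J xi + e%:E * ind U xi)) =
    (fun n => b n (layer F e J) + e%:E * b n (ind U)).
  by apply/funext => n; rewrite bD// bZ.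
apply: cvgeD.
- by apply: fin_num_adde_defl; rewrite fin_numM// fin_numM.
- exact: ih.
- by rewrite muleCA; apply: cvgeZl => //; exact: tail_set.
Qed.

(** The convergence for indicators extends to layer sums by linearity.  The mesh
    [c] of the layers makes the error of the approximation, at most [c * M], less
    than [e]. *)
Theorem tail_product_le (F : N -> R) (M' e : R) : measurable_fun [set: N] F ->
  (forall xi, (0 <= F xi)%R) -> (forall xi, (F xi <= M')%R) -> (0 < e)%R ->
  \forall n \near \oo, b n (EFin \o F) <= EG * \int[P]_w (F (eta w))%:E + e%:E.
Proof.
move=> mF F0 FM e0.
have M1 : (0 < M + 1)%R by rewrite ltr_wpDl.
pose c : R := (e / (2 * (M + 1)))%R.
have c0 : (0 < c)%R by rewrite divr_gt0// mulr_gt0.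
pose J := (Num.truncn (M' / c)).+1.
have JM : (M' <= J%:R * c)%R.
  by rewrite -ler_pdivrMr// ltW// truncnS_gt.
have nF : nn_measurable (EFin \o F).
  by split; [exact/measurable_EFinP|move=> xi; rewrite lee_fin].
have nl := nlayer J (ltW c0) mF.
have Fl xi : (F xi)%:E <= layer F c J xi.
  have [+ _ _] := layer_bounds J c0 (F0 xi); apply: le_trans.
  by rewrite lee_fin le_min lexx (le_trans (FM xi)).
have lF xi : layer F c J xi <= (F xi + c)%:E.
  by have [_ _] := layer_bounds J c0 (F0 xi).
have EFfin : E (EFin \o F) \is a fin_num by apply: (E_fin nF) => xi; rewrite lee_fin.
have nFc : nn_measurable (fun xi => (F xi)%:E + c%:E).
  by apply: nn_measurableD => //; apply: nn_measurable_cst; rewrite lee_fin ltW.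
have El : E (layer F c J) <= E (EFin \o F) + c%:E.
  have -> : E (EFin \o F) + c%:E = E (fun xi => (F xi)%:E + c%:E).
    rewrite /E ge0_integralD//.
    - by rewrite intP// lee_fin ltW.
    - by move=> w _; exact: nF.2.
    - exact: (nn_measurableT_comp nF meta).1.
    - by move=> w _; rewrite lee_fin ltW.
  apply: ge0_le_integral => //.
  - by move=> w _; exact: nl.2.
  - exact: (nn_measurableT_comp nl meta).1.
  - exact: (nn_measurableT_comp nFc meta).1.
have EG0 : 0 <= EG by apply: integral_ge0 => w _; exact: nG.2.
have EGM : EG <= M%:E.
  rewrite -(@intP M%:E) ?lee_fin//; apply: ge0_le_integral => //.
  - by move=> w _; exact: nG.2.
  - exact: (nn_measurableT_comp nG meta).1.
have lt1 : EG * E (layer F c J) < EG * E (EFin \o F) + e%:E.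
  apply: (@le_lt_trans _ _ (EG * (E (EFin \o F) + c%:E))); first exact: lee_wpmul2l.
  rewrite muleDr//; last exact: fin_num_adde_defl.
  rewrite lteD2lE//; last exact: fin_numM.
  apply: (@le_lt_trans _ _ (M%:E * c%:E)); first by rewrite lee_wpmul2r// lee_fin ltW.
  rewrite -EFinM lte_fin /c mulrA ltr_pdivrMr ?mulr_gt0//.
  by nra.
have := limit_layer c0 mF F0 (J := J); rewrite /limit_ok => cvl.
have : \forall n \near \oo, b n (layer F c J) < EG * E (EFin \o F) + e%:E.
  exact: (cvl _ (open_ereal_lt' lt1)).
apply: filterS => n; move=> /ltW; apply: le_trans; exact: b_le.
Qed.

End tail.

(** * Bounded functionals *)

Section powers.
Variable R : realType.
Implicit Types a b q : R.

Lemma young_powR a b q : (0 <= a -> 0 <= b -> 1 <= q ->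
  a * b `^ (q - 1) <= a `^ q / q + (q - 1) / q * b `^ q)%R.
Proof.
move=> a0 b0; rewrite le_eqVlt => /predU1P[<-|q1].
  by rewrite subrr powRr0 mulr1 powRr1// divr1 !mul0r addr0.
have q0 : (0 < q)%R by exact: lt_trans q1.
have r0 : (0 < q - 1)%R by rewrite subr_gt0.
have qr : (q^-1 + (q / (q - 1))^-1 = 1)%R.
  by field; rewrite !gt_eqF.
have := conjugate_powR a0 (powR_ge0 b (q - 1)) q0 (divr_gt0 q0 r0) qr.
rewrite -powRrM [((q - 1) * _)%R](_ : _ = q); last first.
  by field; rewrite gt_eqF.
by rewrite invf_div [(_ * b `^ q)%R]mulrC.
Qed.

(** The mean value inequality for [t `^ q], deduced from Young's inequality
    since [t `^ (q - 1) * s] is at most a convex combination of [s `^ q] and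
    [t `^ q]. *)
Lemma powR_sub_le a b q : (0 <= a -> 0 <= b -> 1 <= q ->
  b `^ q - a `^ q <= q * (b `^ (q - 1) * (b - a)))%R.
Proof.
move=> a0 b0 q1; have q0 : (0 < q)%R by exact: lt_le_trans q1.
have := young_powR a0 b0 q1.
rewrite -(ler_pM2l q0).
have -> : (q * (a `^ q / q + (q - 1) / q * b `^ q) = a `^ q + (q - 1) * b `^ q)%R.
  by field; rewrite gt_eqF.
by have := mulr_powRB1 b0 q0; nra.
Qed.

Lemma max0_powR_diff a b a' b' q : (0 <= a -> 0 <= b -> 1 <= q ->
  b - a <= Num.max 0 (b' - a') ->
  Num.max 0 (b `^ q - a `^ q) <= q * (b `^ (q - 1) * Num.max 0 (b' - a')))%R.
Proof.
move=> a0 b0 q1 ba; have q0 : (0 <= q)%R by exact: le_trans q1.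
have t0 := powR_ge0 b (q - 1).
have m0 : (0 <= Num.max 0 (b' - a'))%R by rewrite le_max lexx.
rewrite ge_max; apply/andP; split; first by rewrite !mulr_ge0.
apply: (le_trans (powR_sub_le a0 b0 q1)).
by rewrite ler_wpM2l// ler_wpM2l.
Qed.

Lemma max0_sub_le (x y z : R) :
  (Num.max 0 (x - z) - Num.max 0 (y - z) <= Num.max 0 (x - y))%R.
Proof.
rewrite lerBlDr ge_max; apply/andP; split; first by rewrite addr_ge0// le_max lexx.
rewrite -lerBlDr; apply: (@le_trans _ _ (x - z - (y - z))%R).
  by rewrite lerB// le_max lexx orbT.
by rewrite le_max; apply/orP; right; lra.
Qed.

(** Young's inequality with weights chosen so that both terms on the right are
    of the same order when [a] is of order [v] and [b] of order [y]. *)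
Lemma young_scaled (a b v y p : R) : (0 <= a -> 0 <= b -> 0 < v -> 0 < y -> 2 <= p ->
  a * b `^ (p - 2) <= v * y `^ (p - 2) * (2 / p) / v `^ (p / 2) * a `^ (p / 2) +
    v * y `^ (p - 2) * ((p - 2) / p) / y `^ p * b `^ p)%R.
Proof.
move=> a0 b0 v0 y0 p2; have p0 : (0 < p)%R by exact: lt_le_trans p2.
pose s : R := (a / v)%R; pose t : R := (b / y)%R.
have s0 : (0 <= s)%R by rewrite divr_ge0// ltW.
have t0 : (0 <= t)%R by rewrite divr_ge0// ltW.
have -> : a = (v * s)%R by rewrite /s; field; rewrite gt_eqF.
have -> : b = (y * t)%R by rewrite /t; field; rewrite gt_eqF.
rewrite !(powRM _ (ltW v0) s0) !(powRM _ (ltW y0) t0).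
have q1 : (1 <= p / 2)%R by rewrite ler_pdivlMr// mul1r.
have := young_powR s0 (powR_ge0 t 2) q1.
rewrite -!powRrM [(2 * (_ - 1))%R](_ : _ = (p - 2)%R); last by field.
rewrite [(2 * (p / 2))%R](_ : _ = p); last by field.
have yp : (0 < y `^ (p - 2))%R by exact: powR_gt0.
have vy : (0 < v * y `^ (p - 2))%R by exact: mulr_gt0.
rewrite -(ler_pM2l vy); set l := (X in (X <= _)%R -> _); set r := (X in (_ <= X)%R -> _).
move=> lr; apply: (@le_trans _ _ l); first by rewrite /l le_eqVlt; apply/orP; left; apply/eqP; ring.
apply: (le_trans lr); rewrite /r le_eqVlt; apply/orP; left; apply/eqP.
by field; rewrite !gt_eqF// powR_gt0.
Qed.

End powers.

Section bounded.
Context d (X : measurableType d) d' (Omega : measurableType d') (R : realType).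
Local Notation N := (counting_space X R).
Variables (P : probability Omega R) (mu : {measure set X -> \bar R}).
Variables (eta : Omega -> N) (eta_poisson : is_poisson_process P mu eta).
Variable An : nat -> set X.
Hypotheses (mAn : forall n, measurable (An n))
  (ndAn : forall m n, (m <= n)%N -> An m `<=` An n)
  (AnT : forall x, exists n, An n x) (finAn : forall n, mu (An n) < +oo).

Let meta : measurable_fun [set: Omega] eta := poisson_process_measurable eta_poisson.
Let nu n := restricted_intensity (mAn n) (finAn n).
Let kP n : kernel_operator (poisson_op (nu n) 1) := kernel_operator_poisson (nu n) ler01.
Let out n w : N := outside (mAn n) (eta w).

Variables (f : N -> R) (e : N -> X -> R) (M : R).
Hypotheses (mf : measurable_fun [set: N] f)
  (me : measurable_fun [set: N * X] (fun q : N * X => e q.1 q.2))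
  (ef : forall xi x, e (add_dirac xi x) x = f xi)
  (fM : forall xi, (`|f xi| <= M)%R).

(** The variation [V] with only the points in [An n] added or removed.  The
    function [e] stands for the value of [f] after the removal of a point; it is
    only required to be right for points that have just been added, which is all
    that the Mecke formula sees. *)
Definition local_variation n (xi : N) : \bar R :=
  \int[nu n]_x ((decrease f xi x) ^+ 2)%:E +
  point_sum (An n) (fun zeta x => ((pos_part (f zeta - e zeta x)) ^+ 2)%:E) xi.

Let w (xi : N) (x : X) : R := ((pos_part (f xi - e xi x)) ^+ 2)%R.

Let pos_part_ge0 (x : R) : (0 <= pos_part x)%R.
Proof. by rewrite /pos_part le_max lexx. Qed.

Let measurable_pos_part d0 (S : measurableType d0) (g : S -> R) :
  measurable_fun [set: S] g -> measurable_fun [set: S] (fun s => pos_part (g s)).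
Proof. by move=> mg; apply: measurable_maxr => //; exact: measurable_cst. Qed.

Let nnE d0 (Z : measurableType d0) (H : Z -> R) : measurable_fun [set: Z] H ->
  (forall z, (0 <= H z)%R) -> nn_measurable (fun z => (H z)%:E).
Proof.
by move=> mH H0; split; [exact/measurable_EFinP|move=> z; rewrite lee_fin].
Qed.

Let mw : measurable_fun [set: N * X] (fun q : N * X => w q.1 q.2).
Proof.
apply: measurable_funX; apply: measurable_pos_part.
by apply: measurable_funB => //; exact: (measurableT_comp mf measurable_fst).
Qed.

Let w0 xi x : (0 <= w xi x)%R. Proof. exact: sqr_ge0. Qed.

Lemma nn_measurable_local_variation n : nn_measurable (local_variation n).
Proof.
apply: nn_measurableD; last first.
  by apply: (nn_measurable_point_sum (mAn n)); apply: (nnE mw) => q; exact: w0.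
apply: (@nn_measurable_integral _ _ _ _ _ _ (fun xi x => ((decrease f xi x) ^+ 2)%:E)).
apply: nnE => [|q]; last exact: sqr_ge0.
apply: measurable_funX; apply: measurable_maxr; first exact: measurable_cst.
apply: measurable_funB; first exact: (measurableT_comp mf measurable_fst).
exact: (measurableT_comp mf (@measurable_add_dirac _ X R)).
Qed.

Variables (p v y m : R).
Hypotheses (p2 : (2 <= p)%R) (v0 : (0 < v)%R) (y0 : (0 < y)%R).
Hypotheses (Em : \int[P]_w (f (eta w) + M)%:E = (m + M)%:E)
  (Ey : \int[P]_w (pos_part (f (eta w) - m) `^ p)%:E = (y `^ p)%:E)
  (Ev : forall n, \int[P]_w (local_variation n (eta w) `^ (p / 2)) <= (v `^ (p / 2))%:E).

Let b xi : R := pos_part (f xi - m).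
Let F xi : R := (f xi + M)%R.
Let G xi : R := (b xi `^ (p - 1))%R.
Let phi xi : R := (b xi `^ (p - 2))%R.
(* a common bound for [F] and [G] *)
Let K : R := (2 * M + (2 * M) `^ (p - 1))%R.

Let p0 : (0 < p)%R. Proof. exact: lt_le_trans p2. Qed.
Let q0 : (0 < p - 1)%R. Proof. by have := p2; lra. Qed.
Let q1 : (1 <= p - 1)%R. Proof. by have := p2; lra. Qed.

Let mb : measurable_fun [set: N] b.
Proof. by apply: measurable_pos_part; apply: measurable_funB => //; exact: measurable_cst. Qed.
Let mF : measurable_fun [set: N] F.
Proof. by apply: measurable_funD => //; exact: measurable_cst. Qed.
Let mpow r : measurable_fun [set: N] (fun xi => b xi `^ r)%R.
Proof. exact: (measurableT_comp (measurable_powR _) mb). Qed.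

Let b0 xi : (0 <= b xi)%R. Proof. exact: pos_part_ge0. Qed.
Let F0 xi : (0 <= F xi)%R.
Proof. by have := fM xi; rewrite ler_norml /F => /andP[]; lra. Qed.
Let F2M xi : (F xi <= 2 * M)%R.
Proof. by have := fM xi; rewrite ler_norml /F => /andP[]; lra. Qed.
Let mM : (0 <= m + M)%R.
Proof. by rewrite -lee_fin -Em; apply: integral_ge0 => z _; rewrite lee_fin; exact: F0. Qed.
Let b2M xi : (b xi <= 2 * M)%R.
Proof.
by have := fM xi; rewrite ler_norml /b /pos_part ge_max => /andP[]; have := mM; lra.
Qed.
Let M20 : (0 <= 2 * M)%R. Proof. exact: le_trans (b0 point) (b2M point). Qed.
Let FK xi : (F xi <= K)%R.
Proof. by rewrite /K -[leLHS]addr0 lerD ?powR_ge0. Qed.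
Let GK xi : (G xi <= K)%R.
Proof.
rewrite /K -[leLHS]add0r lerD// /G ge0_ler_powR ?nnegrE//; exact: ltW.
Qed.
Let G0 xi : (0 <= G xi)%R. Proof. exact: powR_ge0. Qed.

Let powers_phi xi : (b xi `^ (p - 1 - 1) = phi xi)%R.
Proof. by rewrite /phi; congr powR; ring. Qed.

Let incG xi x :
  (increase G xi x <= (p - 1) * (phi (add_dirac xi x) * increase F xi x))%R.
Proof.
rewrite -powers_phi; apply: max0_powR_diff => //.
rewrite /b /pos_part /F; apply: (le_trans (max0_sub_le _ _ _)).
by rewrite opprD addrACA subrr addr0.
Qed.

Let decG xi x :
  (decrease G xi x <= (p - 1) * (phi xi * decrease F xi x))%R.
Proof.
rewrite -powers_phi; apply: max0_powR_diff => //.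
rewrite /b /pos_part /F; apply: (le_trans (max0_sub_le _ _ _)).
by rewrite opprD addrACA subrr addr0.
Qed.

Let wE xi x : w (add_dirac xi x) x = (increase F xi x ^+ 2)%R.
Proof.
rewrite /w ef /increase /F /pos_part; congr (Num.max _ _ ^+ 2)%R; ring.
Qed.

(* the coefficients in [young_scaled] *)
Let k1 : R := (v * y `^ (p - 2) * (2 / p) / v `^ (p / 2))%R.
Let k2 : R := (v * y `^ (p - 2) * ((p - 2) / p) / y `^ p)%R.
Let W1 n xi : \bar R := k1%:E * local_variation n xi `^ (p / 2).
Let W2 xi : \bar R := k2%:E * (b xi `^ p)%:E.

Let k10 : (0 < k1)%R.
Proof. by rewrite /k1 !(mulr_gt0, divr_gt0, invr_gt0, powR_gt0). Qed.
Let k20 : (0 <= k2)%R.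
Proof. apply: divr_ge0; last exact: powR_ge0.
apply: mulr_ge0; last by rewrite divr_ge0 ?subr_ge0// ltW.
by apply: mulr_ge0; [exact: ltW|exact: powR_ge0]. Qed.

Let nV n : nn_measurable (fun xi => local_variation n xi `^ (p / 2)).
Proof.
split; last by move=> xi; exact: poweR_ge0.
exact: (measurableT_comp (measurable_poweR _) (nn_measurable_local_variation n).1).
Qed.

Let nb : nn_measurable (fun xi => (b xi `^ p)%:E).
Proof. by apply: nnE => // xi; exact: powR_ge0. Qed.

Let nW1 n : nn_measurable (W1 n).
Proof.
by apply: nn_measurableM => //; apply: nn_measurable_cst; rewrite lee_fin ltW.
Qed.
Let nW2 : nn_measurable W2.
Proof. by apply: nn_measurableM => //; apply: nn_measurable_cst; rewrite lee_fin. Qed.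

Let VW n xi zeta :
  (\int[nu n]_x ((decrease F xi x) ^+ 2)%:E +
   point_sum (An n) (fun xi x => (w xi x)%:E) xi) * (phi zeta)%:E <= W1 n xi + W2 zeta.
Proof.
have dF x : decrease F xi x = decrease f xi x.
  by rewrite /decrease /F; congr (Num.max _ _); ring.
under eq_integral do rewrite dF.
rewrite -/(local_variation n xi) /W1 /W2.
have := (nn_measurable_local_variation n).2 xi.
case: (local_variation n xi) => [a| |]//; last first.
  move=> _; rewrite poweRyr ?gt_eqF ?divr_gt0// gt0_muley ?lte_fin//.
  by rewrite addye ?leey// -EFinM.
rewrite lee_fin => a0; rewrite poweR_EFin -!EFinM -EFinD lee_fin.
exact: young_scaled.
Qed.

Let W_integral n : \int[P]_w (W1 n (eta w) + W2 (eta w)) <= (v * y `^ (p - 2))%:E.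
Proof.
rewrite ge0_integralD//; last 4 first.
- by move=> z _; exact: (nW1 n).2.
- exact: (nn_measurableT_comp (nW1 n) meta).1.
- by move=> z _; exact: nW2.2.
- exact: (nn_measurableT_comp nW2 meta).1.
have -> : \int[P]_w W1 n (eta w) = k1%:E * \int[P]_w local_variation n (eta w) `^ (p / 2).
  rewrite ge0_integralZl//.
  - exact: (nn_measurableT_comp (nV n) meta).1.
  - by move=> z _; exact: (nV n).2.
  - by rewrite lee_fin ltW.
have -> : \int[P]_w W2 (eta w) = k2%:E * (y `^ p)%:E.
  rewrite ge0_integralZl//.
  - by rewrite Ey.
  - exact: (nn_measurableT_comp nb meta).1.
  - by move=> z _; exact: nb.2.
apply: (@le_trans _ _ (k1%:E * (v `^ (p / 2))%:E + k2%:E * (y `^ p)%:E)).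
  by rewrite leeD2r// lee_wpmul2l// lee_fin ltW.
rewrite -!EFinM -EFinD lee_fin /k1 /k2 le_eqVlt; apply/orP; left; apply/eqP.
by field; rewrite !gt_eqF// powR_gt0.
Qed.

Let nF : nn_measurable (EFin \o F). Proof. exact: nnE. Qed.
Let nG : nn_measurable (EFin \o G). Proof. by apply: nnE => //; exact: mpow. Qed.
Let nGF : nn_measurable (fun xi => (G xi)%:E * (F xi)%:E).
Proof. exact: nn_measurableM nG nF. Qed.

Let EG := \int[P]_w (G (eta w))%:E.

Let covariance n : \int[P]_w ((G (eta w))%:E * (F (eta w))%:E) <=
  tail_product P eta mAn finAn (EFin \o G) n (EFin \o F) +
  (2 * (p - 1))%:E * (v * y `^ (p - 2))%:E.
Proof.
have nW : nn_measurable (fun t => W1 n t + W2 t) by exact: nn_measurableD.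
have re h (nh : nn_measurable h) :=
  resample eta_poisson mAn ndAn AnT (mAn n) (finAn n) nh.
have no h (nh : nn_measurable h) :=
  nn_measurable_resampled eta_poisson (mAn n) (finAn n) nh.
rewrite (re _ nGF) /resampled.
have nuA : nu n (~` An n) = 0.
  by rewrite -[LHS]/(mu (~` An n `&` An n)) setICl measure0.
have cov z := poisson_covariance_le (mAn n) nuA mF (mpow _) (mpow _) F0 FK G0 GK
  (fun xi => powR_ge0 _ _) (ltW q0) incG decG mw w0 wE (nW1 n) nW2 (VW n)
  (outside_in (mAn n) (eta z) (@subset_refl _ (An n))) q0.
have [m1 g1] := no _ nGF; have [m2 g2] := no _ nG; have [m3 g3] := no _ nF.
have [m4 g4] := no _ nW.
pose PW z := poisson_op (nu n) 1 (fun t => W1 n t + W2 t) (out n z).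
have c0 : 0 <= (2 * (p - 1))%:E by rewrite lee_fin mulr_ge0// ltW.
apply: (@le_trans _ _ (\int[P]_z (
    poisson_op (nu n) 1 (EFin \o G) (out n z) * poisson_op (nu n) 1 (EFin \o F) (out n z)
    + (2 * (p - 1))%:E * PW z))).
  apply: ge0_le_integral => //.
  by apply: emeasurable_funD; [exact: emeasurable_funM|exact: measurable_funeM].
rewrite ge0_integralD//; last 4 first.
- by move=> z _; apply: mule_ge0; [exact: g2|exact: g3].
- exact: emeasurable_funM.
- by move=> z _; apply: mule_ge0 => //; exact: g4.
- exact: measurable_funeM.
apply: leeD2l; rewrite ge0_integralZl//; last by move=> z _; exact: g4.
apply: lee_wpmul2l => //.
have -> : \int[P]_z PW z = \int[P]_w (W1 n (eta w) + W2 (eta w)) by rewrite (re _ nW).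
exact: W_integral.
Qed.

Let product_integral : \int[P]_w ((G (eta w))%:E * (F (eta w))%:E) =
  (y `^ p)%:E + (m + M)%:E * EG.
Proof.
rewrite -Ey /EG -ge0_integralZl//; last 2 first.
- exact: (nn_measurableT_comp nG meta).1.
- by move=> z _; exact: nG.2.
rewrite -ge0_integralD//; last 4 first.
- by move=> z _; exact: nb.2.
- exact: (nn_measurableT_comp nb meta).1.
- by move=> z _; rewrite mule_ge0// ?lee_fin//; exact: nG.2.
- exact: measurable_funeM (nn_measurableT_comp nG meta).1.
apply: eq_integral => z _; rewrite -!EFinM -EFinD; congr EFin.
rewrite -/(b (eta z)) -mulr_powRB1// -/(G _) /F.
have [fm|fm] := leP (f (eta z) - m)%R 0%R.
  have bz : b (eta z) = 0%R by rewrite /b /pos_part; exact/max_idPl.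
  by rewrite /G bz !powR0 ?gt_eqF// !(mul0r, mulr0, addr0).
have -> : b (eta z) = (f (eta z) - m)%R by rewrite /b /pos_part; apply/max_idPr; exact: ltW.
ring.
Qed.

(** With [F = f + M] and [G = (f - m)_+ `^ (p - 1)], the mean of [G * F] exceeds
    the product of the means by [y `^ p], while [covariance] and the triviality
    of the tail bound this excess by [2 * (p - 1) * v * y `^ (p - 2)]. *)
Theorem bounded_moment : (y ^+ 2 <= 2 * (p - 1) * v)%R.
Proof.
have yp : (0 < y `^ (p - 2))%R by exact: powR_gt0.
have EGfin : EG \is a fin_num.
  rewrite ge0_fin_numE; last by apply: integral_ge0 => z _; exact: nG.2.
  apply: (@le_lt_trans _ _ (\int[P]_z (cst K%:E) z)).
    apply: ge0_le_integral => //.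
    - by move=> z _; exact: nG.2.
    - exact: (nn_measurableT_comp nG meta).1.
    - by move=> z _; rewrite lee_fin.
  by rewrite integral_cst//= lte_mul_pinfty// ?lee_fin ?(le_trans (G0 point))//
    ltey_eq fin_num_measure.
suff main : (y `^ p)%:E <= (2 * (p - 1) * (v * y `^ (p - 2)))%:E.
  move: main; rewrite lee_fin [(_ * (v * _))%R]mulrA.
  have -> : (y `^ p = y ^+ 2 * y `^ (p - 2))%R.
    rewrite -powR_mulrn ?ltW// -powRD ?(gt_eqF y0) ?implybT//.
    by congr powR; rewrite addrC subrK.
  by rewrite ler_pM2r.
apply/lee_addgt0Pr => eps eps0.
have [n _ nP] := tail_product_le eta_poisson mAn ndAn AnT finAn nG
  (M := K) (fun xi => ltac:(by rewrite lee_fin)) mF F0 FK eps0.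
have := le_trans (covariance n) (leeD2r _ (nP n (leqnn n))).
rewrite product_integral Em -/EG muleC -EFinM.
rewrite -addeA [X in _ <= X]addeC.
by rewrite leeD2rE ?fin_numM// addeC.
Qed.

End bounded.

(** * Truncation *)

(** The integral of a nonnegative function is a supremum over simple functions
    below it, hence it is monotone even at nonmeasurable functions; this matters
    because the variations of a functional need not be measurable. *)
Lemma ge0_le_integral_simple d (T : measurableType d) (R : realType)
    (m : {measure set T -> \bar R}) (h1 h2 : T -> \bar R) :
  (forall x, 0 <= h1 x) -> (forall x, h1 x <= h2 x) ->
  \int[m]_x h1 x <= \int[m]_x h2 x.
Proof.
move=> h10 h12.
have h20 x : 0 <= h2 x by exact: le_trans (h12 x).
rewrite !ge0_integralTE//; apply: ereal_sup_le => _ [h hh1 <-].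
by exists h => // x; exact: le_trans (h12 x).
Qed.

Section clamp.
Variable R : realType.
Implicit Types s t : R.

Definition clamp (k : nat) t : R := Num.max (- k%:R)%R (Num.min k%:R t).

Lemma clamp_bounded k t : (`|clamp k t| <= k%:R)%R.
Proof.
have k0 : (0 <= k%:R :> R)%R by exact: ler0n.
by rewrite ler_norml /clamp le_max lexx /= ge_max ge_min lexx /=; lra.
Qed.

Lemma clamp_id k t : (`|t| <= k%:R)%R -> clamp k t = t.
Proof.
rewrite ler_norml => /andP[kt tk]; rewrite /clamp.
by have /min_idPr -> := tk; exact/max_idPr.
Qed.

Lemma le_norm_clamp k t : (`|clamp k t| <= `|t|)%R.
Proof.
have k0 : (0 <= k%:R :> R)%R by exact: ler0n.
have [|tk] := leP `|t|%R k%:R; first by move=> /clamp_id ->.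
exact: le_trans (clamp_bounded k t) (ltW tk).
Qed.

Lemma clamp_contraction k s t :
  (Num.max 0 (clamp k s - clamp k t) <= Num.max 0 (s - t))%R.
Proof.
have k0 : (0 <= k%:R :> R)%R by exact: ler0n.
rewrite ge_max le_max lexx /= /clamp.
have [ks|ks] := leP k%:R s; have [kt|kt] := leP k%:R t;
  do ?case: (leP (- k%:R)%R _) => ?; rewrite le_max; apply/orP;
  solve [left; lra|right; lra].
Qed.

Lemma measurable_clamp k : measurable_fun [set: R] (clamp k).
Proof.
apply: measurable_maxr; first exact: measurable_cst.
by apply: measurable_minr; first exact: measurable_cst.
Qed.

Lemma near_clamp t : \forall k \near \oo, clamp k t = t.
Proof.
exists (Num.truncn `|t|%R).+1 => // k /= tk; apply: clamp_id.
apply: (@le_trans _ _ (Num.truncn `|t|%R).+1%:R); last by rewrite ler_nat.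
by apply: ltW; exact: truncnS_gt.
Qed.

End clamp.

Lemma sqr_powR_half (R : realType) (y p : R) : (0 <= y)%R ->
  ((y ^+ 2) `^ (p / 2) = y `^ p)%R.
Proof. by move=> y0; rewrite -powR_mulrn// -powRrM; congr powR; field. Qed.

Section truncation.
Context d (X : measurableType d) d' (Omega : measurableType d') (R : realType).
Local Notation N := (counting_space X R).
Variables (P : probability Omega R) (mu : {measure set X -> \bar R}).
Variables (eta : Omega -> N) (eta_poisson : is_poisson_process P mu eta).
Variable An : nat -> set X.
Hypotheses (mAn : forall n, measurable (An n))
  (ndAn : forall m n, (m <= n)%N -> An m `<=` An n)
  (AnT : forall x, exists n, An n x) (finAn : forall n, mu (An n) < +oo).

Let meta : measurable_fun [set: Omega] eta := poisson_process_measurable eta_poisson.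

Variables (f : N -> R) (e : N -> X -> R).
Hypotheses (mf : measurable_fun [set: N] f)
  (me : measurable_fun [set: N * X] (fun q : N * X => e q.1 q.2))
  (ef : forall xi x, e (add_dirac xi x) x = f xi).

(** For [e = eval_sub_dirac f] this is [Vplus]; for [- f] and
    [- eval_sub_dirac f] it is [Vminus]. *)
Definition full_variation (xi : N) : \bar R :=
  \int[mu]_x ((decrease f xi x) ^+ 2)%:E +
  \int[xi]_x ((pos_part (f xi - e xi x)) ^+ 2)%:E.

Let fk k xi : R := clamp k (f xi).
Let ek k xi x : R := clamp k (e xi x).

Let mfk k : measurable_fun [set: N] (fk k).
Proof. exact: measurableT_comp (@measurable_clamp R k) mf. Qed.

Let mek k : measurable_fun [set: N * X] (fun q : N * X => ek k q.1 q.2).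
Proof. exact: measurableT_comp (@measurable_clamp R k) me. Qed.

Lemma local_variation_clamp_le k n xi :
  local_variation mAn finAn (fk k) (ek k) n xi <= full_variation xi.
Proof.
have sq_le (s t : R) :
    ((Num.max 0 (clamp k s - clamp k t)) ^+ 2 <= (Num.max 0 (s - t)) ^+ 2)%R.
  by apply: lerXn2r (clamp_contraction k s t); rewrite nnegrE le_max lexx.
apply: leeD.
  have nd : nn_measurable (fun x => ((decrease (fk k) xi x) ^+ 2)%:E).
    split; last by move=> x; rewrite lee_fin sqr_ge0.
    apply/measurable_EFinP; apply: measurable_funX.
    apply: measurable_maxr; first exact: measurable_cst.
    apply: measurable_funB; first exact: measurable_cst.
    exact: (measurableT_comp (mfk k) (measurable_add_diracr xi)).
  rewrite -[leLHS]/(\int[mrestr mu (mAn n)]_x ((decrease (fk k) xi x) ^+ 2)%:E).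
  rewrite ge0_integral_mrestr//.
  apply: (@le_trans _ _ (\int[mu]_x ((decrease (fk k) xi x) ^+ 2)%:E)).
    by apply: ge0_subset_integral => //; [exact: nd.1|move=> x _; exact: nd.2].
  by apply: ge0_le_integral_simple => x; [exact: nd.2|rewrite lee_fin; exact: sq_le].
rewrite /point_sum; case: ifP => _; last first.
  by apply: integral_ge0 => x _; rewrite lee_fin sqr_ge0.
have nr : nn_measurable (fun x => ((pos_part (fk k xi - ek k xi x)) ^+ 2)%:E).
  split; last by move=> x; rewrite lee_fin sqr_ge0.
  apply/measurable_EFinP; apply: measurable_funX.
  apply: measurable_maxr; first exact: measurable_cst.
  apply: measurable_funB; first exact: measurable_cst.
  exact: (measurableT_comp (mek k) (measurable_pair1 xi)).
apply: (@le_trans _ _ (\int[xi]_x ((pos_part (fk k xi - ek k xi x)) ^+ 2)%:E)).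
  by apply: ge0_subset_integral => //; [exact: nr.1|move=> x _; exact: nr.2].
by apply: ge0_le_integral_simple => x; [exact: nr.2|rewrite lee_fin; exact: sq_le].
Qed.

Hypothesis f_integrable : P.-integrable [set: Omega] (fun w => (f (eta w))%:E).

Variables (p v : R).
Hypotheses (p2 : (2 <= p)%R) (v0 : (0 < v)%R)
  (Vv : \int[P]_w (full_variation (eta w) `^ (p / 2)) <= (v `^ (p / 2))%:E).

Let p0 : (0 < p)%R. Proof. exact: lt_le_trans p2. Qed.
Let ph : (0 <= p / 2)%R. Proof. by rewrite divr_ge0// ltW. Qed.

Let m : R := fine (\int[P]_w (f (eta w))%:E).
Let mk k : R := fine (\int[P]_w (fk k (eta w))%:E).
Let C : R := ((2 * (p - 1) * v) `^ (p / 2))%R.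

Let mfe : measurable_fun [set: Omega] (fun w => f (eta w)).
Proof. exact: measurableT_comp mf meta. Qed.

Let mfke k : measurable_fun [set: Omega] (fun w => fk k (eta w)).
Proof. exact: measurableT_comp (mfk k) meta. Qed.

Let fk_integrable k : P.-integrable [set: Omega] (fun w => (fk k (eta w))%:E).
Proof.
apply: (le_integrable measurableT _ _ f_integrable); first exact/measurable_EFinP.
by move=> w _; rewrite lee_fin; exact: le_norm_clamp.
Qed.

Let mk_cvg : mk k @[k --> \oo] --> m.
Proof.
have pt w : (fk k (eta w))%:E @[k --> \oo] --> (f (eta w))%:E.
  by apply: cvg_near_cst; apply: filterS (near_clamp (f (eta w))) => k /= fkE; rewrite /fk fkE.
have [_ _ cv] := @dominated_convergence _ _ _ P _ measurableT
  (fun k w => (fk k (eta w))%:E) (fun w => (f (eta w))%:E)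
  (fun w => `|(f (eta w))%:E|)
  (fun k => (measurable_EFinP _ _).2 (mfke k)) ((measurable_EFinP _ _).2 mfe)
  (aeW _ (fun w _ => pt w))
  (integrable_abse f_integrable)
  (aeW _ (fun w k _ => le_norm_clamp k (f (eta w)))).
by apply: fine_cvg; rewrite /m fineK//; exact: integrable_fin_num.
Qed.

Let b k w : \bar R := (pos_part (fk k (eta w) - mk k) `^ p)%:E.

Let nbk k : nn_measurable (b k).
Proof.
split; last by move=> w; rewrite lee_fin powR_ge0.
apply/measurable_EFinP; apply: (measurableT_comp (measurable_powR _)).
apply: measurable_maxr; first exact: measurable_cst.
by apply: measurable_funB => //; exact: measurable_cst.
Qed.

Let Pcst (c : R) : \int[P]_w (cst c%:E) w = c%:E.
Proof.
rewrite integral_cst// -[RHS]mule1; congr (_ * _); exact: probability_setT.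
Qed.

Let truncated_moment k : \int[P]_w b k w <= C%:E.
Proof.
have k0 : (0 <= k%:R :> R)%R by exact: ler0n.
have mean : \int[P]_w (fk k (eta w) + k%:R)%:E = (mk k + k%:R)%:E.
  have -> : \int[P]_w (fk k (eta w) + k%:R)%:E =
      \int[P]_w ((fk k (eta w))%:E + (cst k%:R%:E) w) by [].
  rewrite integralD//; last exact: finite_measure_integrable_cst.
  rewrite EFinD /mk fineK; last exact: integrable_fin_num.
  by rewrite Pcst.
have mk0 : (`|mk k| <= k%:R)%R.
  have [lo hi] : (- k%:R <= mk k)%R /\ (mk k <= k%:R)%R.
    split.
      rewrite -subr_ge0 opprK -lee_fin -mean; apply: integral_ge0 => w _.
      by have := clamp_bounded k (f (eta w)); rewrite ler_norml lee_fin /fk => /andP[]; lra.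
    rewrite -(lerD2r k%:R) -lee_fin -mean.
    have -> : (k%:R + k%:R)%:E = \int[P]_w (cst (k%:R + k%:R)%:E) w.
      by rewrite Pcst.
    apply: ge0_le_integral_simple => w; rewrite lee_fin;
      by have := clamp_bounded k (f (eta w)); rewrite ler_norml /fk => /andP[]; lra.
  by rewrite ler_norml lo hi.
have fin : \int[P]_w b k w \is a fin_num.
  rewrite ge0_fin_numE; last by apply: integral_ge0 => w _; exact: (nbk k).2.
  apply: (@le_lt_trans _ _ (\int[P]_w (cst ((k%:R + k%:R) `^ p)%:E) w)).
    apply: ge0_le_integral_simple => w; first exact: (nbk k).2.
    rewrite lee_fin ge0_ler_powR ?nnegrE ?(ltW p0) ?addr_ge0//.
      by rewrite /pos_part le_max lexx.
    have := clamp_bounded k (f (eta w)); rewrite /pos_part ge_max /fk.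
    by move: mk0; rewrite !ler_norml => /andP[? ?] /andP[? ?]; lra.
  by rewrite Pcst ltry.
have : 0 <= \int[P]_w b k w by apply: integral_ge0 => w _; exact: (nbk k).2.
rewrite -(fineK fin) !lee_fin le_eqVlt => /predU1P[<-|j0]; first exact: powR_ge0.
set j := fine _ in j0 *; pose y : R := (j `^ p^-1)%R.
have yp : (y `^ p = j)%R by rewrite /y -powRrM mulVf ?gt_eqF// powRr1// ltW.
have y0 : (0 < y)%R by exact: powR_gt0.
have : (y ^+ 2 <= 2 * (p - 1) * v)%R.
  apply: (@bounded_moment _ _ _ _ _ P mu eta eta_poisson An mAn ndAn AnT finAn
    (fk k) (ek k) k%:R (mfk k) (mek k) _ _ p v y (mk k)) => //.
  - by move=> xi x; rewrite /ek ef.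
  - by move=> xi; exact: clamp_bounded.
  - by rewrite yp /j fineK.
  - move=> n; apply: le_trans Vv; apply: ge0_le_integral_simple => w.
      exact: poweR_ge0.
    apply: gt0_ler_poweR => //; last exact: local_variation_clamp_le.
    + by rewrite in_itv /= leey andbT; exact: (nn_measurable_local_variation _ _ _ _ _).2.
    + rewrite in_itv /= leey andbT; apply: le_trans (local_variation_clamp_le k n (eta w)).
      exact: (nn_measurable_local_variation _ _ _ _ _).2.
move=> le; rewrite -yp /C.
rewrite -(sqr_powR_half p (ltW y0)).
rewrite ge0_ler_powR ?nnegrE ?sqr_ge0//.
exact: le_trans (sqr_ge0 _) le.
Qed.

(* the power function is continuous at positive points, and at zero the terms
   are nonnegative, which is enough for a lower bound *)
Let b_liminf w :
  (pos_part (f (eta w) - m) `^ p)%:E <= limn_einf (fun k => b k w).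
Proof.
have [z0|z0] := leP (pos_part (f (eta w) - m)) 0%R.
  have -> : pos_part (f (eta w) - m) = 0%R.
    by apply/eqP; rewrite eq_le z0 /pos_part le_max lexx.
  rewrite powR0 ?gt_eqF// limn_einf_lim; apply: lime_ge; first exact: is_cvg_einfs.
  by apply: nearW => n; apply: le_ereal_inf_tmp => _ [k _ <-]; exact: (nbk k).2.
have cv : pos_part (fk k (eta w) - mk k) @[k --> \oo] --> pos_part (f (eta w) - m).
  have cpos : {for (f (eta w) - m)%R, continuous (@pos_part R)}.
    by apply: (@continuous_max _ _ (fun=> 0%R) id); [exact: cvg_cst|exact: cvg_id].
  apply: (continuous_cvg _ cpos); apply: cvgB; last exact: mk_cvg.
  by apply: cvg_near_cst; exact: near_clamp.
have cont : {for pos_part (f (eta w) - m), continuous (fun t : R => t `^ p)%R}.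
  apply: differentiable_continuous; apply/derivable1_diffP.
  by apply: derivable_powR; rewrite in_itv /= z0.
have cvp : b k w @[k --> \oo] --> (pos_part (f (eta w) - m) `^ p)%:E.
  apply/fine_cvgP; split; first exact: nearW.
  exact: (continuous_cvg _ cont cv).
by have [-> _] := cvg_limn_einf_sup cvp.
Qed.

(** Bounds pass from the truncated functionals to the functional itself by
    Fatou's lemma. *)
Theorem moment_bound : \int[P]_w (pos_part (f (eta w) - m) `^ p)%:E <= C%:E.
Proof.
apply: (@le_trans _ _ (\int[P]_w limn_einf (fun k => b k w))).
  by apply: ge0_le_integral_simple => w; [rewrite lee_fin powR_ge0|exact: b_liminf].
apply: (le_trans (fatou P measurableT (fun k => (nbk k).1) (fun k w _ => (nbk k).2 w))).
rewrite limn_einf_lim; apply: lime_le; first exact: is_cvg_einfs.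
apply: nearW => n; apply: le_trans (truncated_moment n).
by apply: ereal_inf_lbound; exists n => //=.
Qed.

End truncation.

(** * Norms *)

Section constant.
Variable R : realType.

Let sqrt_expR1 : (Num.sqrt (expR 1) = expR 2^-1 :> R)%R.
Proof.
by rewrite -powR12_sqrt ?expR_ge0// -expRM mul1r.
Qed.

(** [sqrt e] lies between [1] and [2], and [s / (2 * (s - 1)) >= 1] means
    [s <= 2]. *)
Lemma kappa_ge1 : (1 <= kappa R)%R.
Proof.
rewrite /kappa sqrt_expR1.
have lo : (1 < expR 2^-1 :> R)%R by rewrite expR_gt1 invr_gt0.
have hi : (expR 2^-1 <= 2 :> R)%R.
  have := expR_ge1Dx (- 2^-1 : R)%R; rewrite expRN.
  have e0 := expR_gt0 (2^-1 : R)%R.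
  rewrite -(ler_pM2r e0) mulVf ?gt_eqF//; lra.
by rewrite ler_pdivlMr ?mulr_gt0// ?subr_gt0//; lra.
Qed.

End constant.

Section Lnorm_facts.
Context d (T : measurableType d) (R : realType) (P : probability T R).

Lemma Lnorm_finE (q : R) (g : T -> \bar R) :
  'N[P]_q%:E[g] = (\int[P]_w `|g w| `^ q) `^ q^-1.
Proof. by rewrite unlock. Qed.

Lemma Lnorm_ae_eq (q : R) (g h : T -> R) :
  measurable_fun [set: T] g -> measurable_fun [set: T] h ->
  {ae P, forall w, g w = h w} ->
  'N[P]_q%:E[EFin \o g] = 'N[P]_q%:E[EFin \o h].
Proof.
move=> mg mh gh; rewrite !Lnorm_finE; apply: (congr1 (fun I => I `^ q^-1)).
have mq (k : T -> R) : measurable_fun [set: T] k ->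
    measurable_fun [set: T] (fun x => `|(EFin \o k) x| `^ q).
  move=> mk; apply: (measurableT_comp (measurable_poweR _)).
  by apply: measurableT_comp => //; exact/measurable_EFinP.
apply: ae_eq_integral => //; [exact: mq|exact: mq|].
by apply: filterS gh => w /= ghw _; rewrite ghw.
Qed.

Lemma ge0_le_Lnorm (q : R) (g h : T -> \bar R) : (0 < q)%R ->
  (forall w, 0 <= g w) -> (forall w, g w <= h w) ->
  'N[P]_q%:E[g] <= 'N[P]_q%:E[h].
Proof.
move=> q0 g0 gh; rewrite !Lnorm_finE.
have h0 w : 0 <= h w by exact: le_trans (gh w).
apply: gt0_ler_poweR; first by rewrite invr_ge0 ltW.
- by rewrite in_itv /= leey andbT; apply: integral_ge0 => w _; exact: poweR_ge0.
- by rewrite in_itv /= leey andbT; apply: integral_ge0 => w _; exact: poweR_ge0.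
apply: ge0_le_integral_simple => w; first exact: poweR_ge0.
rewrite !gee0_abs//; apply: gt0_ler_poweR; first exact: ltW.
- by rewrite in_itv /= leey andbT.
- by rewrite in_itv /= leey andbT.
- exact: gh.
Qed.

Lemma sqrte_Lnorm (c p : R) (V : T -> \bar R) : (0 <= c)%R -> (0 < p)%R ->
  (forall w, 0 <= V w) ->
  sqrte (c%:E * 'N[P]_(p / 2)%:E[V]) =
  (Num.sqrt c)%:E * 'N[P]_p%:E[@sqrte R \o V].
Proof.
move=> c0 p0 V0; rewrite sqrteM ?lee_fin//; congr (_ * _).
rewrite -poweR12_sqrt ?Lnorm_ge0// !Lnorm_finE -poweRrM.
congr (_ `^ _); last by field; rewrite gt_eqF.
apply: eq_integral => w _ /=.
rewrite gee0_abs// gee0_abs ?sqrte_ge0// -poweR12_sqrt// -poweRrM.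
by congr (_ `^ _); rewrite mulrC.
Qed.

End Lnorm_facts.

Section norm_bound.
Context d (X : measurableType d) d' (Omega : measurableType d') (R : realType).
Local Notation N := (counting_space X R).
Variables (P : probability Omega R) (mu : {measure set X -> \bar R}).
Hypothesis mu_sfin : sigma_finite [set: X] mu.
Variables (eta : Omega -> N) (eta_poisson : is_poisson_process P mu eta).
Variables (f : N -> R) (e : N -> X -> R) (p : R).
Hypotheses (mf : measurable_fun [set: N] f)
  (me : measurable_fun [set: N * X] (fun q : N * X => e q.1 q.2))
  (ef : forall xi x, e (add_dirac xi x) x = f xi)
  (f_integrable : P.-integrable [set: Omega] (fun w => (f (eta w))%:E))
  (p2 : (2 <= p)%R).

Let p0 : (0 < p)%R. Proof. exact: lt_le_trans p2. Qed.
Let ph : (0 < p / 2)%R. Proof. by rewrite divr_gt0. Qed.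
Let m : R := fine (\int[P]_w (f (eta w))%:E).
Let V w := full_variation mu f e (eta w).

Lemma full_variation_ge0 xi : 0 <= full_variation mu f e xi.
Proof. by apply: adde_ge0; apply: integral_ge0 => x _; rewrite lee_fin sqr_ge0. Qed.

Let moment (v : R) : (0 < v)%R ->
  \int[P]_w (V w `^ (p / 2)) <= (v `^ (p / 2))%:E ->
  \int[P]_w (pos_part (f (eta w) - m) `^ p)%:E <= ((2 * (p - 1) * v) `^ (p / 2))%:E.
Proof.
move=> v0 Vv; have [An [AT ndA mA]] := (sigma_finiteP _ _).1 mu_sfin.
apply: (@moment_bound _ _ _ _ _ P mu eta eta_poisson An (fun n => (mA n).1) _ _
  (fun n => (mA n).2) f e mf me ef f_integrable p v p2 v0 Vv).
- by move=> i j ij; exact/subsetPset/ndA.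
- by move=> x; have : [set: X] x by []; rewrite AT => -[n _ Anx]; exists n.
Qed.

(** [moment_bound] requires a positive bound [v] on the norm of the variation; it
    is used with [v] slightly above the norm, which may vanish. *)
Theorem Lnorm_pos_part_le :
  'N[P]_p%:E[EFin \o (fun w => pos_part (f (eta w) - m))] <=
  sqrte ((2 * kappa R * p)%:E * 'N[P]_(p / 2)%:E[V]).
Proof.
have k1 := kappa_ge1 R.
have k0 : (0 < kappa R)%R by exact: lt_le_trans ltr01 k1.
have c0 : (0 < 2 * kappa R * p)%R by exact: mulr_gt0 (mulr_gt0 (ltr0Sn R 1) k0) p0.
have V0 w : 0 <= V w by exact: full_variation_ge0.
have -> : 'N[P]_p%:E[EFin \o (fun w => pos_part (f (eta w) - m))] =
    (\int[P]_w (pos_part (f (eta w) - m) `^ p)%:E) `^ p^-1.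
  rewrite Lnorm_finE; apply: (congr1 (fun I => I `^ p^-1)).
  apply: eq_integral => w _ /=.
  by rewrite ger0_norm// /pos_part le_max lexx.
have -> : 'N[P]_(p / 2)%:E[V] = (\int[P]_w (V w `^ (p / 2))) `^ (p / 2)^-1.
  rewrite Lnorm_finE; apply: (congr1 (fun I => I `^ (p / 2)^-1)).
  by apply: eq_integral => w _; rewrite gee0_abs.
have : 0 <= \int[P]_w (V w `^ (p / 2)) by apply: integral_ge0 => w _; exact: poweR_ge0.
case IE : (\int[P]_w (V w `^ (p / 2))) => [r| |]//; last first.
  have nz : ((p / 2)^-1 != 0)%R by rewrite invr_neq0// gt_eqF.
  by move=> _; rewrite (poweRyr nz) gt0_muley ?lte_fin//; exact: leey.
rewrite lee_fin => r0; pose a := (r `^ (p / 2)^-1)%R.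
have a0 : (0 <= a)%R by exact: powR_ge0.
have ar : (a `^ (p / 2) = r)%R by rewrite /a -powRrM mulVf ?gt_eqF// powRr1.
have J0 : 0 <= \int[P]_w (pos_part (f (eta w) - m) `^ p)%:E.
  by apply: integral_ge0 => w _; rewrite lee_fin powR_ge0.
have step (eps : R) : (0 < eps)%R ->
    \int[P]_w (pos_part (f (eta w) - m) `^ p)%:E <=
    ((2 * (p - 1) * (a + eps)) `^ (p / 2))%:E.
  move=> e0; apply: moment; first by rewrite ltr_wpDl.
  rewrite IE lee_fin -ar ge0_ler_powR ?nnegrE ?(ltW ph)//; last by rewrite lerDl ltW.
  by rewrite addr_ge0// ltW.
move: J0 step; case: (\int[P]_w _) => [j| |]//; last by move=> _ /(_ _ ltr01).
rewrite lee_fin => j0 step; rewrite !poweR_EFin -/a -EFinM /= lee_fin.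
set y := (j `^ p^-1)%R; have y0 : (0 <= y)%R by exact: powR_ge0.
have yj : ((y ^+ 2) `^ (p / 2) = j)%R.
  by rewrite sqr_powR_half// /y -powRrM mulVf ?gt_eqF// powRr1.
have q1 : (0 < 2 * (p - 1))%R by have := p2; lra.
have ysq : (y ^+ 2 <= 2 * (p - 1) * a)%R.
  apply/ler_addgt0Pr => eps e0.
  have e'0 : (0 < eps / (2 * (p - 1)))%R by rewrite divr_gt0.
  have := step _ e'0; rewrite lee_fin -yj mulrDr mulrCA divff ?gt_eqF// mulr1.
  rewrite leNgt; apply: contraNle => lt.
  apply: gt0_ltr_powR => //; rewrite nnegrE ?sqr_ge0//.
  by apply: addr_ge0; [exact: mulr_ge0 (ltW q1) a0|exact: ltW].
rewrite -(ger0_norm y0) -sqrtr_sqr ler_sqrt; last exact: mulr_ge0 (ltW c0) a0.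
apply: (le_trans ysq); rewrite ler_wpM2r//.
by have := p0; nra.
Qed.

End norm_bound.


(** * The moment inequalities *)

Theorem theorem4p1 (R : realType)
    (d : measure_display) (X : measurableType d)
    (d' : measure_display) (Omega : measurableType d')
    (P : probability Omega R)
    (mu : {measure set X -> \bar R}) (mu_sfin : sigma_finite [set: X] mu)
    (eta : Omega -> counting_space X R) (eta_poisson : is_poisson_process P mu eta)
    (p : R) (p_ge2 : (2 <= p)%R)
    (F : Omega -> R) (f : counting_space X R -> R)
    (F_L1 : F \in Lfun P 1) (F_rep : is_representative P eta F f) :
  let Fc := fun w => (F w - fine 'E_P[F])%R in
  let Vp := fun w => Vplus mu f (eta w) in
  let Vm := fun w => Vminus mu f (eta w) in
  let V := fun w => Vfull mu f (eta w) in
  [/\ 'N[P]_p%:E[EFin \o (@pos_part R \o Fc)]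
         <= sqrte ((2 * kappa R * p)%:E * 'N[P]_(p / 2)%:E[Vp]) /\
       sqrte ((2 * kappa R * p)%:E * 'N[P]_(p / 2)%:E[Vp])
         = (Num.sqrt (2 * kappa R * p))%:E * 'N[P]_p%:E[@sqrte R \o Vp],
      'N[P]_p%:E[EFin \o (@neg_part R \o Fc)]
         <= sqrte ((2 * kappa R * p)%:E * 'N[P]_(p / 2)%:E[Vm]) /\
       sqrte ((2 * kappa R * p)%:E * 'N[P]_(p / 2)%:E[Vm])
         = (Num.sqrt (2 * kappa R * p))%:E * 'N[P]_p%:E[@sqrte R \o Vm] &
      'N[P]_p%:E[EFin \o Fc]
         <= sqrte ((8 * kappa R * p)%:E * 'N[P]_(p / 2)%:E[V]) /\
       sqrte ((8 * kappa R * p)%:E * 'N[P]_(p / 2)%:E[V])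
         = (Num.sqrt (8 * kappa R * p))%:E * 'N[P]_p%:E[@sqrte R \o V] ].
Proof.
move=> Fc Vp Vm V; have [mf Ff] := F_rep.
have meta : measurable_fun [set: Omega] eta := poisson_process_measurable eta_poisson.
have mfe : measurable_fun [set: Omega] (fun w => f (eta w)).
  exact: measurableT_comp mf meta.
have iF := (Lfun1_integrable P F).1 F_L1.
have mF : measurable_fun [set: Omega] F.
  by apply/measurable_EFinP; exact: measurable_int iF.
have ifeta : P.-integrable [set: Omega] (fun w => (f (eta w))%:E).
  have /integrableP[_ fin] := iF; apply/integrableP; split.
    exact/measurable_EFinP.
  rewrite (_ : \int[P]_w `|(f (eta w))%:E| = \int[P]_w `|(F w)%:E|)//.
  apply: ae_eq_integral => //.
  - by apply: measurableT_comp => //; exact/measurable_EFinP.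
  - by apply: measurableT_comp => //; exact/measurable_EFinP.
  - by apply: filterS Ff => w /= -> _.
pose m : R := fine (\int[P]_w (f (eta w))%:E).
have EF : fine 'E_P[F] = m.
  rewrite expectation.unlock /m; congr fine; apply: ae_eq_integral => //.
  - exact/measurable_EFinP.
  - exact/measurable_EFinP.
  - by apply: filterS Ff => w /= -> _.
have p0 : (0 < p)%R by exact: lt_le_trans p_ge2.
have ph : (0 < p / 2)%R by rewrite divr_gt0.
have k1 := kappa_ge1 R.
have k0 : (0 <= kappa R)%R by exact: le_trans ler01 k1.
have c20 : (0 <= 2 * kappa R * p)%R by exact: mulr_ge0 (mulr_ge0 (ler0n R 2) k0) (ltW p0).
have c80 : (0 <= 8 * kappa R * p)%R by exact: mulr_ge0 (mulr_ge0 (ler0n R 8) k0) (ltW p0).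
have sq0 (D : set X) (m' : {measure set X -> \bar R}) (u : X -> R) :
    0 <= \int[m']_x ((u x) ^+ 2)%:E.
  by apply: integral_ge0 => x _; rewrite lee_fin sqr_ge0.
have Vp0 w : 0 <= Vp w by apply: adde_ge0; exact: (sq0 setT).
have Vm0 w : 0 <= Vm w by apply: adde_ge0; exact: (sq0 setT).
have V0 w : 0 <= V w by apply: adde_ge0; exact: (sq0 setT).
have ef xi x : eval_sub_dirac f (add_dirac xi x) x = f xi.
  by apply: eval_sub_diracE => // B mB; exact: add_diracE.
have negE (x : R) : neg_part x = (- pos_part (- x))%R.
  by rewrite /neg_part /pos_part -{1}oppr0 oppr_max oppr0 opprK.
have mFc : measurable_fun [set: Omega] Fc.
  by apply: measurable_funB => //; exact: measurable_cst.
have mpos (g : Omega -> R) : measurable_fun [set: Omega] g ->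
    measurable_fun [set: Omega] (fun w => pos_part (g w)).
  by move=> mg; apply: measurable_maxr => //; exact: measurable_cst.
have pos : 'N[P]_p%:E[EFin \o (@pos_part R \o Fc)]
    <= sqrte ((2 * kappa R * p)%:E * 'N[P]_(p / 2)%:E[Vp]).
  have -> : 'N[P]_p%:E[EFin \o (@pos_part R \o Fc)] =
      'N[P]_p%:E[EFin \o (fun w => pos_part (f (eta w) - m))].
    apply: Lnorm_ae_eq; first exact: mpos.
    - by apply: mpos; apply: measurable_funB => //; exact: measurable_cst.
    - by apply: filterS Ff => w /= Fw; rewrite /Fc EF Fw.
  have := Lnorm_pos_part_le mu_sfin eta_poisson mf (measurable_eval_sub_dirac mf) ef
    ifeta p_ge2.
  have -> : (fun w => full_variation mu f (eval_sub_dirac f) (eta w)) = Vp.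
    apply/funext => w; congr (_ + _); apply: eq_integral => x _.
    by rewrite negE sqrrN /decrease /add_cost opprB.
  by [].
have neg : 'N[P]_p%:E[EFin \o (@neg_part R \o Fc)]
    <= sqrte ((2 * kappa R * p)%:E * 'N[P]_(p / 2)%:E[Vm]).
  pose g xi := (- f xi)%R; pose eg xi x := (- eval_sub_dirac f xi x)%R.
  have mg : measurable_fun [set: counting_space X R] g by exact: measurableT_comp mf.
  have meg : measurable_fun setT (fun q : counting_space X R * X => eg q.1 q.2).
    exact: measurableT_comp (measurable_eval_sub_dirac mf).
  have eg_g xi x : eg (add_dirac xi x) x = g xi by rewrite /eg ef.
  have ig : P.-integrable [set: Omega] (fun w => (g (eta w))%:E).
    by under eq_fun do rewrite EFinN; exact: integrableN.
  have gm : fine (\int[P]_w (g (eta w))%:E) = (- m)%R.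
    rewrite /m -fineN -integralN; first by congr fine; apply: eq_integral.
    exact: integrable_add_def.
  have := Lnorm_pos_part_le mu_sfin eta_poisson mg meg eg_g ig p_ge2.
  have -> : (fun w => full_variation mu g eg (eta w)) = Vm.
    apply/funext => w; congr (_ + _); apply: eq_integral => x _.
      by rewrite /decrease /add_cost /g opprK addrC.
    by rewrite negE sqrrN /remove_cost /g /eg opprB opprK addrC.
  apply: le_trans; rewrite gm.
  have -> : 'N[P]_p%:E[EFin \o (@neg_part R \o Fc)] =
      'N[P]_p%:E[EFin \o (@pos_part R \o (fun w => (- Fc w)%R))].
    rewrite !Lnorm_finE; apply: (congr1 (fun I => I `^ p^-1)).
    apply: eq_integral => w _ /=.
    by rewrite negE normrN.
  rewrite le_eqVlt; apply/orP; left; apply/eqP; apply: Lnorm_ae_eq.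
  - by apply: mpos; exact: measurableT_comp mFc.
  - apply: mpos; apply: measurable_funB; last exact: measurable_cst.
    exact: measurableT_comp mg meta.
  - by apply: filterS Ff => w /= Fw; rewrite /Fc EF Fw /g opprB opprK addrC.
split; split => //; try exact: sqrte_Lnorm.
have sqp (x : R) : ((pos_part x) ^+ 2 <= x ^+ 2)%R.
  by rewrite /pos_part; case: (leP 0%R x) => ?; nra.
have sqn (x : R) : ((neg_part x) ^+ 2 <= x ^+ 2)%R.
  by rewrite /neg_part; case: (leP 0%R x) => ?; nra.
have VpV w : Vp w <= V w.
  by apply: leeD; apply: ge0_le_integral_simple => x; rewrite lee_fin ?sqr_ge0.
have VmV w : Vm w <= V w.
  by apply: leeD; apply: ge0_le_integral_simple => x; rewrite lee_fin ?sqr_ge0.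
have bound (W : Omega -> \bar R) : (forall w, 0 <= W w) -> (forall w, W w <= V w) ->
    sqrte ((2 * kappa R * p)%:E * 'N[P]_(p / 2)%:E[W]) <=
    sqrte ((2 * kappa R * p)%:E * 'N[P]_(p / 2)%:E[V]).
  move=> W0 WV; rewrite lee_sqrt ?mule_ge0 ?lee_fin ?Lnorm_ge0//.
  by apply: lee_wpmul2l; [rewrite lee_fin|exact: ge0_le_Lnorm].
have -> : EFin \o Fc = EFin \o ((@pos_part R \o Fc) \+ (@neg_part R \o Fc))%R.
  apply/funext => w /=; congr EFin; rewrite /pos_part /neg_part.
  by case: (leP 0%R (Fc w)) => ?; rewrite ?addr0 ?add0r.
have mneg : measurable_fun [set: Omega] (@neg_part R \o Fc).
  by apply: measurable_minr => //; exact: measurable_cst.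
have p1 : (1 <= p)%R by apply: le_trans p_ge2; rewrite ler1n.
apply: (le_trans (minkowski_EFin P (mpos _ mFc) mneg p1)).
have -> : sqrte ((8 * kappa R * p)%:E * 'N[P]_(p / 2)%:E[V]) =
    2%:E * sqrte ((2 * kappa R * p)%:E * 'N[P]_(p / 2)%:E[V]).
  have -> : (8 * kappa R * p)%:E = (2 ^+ 2)%:E * (2 * kappa R * p)%:E.
    by rewrite -EFinM; congr EFin; ring.
  rewrite -muleA sqrteM ?lee_fin ?sqr_ge0//=.
  by rewrite sqrtr_sqr ger0_norm.
rewrite -[2%R]/(1 + 1)%R EFinD ge0_muleDl ?lee_fin// !mul1e.
by apply: leeD; [apply: le_trans pos _|apply: le_trans neg _]; exact: bound.
Qed.
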